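(* Suppose that the rows $(X_{n,i})_{1\le i\le n}$ are stationary, that $\ell_n\to\infty$, $\ell_n=o(r_n)$, $r_n=o(n)$, $r_nv_n\to 0$, $nv_n\to\infty$, and that $\beta_{n,\ell_n}\,n/r_n\to 0$. Let $\mathcal{F}$ be a class of cluster functionals such that the following three conditions hold. (1) For all $f\in\mathcal{F}$, with $\bar\Delta_n(f):=\Delta_n(f)-E\Delta_n(f)$, $$E\big(\bar\Delta_n(f)^2\mathbf{1}_{\{|\bar\Delta_n(f)|\le\sqrt{nv_n}\}}\big)=o(r_nv_n),\quad E\big(\bar\Delta_n(f)\mathbf{1}_{\{|\bar\Delta_n(f)|>\sqrt{nv_n}\}}\big)=o\big(r_n\sqrt{v_n/n}\big),\quad P\{|\bar\Delta_n(f)|>\sqrt{nv_n}\}=o(r_n/n).$$ (2) $E\big((f(Y_n)-Ef(Y_n))^2\mathbf{1}_{\{|f(Y_n)-Ef(Y_n)|>\varepsilon\sqrt{nv_n}\}}\big)=o(r_nv_n)$ for all $\varepsilon>0$ and $f\in\mathcal{F}$. (3) There is a function $c:\mathcal{F}^2\to\mathbb{R}$ with $\frac{1}{r_nv_n}\mathrm{Cov}\big(f(Y_n),g(Y_n)\big)\to c(f,g)$ for all $f,g\in\mathcal{F}$. Then the finite-dimensional distributions of the empirical process $(Z_n(f))_{f\in\mathcal{F}}$ of cluster functionals converge weakly to the finite-dimensional distributions of a Gaussian process $(Z(f))_{f\in\mathcal{F}}$ with covariance function $c$.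
   Context: Let $d\in\mathbb{N}$, let $E\subset\mathbb{R}^d$ be measurable with $0\in E$, and let $(X_{n,i})_{1\le i\le n,\,n\in\mathbb{N}}$ be a triangular array of row-wise stationary $E$-valued random variables. Put $v_n:=P\{X_{n,1}\neq 0\}$. Let $(r_n)$ and $(\ell_n)$ be sequences of positive integers, $m_n:=\lfloor n/r_n\rfloor$, and define the blocks $Y_{n,j}:=(X_{n,i})_{(j-1)r_n+1\le i\le jr_n}$, $1\le j\le m_n$; $Y_n$ denotes a generic block, i.e. $Y_n\stackrel{d}{=}Y_{n,1}$. All limits and $o(\cdot)$ are for $n\to\infty$; expectations occurring are understood to exist. For a vector $x$, $x^{(k)}=(x_1,\dots,x_k)$ denotes its first $k$ components (and $x^{(k)}=x$ if $x$ has fewer than $k$ components). $E_\cup:=\bigcup_{l\in\mathbb{N}}E^l$ is equipped with the $\sigma$-field induced by the Borel $\sigma$-fields on $E^l$. For $x=(x_1,\dots,x_k)\in E^k$ the core is $x^c:=(x_l)_{l_1\le l\le l_2}$ if $x\ne(0,\dots,0)$, where $l_1=\min\{i: x_i\neq0\}$, $l_2=\max\{i:x_i\ne0\}$, and $x^c:=0$ otherwise. A cluster functional is a measurable map $f:E_\cup\to\mathbb{R}$ with $f(x)=f(x^c)$ for all $x\in E_\cup$ and $f(0)=0$. The empirical process of cluster functionals is $Z_n(f):=\frac{1}{\sqrt{nv_n}}\sum_{j=1}^{m_n}\big(f(Y_{n,j})-Ef(Y_{n,j})\big)$, $f\in\mathcal{F}$. Further $\Delta_n(f):=f(Y_n)-f(Y_n^{(r_n-\ell_n)})$.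 The $\beta$-mixing coefficients are $\beta_{n,k}:=\sup_{1\le l\le n-k-1}E\big(\sup_{B\in\mathcal{B}_{n,l+k+1}^n}|P(B\mid\mathcal{B}_{n,1}^l)-P(B)|\big)$, where $\mathcal{B}_{n,i}^j$ is the $\sigma$-field generated by $(X_{n,l})_{i\le l\le j}$ (the inner supremum is understood as an essential supremum). *)

(* Defs.v *)
From HB Require Import structures.
From mathcomp Require Import all_boot all_order all_algebra.
From mathcomp Require Import all_classical all_reals all_analysis.
From mathcomp Require Import measurable_realfun lebesgue_stieltjes_measure.

Set Implicit Arguments.
Unset Strict Implicit.
Unset Printing Implicit Defensive.

Import Order.TTheory GRing.Theory Num.Theory.
Import numFieldNormedType.Exports.

Local Open Scope classical_set_scope.
Local Open Scope ring_scope.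

(* R^d is [d.-tuple R]: the library gives tuples the product of the Borel
   sigma-algebras of the factors, which on R^d and on (R^d)^l is the Borel
   sigma-algebra.  Finite sequences of vectors are [seq (d.-tuple R)]. *)
Definition vzero (R : realType) (d : nat) : d.-tuple R := [tuple 0 | i < d].

(* [find] is 0-based: [find nz x] is l_1 - 1, and
   [size x - find nz (rev x)] is l_2. *)
Definition core (R : realType) (d : nat) (x : seq (d.-tuple R)) :
    seq (d.-tuple R) :=
  let nz := fun v : d.-tuple R => v != vzero R d in
  if has nz x
  then drop (find nz x) (take (size x - find nz (rev x)) x)
  else [:: vzero R d].

(* The union of the E^l over l >= 1. *)
Definition Ecup (R : realType) (d : nat) (E : set (d.-tuple R)) :
    set (seq (d.-tuple R)) :=
  [set x | x <> [::] /\ forall v, v \in x -> E v].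

(* Only the values of [f] on [Ecup E] matter.  A set is measurable in the
   sigma-algebra of [Ecup E] iff its trace on each E^l is Borel, whence the
   first clause. *)
Definition cluster_functional (R : realType) (d : nat) (E : set (d.-tuple R))
    (f : seq (d.-tuple R) -> R) : Prop :=
  [/\ forall l : nat,
        measurable_fun [set x : l.-tuple (d.-tuple R) | Ecup E x]
          (fun x : l.-tuple (d.-tuple R) => f x),
      forall x, Ecup E x -> f x = f (core x)
    & f [:: vzero R d] = 0].

Section array.
Context {R : realType} {d : nat} {disp : measure_display}
  {T : measurableType disp} (P : probability T R).

(* [X n i] is X_{n,i}; it is meaningful for 1 <= i <= n only. *)
Variable X : nat -> nat -> T -> d.-tuple R.

Definition rowwise_stationary : Prop :=
  forall (n k h : nat) (t : k.-tuple nat),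
    (forall i, (1 <= tnth t i)%N /\ (tnth t i + h <= n)%N) ->
    forall B : set (k.-tuple (d.-tuple R)), measurable B ->
      P ((fun w => [tuple X n (tnth t i + h) w | i < k]) @^-1` B) =
      P ((fun w => [tuple X n (tnth t i) w | i < k]) @^-1` B).

Definition vprob (n : nat) : R := fine (P [set w | X n 1 w != vzero R d]).

Variables r l : nat -> nat.

(* Blocks are numbered from j = 1; [block n 1] is the generic block Y_n. *)
Definition block (n j : nat) (w : T) : seq (d.-tuple R) :=
  [seq X n i w | i <- iota ((j - 1) * r n + 1) (r n)].

Definition Zproc (n : nat) (f : seq (d.-tuple R) -> R) (w : T) : R :=
  (Num.sqrt (n%:R * vprob n))^-1 *
  \sum_(1 <= j < (n %/ r n).+1)
    (f (block n j w) - fine 'E_P[fun w' => f (block n j w')]).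

Definition Delta (n : nat) (f : seq (d.-tuple R) -> R) (w : T) : R :=
  f (block n 1 w) - f (take (r n - l n) (block n 1 w)).

Definition row_sigma (n i j : nat) : set (set T) :=
  <<s \bigcup_(k in [set k | (i <= k <= j)%N])
        preimage_set_system setT (X n k) measurable >>.

End array.

Section conditioning.
Context {R : realType} {disp : measure_display} {T : measurableType disp}
  (P : probability T R).

Definition is_cond_prob (G : set (set T)) (B : set T) (h : T -> R) : Prop :=
  [/\ forall C : set R, measurable C -> G (h @^-1` C),
      P.-integrable setT (EFin \o h)
    & forall A, G A -> (\int[P]_(w in A) (h w)%:E = P (A `&` B))%E].

(* P(B | G), by choice of a version. *)
Definition cond_prob (G : set (set T)) (B : set T) : T -> R :=
  xget (cst 0) [set h | is_cond_prob G B h].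

Definition is_ess_sup_family (S : set (T -> \bar R)) (g : T -> \bar R) : Prop :=
  [/\ measurable_fun setT g,
      forall h, S h -> {ae P, forall w, (h w <= g w)%E}
    & forall g', measurable_fun setT g' ->
        (forall h, S h -> {ae P, forall w, (h w <= g' w)%E}) ->
        {ae P, forall w, (g w <= g' w)%E}].

(* Essential supremum of a family of functions, unique up to P-null sets. *)
Definition ess_sup_family (S : set (T -> \bar R)) : T -> \bar R :=
  xget (cst 0%E) [set g | is_ess_sup_family S g].

End conditioning.

Definition beta_mixing (R : realType) (d : nat) (disp : measure_display)
    (T : measurableType disp) (P : probability T R)
    (X : nat -> nat -> T -> d.-tuple R) (n k : nat) : \bar R :=
  ereal_sup
    [set (\int[P]_w
            ess_sup_family P
              [set (fun w' => `|cond_prob P (row_sigma X n 1 l) B w'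
                                 - fine (P B)|%:E)
              | B in row_sigma X n (l + k + 1) n] w)%E
    | l in [set l | (1 <= l)%N /\ (l + k + 1 <= n)%N]].

(* a_n = o(b_n) for extended real a_n, so that infinite or undefined
   expectations are not silently truncated to real numbers. *)
Definition elittleo (R : realType) (a : nat -> \bar R) (b : nat -> R) : Prop :=
  forall e : R, 0 < e -> \forall n \near \oo, (`|a n| <= (e * `|b n|)%:E)%E.

Section limits.
Context {R : realType}.

(* Degenerate laws are included; [normal_prob m 0] is not a Dirac mass. *)
Definition gaussian_rv (disp : measure_display) (T : measurableType disp)
    (Q : probability T R) (Y : T -> R) : Prop :=
  measurable_fun setT Y /\
  exists m s : R, 0 <= s /\
    forall B : set R, measurable B ->
      Q (Y @^-1` B) = if s == 0 then \d_m B else normal_prob m s B.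

Definition centered_gaussian_process (disp : measure_display)
    (T : measurableType disp) (Q : probability T R) (I : Type) (F : set I)
    (c : I -> I -> R) (Z : I -> T -> R) : Prop :=
  [/\ forall (k : nat) (t : 'I_k -> I) (a : 'I_k -> R), (forall j, F (t j)) ->
        gaussian_rv Q (fun w => \sum_(j < k) a j * Z (t j) w),
      forall i, F i -> ('E_Q[Z i] = 0)%E
    & forall i j, F i -> F j -> (covariance Q (Z i) (Z j) = (c i j)%:E)%E].

Definition cvg_in_law (k : nat) (disp : measure_display)
    (T : measurableType disp) (P : probability T R) (U : nat -> T -> 'rV[R]_k)
    (disp' : measure_display) (T' : measurableType disp')
    (Q : probability T' R) (V : T' -> 'rV[R]_k) : Prop :=
  forall g : 'rV[R]_k -> R, continuous g ->
    (exists M : R, forall x, `|g x| <= M) ->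
    ('E_P[fun w => g (U n w)])%E @[n --> \oo] --> ('E_Q[fun w => g (V w)])%E.

Definition fidi_cvg (I : Type) (F : set I) (disp : measure_display)
    (T : measurableType disp) (P : probability T R) (U : nat -> I -> T -> R)
    (disp' : measure_display) (T' : measurableType disp')
    (Q : probability T' R) (Z : I -> T' -> R) : Prop :=
  forall (k : nat) (t : 'I_k -> I), (forall j, F (t j)) ->
    cvg_in_law P (fun n w => \row_(j < k) U n (t j) w)
               Q (fun w => \row_(j < k) Z (t j) w).

End limits.

(* Main.v *)
Require Import Defs.
From HB Require Import structures.
From mathcomp Require Import all_boot all_order all_algebra.
From mathcomp Require Import all_classical all_reals all_analysis.
From mathcomp Require Import measurable_realfun lebesgue_stieltjes_measure.
From mathcomp Require Import zify ring lra.

Set Implicit Arguments.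
Unset Strict Implicit.
Unset Printing Implicit Defensive.

Import Order.TTheory GRing.Theory Num.Theory.
Import numFieldNormedType.Exports.

Local Open Scope classical_set_scope.
Local Open Scope ring_scope.

(** Write [s = sqrt (n v_n)] and [m = n %/ r_n].  Everything is read off the
    sums [S = \sum_(j < k) a_j Z_n(f_j)].  Such a sum is a sum over the [m]
    blocks of [xi = (1/s) \sum_j a_j (f_j(Y) - E f_j(Y))], and [xi] splits into
    [de], the same combination of the centered differences [Delta_n(f_j)], and
    [zeta = xi - de], which depends on the truncated block only.  Truncated
    blocks are separated by gaps of length [l_n].

    _Dependence._  The covariance of events that are [l_n] apart is at most the
    beta-mixing coefficient ([alpha_le_beta]; this needs the existence of
    conditional probabilities and of essential suprema), hence that of bounded
    variables is at most four times it ([cov_bound]).  No coupling with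
    independent blocks is constructed.  Instead the addition theorem for the
    cosine, applied block after block, compares [E cos (\sum zeta + th)] with
    [(E cos zeta)^m cos th], with error [m (8 beta + |E sin zeta|)]
    ([cos_chain]).  Since [m beta] tends to 0, it remains to know that
    [m E sin zeta --> 0] and [m (1 - E cos zeta) --> V / 2] with [V] the limit
    of [m E xi^2]; both follow from the Lindeberg condition on [xi] and the
    smallness of [de] ([pair_sin_limit], [pair_cos_limit]).  Thus
    [(E cos zeta)^m --> exp (- V / 2)].

    _The remainder._  The sum of the [de] tends to 0 in probability.  The blocks
    of even and of odd index are treated separately, so that consecutive ones
    are again far apart, and the same telescoping is applied to
    [E satq (partial sum)], where [satq x = x^2 / (1 + x^2)] is a smooth bounded
    substitute for the square ([satq_chain]).  This needs only
    [m E sin de --> 0] and [m E min (de^2, 1) --> 0], which is what the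
    truncated moments of the first condition give, although [de] need not have
    a second moment.  Applied to small multiples of [zeta], the same bound gives
    tightness.  Hence [E cos (S + th) --> exp (- V / 2) cos th] and the
    finite-dimensional laws are tight ([Zproc_charfun], [Zproc_tight]).

    _The limit process._  The class of functionals may be uncountable, and the
    limit is built directly on a Loeb space: for an ultrafilter [U] finer than
    [\oo], sequences [w : nat -> T] carry the probability that gives
    [{w | A_n (w_n) for U-most n}] the mass [lim_U P (A_n)], and
    [Z f w = lim_U Z_n f (w_n)].  By tightness [Z f] is almost surely finite,
    and [E_Q (lim_U h_n (w_n)) = lim_U E_P h_n] for bounded [h]
    ([Ex_stdpart]).  So linear combinations of [Z] have the characteristic
    function [exp (- V / 2)], which identifies their law ([law_unique]), and
    the Cauchy form of Levy's theorem ([levy_cvg]), proved by approximation with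
    trigonometric polynomials, turns convergence of characteristic functions
    and tightness into convergence of [E g(Z_n)], necessarily to its
    [U]-limit [E_Q g(Z)] ([gaussian_limit]). *)

(** * Elementary trigonometric bounds *)
Section trig_bounds.
Context {R : realType}.
Implicit Types x y : R.

Lemma sin_le_norm x : `|sin x| <= `|x|.
Proof.
wlog x0 : x / 0 <= x.
  move=> h; have [/h//|/ltW x0] := leP 0 x.
  by rewrite -normrN -sinN -[leRHS]normrN h// oppr_ge0.
have [c _] := @MVT_segment R sin cos 0 x x0
  (fun c _ => is_derive_sin c) (continuous_subspaceT (@continuous_sin R)).
rewrite sin0 !subr0 => ->; rewrite normrM ler_piMl//; exact: cos_max.
Qed.

Lemma cos_bounds x : 0 <= 1 - cos x <= x ^+ 2 / 2.
Proof.
rewrite subr_ge0 cos_le1/= (_ : cos x = cos ((x / 2) *+ 2)); last first.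
  by congr cos; rewrite -mulr_natr; field.
have := sin_le_norm (x / 2); rewrite -ler_sqr ?nnegrE// !real_normK ?num_real//.
rewrite cos_mulr2n cos2sin2 exprMn; move: (sin _) => s.
have -> : 2^-1 ^+ 2 = 4^-1 :> R by field.
by have := sqr_ge0 s => s0 sx; lra.
Qed.

Lemma sin_id_bound x : `|sin x - x| <= `|x| ^+ 3 / 2.
Proof.
wlog x0 : x / 0 <= x.
  move=> h; have [/h//|/ltW x0] := leP 0 x.
  have -> : `|sin x - x| = `|sin (- x) - (- x)|.
    by rewrite sinN -normrN; congr (`| _ |); ring.
  by rewrite -[in leRHS]normrN h// oppr_ge0.
have [c] := @MVT_segment R sin cos 0 x x0
  (fun c _ => is_derive_sin c) (continuous_subspaceT (@continuous_sin R)).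
rewrite in_itv/= => /andP[c0 cx]; rewrite sin0 !subr0 => ->.
have /andP[h1 h2] := cos_bounds c.
rewrite (_ : _ * x - x = - ((1 - cos c) * x)) ?normrN; last by ring.
rewrite normrM !ger0_norm// (_ : _ / 2 = x ^+ 2 / 2 * x); last by field.
by rewrite ler_wpM2r// (le_trans h2)// ler_wpM2r// ler_sqr ?nnegrE// (le_trans c0).
Qed.

Lemma cos_quadratic_bound x : `|1 - cos x - x ^+ 2 / 2| <= x ^+ 4 / 8.
Proof.
have [y ->] : exists y, x = y *+ 2 by exists (x / 2); rewrite -mulr_natr; field.
rewrite cos_mulr2n cos2sin2.
have -> : 1 - ((1 - sin y ^+ 2) *+ 2 - 1) - (y *+ 2) ^+ 2 / 2 =
  2 * ((sin y - y) * (sin y + y)) by rewrite -(mulr_natr y); field.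
have -> : (y *+ 2) ^+ 4 / 8 = 2 * (`|y| ^+ 3 / 2 * (2 * `|y|)).
  rewrite (_ : _ * _ = (`|y| ^+ 2) ^+ 2 * 2); last by field.
  by rewrite real_normK ?num_real// -mulr_natr; field.
rewrite !normrM (ger0_norm (ler0n R 2)) ler_wpM2l// ler_pM ?sin_id_bound//.
by rewrite (le_trans (ler_normD _ _))// [leRHS]mulrDl mul1r lerD2r sin_le_norm.
Qed.

End trig_bounds.

(** * Real-valued expectations *)
Definition integ (R : realType) (disp : measure_display)
  (T : measurableType disp) (P : probability T R) (f : T -> R) :=
  P.-integrable setT (EFin \o f).

Definition Ex (R : realType) (disp : measure_display)
  (T : measurableType disp) (P : probability T R) (f : T -> R) : R :=
  (\int[P]_(w in setT) f w)%R.

Definition bddmeas (R : realType) (disp : measure_display)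
  (T : measurableType disp) (f : T -> R) :=
  measurable_fun setT f /\ exists M, forall w, `|f w| <= M.

Section expectation.
Context {R : realType} {disp : measure_display} {T : measurableType disp}
  (P : probability T R).
Implicit Types f g : T -> R.

Lemma bddmeas_cst (a : R) : bddmeas (cst a : T -> R).
Proof. by split=> //; exists `|a|. Qed.

Lemma bddmeasD f g : bddmeas f -> bddmeas g -> bddmeas (fun w => f w + g w).
Proof.
move=> [mf [M fM]] [mg [N gN]]; split; first exact: measurable_funD.
by exists (M + N) => w; rewrite (le_trans (ler_normD _ _))// lerD.
Qed.

Lemma bddmeasM f g : bddmeas f -> bddmeas g -> bddmeas (fun w => f w * g w).
Proof.
move=> [mf [M fM]] [mg [N gN]]; split; first exact: measurable_funM.
by exists (M * N) => w; rewrite normrM ler_pM.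
Qed.

Lemma bddmeasZ (a : R) f : bddmeas f -> bddmeas (fun w => a * f w).
Proof. by move=> bf; apply: bddmeasM => //; exact: bddmeas_cst. Qed.

Lemma bddmeasN f : bddmeas f -> bddmeas (fun w => - f w).
Proof.
by move=> /(bddmeasZ (-1)); congr bddmeas; apply/funext => w; rewrite mulN1r.
Qed.

Lemma bddmeasB f g : bddmeas f -> bddmeas g -> bddmeas (fun w => f w - g w).
Proof. by move=> bf bg; apply: bddmeasD => //; exact: bddmeasN. Qed.

Lemma bddmeas_indic (A : set T) : measurable A -> bddmeas (\1_A : T -> R).
Proof.
move=> mA; split; first exact: measurable_indic.
by exists 1 => w; rewrite indicE; case: (w \in A); rewrite ?normr1 ?normr0.
Qed.

Lemma bddmeas_integ f : bddmeas f -> integ P f.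
Proof.
move=> [mf [M fM]]; apply: measurable_bounded_integrable => //.
  exact: fin_num_fun_lty.
exists M; split; first exact: num_real.
by move=> x Mx y _ /=; rewrite (le_trans (fM y))// ltW.
Qed.

Lemma integ_meas f : integ P f -> measurable_fun setT f.
Proof. by move=> /measurable_int /measurable_EFinP. Qed.

Lemma integD f g : integ P f -> integ P g -> integ P (fun w => f w + g w).
Proof. by move=> pf pg; have := integrableD measurableT pf pg. Qed.

Lemma integB f g : integ P f -> integ P g -> integ P (fun w => f w - g w).
Proof. by move=> pf pg; have := integrableB measurableT pf pg. Qed.

Lemma integZ (a : R) f : integ P f -> integ P (fun w => a * f w).
Proof. by move=> pf; have := integrableZl measurableT a pf. Qed.

Lemma integ_cst (a : R) : integ P (fun=> a).
Proof. by apply: bddmeas_integ; exact: bddmeas_cst. Qed.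

Lemma integ_norm f : integ P f -> integ P (fun w => `|f w|).
Proof. exact: integrable_norm. Qed.

Lemma integ_le f g : measurable_fun setT f -> (forall w, `|f w| <= `|g w|) ->
  integ P g -> integ P f.
Proof.
move=> mf fg; apply: le_integrable => //; first exact/measurable_EFinP.
by move=> w _; rewrite /= lee_fin.
Qed.

Lemma integ_sum (I : Type) (s : seq I) (F : I -> T -> R) :
  (forall i, integ P (F i)) -> integ P (fun w => \sum_(i <- s) F i w).
Proof.
move=> iF; elim: s => [|i s ih].
  by under eq_fun do rewrite big_nil; exact: integ_cst.
by under eq_fun do rewrite big_cons; exact: integD.
Qed.

Lemma ExD f g : integ P f -> integ P g ->
  Ex P (fun w => f w + g w) = Ex P f + Ex P g.
Proof. exact: RintegralD. Qed.

Lemma ExB f g : integ P f -> integ P g ->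
  Ex P (fun w => f w - g w) = Ex P f - Ex P g.
Proof. exact: RintegralB. Qed.

Lemma ExZ (a : R) f : integ P f -> Ex P (fun w => a * f w) = a * Ex P f.
Proof. exact: RintegralZl. Qed.

Lemma Ex_sum (I : Type) (s : seq I) (F : I -> T -> R) :
  (forall i, integ P (F i)) ->
  Ex P (fun w => \sum_(i <- s) F i w) = \sum_(i <- s) Ex P (F i).
Proof.
move=> iF; elim: s => [|i s ih].
  by rewrite big_nil -[RHS](mul0r (Ex P (cst 0))) -ExZ; last exact: integ_cst;
     congr (Ex P); apply/funext => w; rewrite big_nil mul0r.
rewrite big_cons -ih -ExD//; last exact: integ_sum.
by congr (Ex P); apply/funext => w; rewrite big_cons.
Qed.

Lemma Ex_cst (a : R) : Ex P (fun=> a) = a.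
Proof. by rewrite /Ex Rintegral_cst//= probability_setT/= mulr1. Qed.

Lemma Ex_le f g : integ P f -> integ P g -> (forall w, f w <= g w) ->
  Ex P f <= Ex P g.
Proof. by move=> pf pg fg; exact: le_Rintegral. Qed.

Lemma Ex_ge0 f : (forall w, 0 <= f w) -> 0 <= Ex P f.
Proof. by move=> f0; exact: Rintegral_ge0. Qed.

Lemma Ex_norm f : integ P f -> `|Ex P f| <= Ex P (fun w => `|f w|).
Proof. by move=> pf; exact: le_normr_Rintegral. Qed.

Lemma Ex_norm_le f g : integ P f -> integ P g -> (forall w, `|f w| <= g w) ->
  `|Ex P f| <= Ex P g.
Proof.
move=> pf pg fg; apply: le_trans (Ex_norm pf) _.
by apply: Ex_le => //; exact: integ_norm.
Qed.

Lemma Ex_bound f (M : R) : integ P f -> (forall w, `|f w| <= M) ->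
  `|Ex P f| <= M.
Proof.
by move=> pf fM; rewrite -(Ex_cst M); apply: Ex_norm_le => //; exact: integ_cst.
Qed.

Lemma Ex_indic (A : set T) : measurable A -> Ex P (\1_A) = fine (P A).
Proof. by move=> mA; rewrite /Ex /Rintegral integral_indic// setIT. Qed.

Lemma EFin_Ex f : integ P f -> ((Ex P f)%:E = \int[P]_w (f w)%:E)%E.
Proof. by move=> pf; rewrite /Ex /Rintegral fineK// integrable_fin_num. Qed.

End expectation.

(** * Telescoping along weakly dependent sums *)
Section chain.
Context {R : realType} {disp : measure_display} {T : measurableType disp}
  (P : probability T R).

Lemma bddmeas_comp (phi : R -> R) (M : R) (X : T -> R) :
  measurable_fun setT phi -> (forall x, `|phi x| <= M) ->
  measurable_fun setT X -> bddmeas (fun w => phi (X w)).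
Proof.
by move=> mphi phiM mX; split; [exact: measurableT_comp | exists M].
Qed.

Lemma bddmeas_cos (X : T -> R) : measurable_fun setT X ->
  bddmeas (fun w => cos (X w)).
Proof.
move=> mX; apply: (bddmeas_comp _ (@cos_max R) mX).
by apply: continuous_measurable_fun => x; exact: continuous_cos.
Qed.

Lemma bddmeas_sin (X : T -> R) : measurable_fun setT X ->
  bddmeas (fun w => sin (X w)).
Proof.
move=> mX; apply: (bddmeas_comp _ (@sin_max R) mX).
by apply: continuous_measurable_fun => x; exact: continuous_sin.
Qed.

Lemma measurable_fun_add_cst (X : T -> R) (a : R) : measurable_fun setT X ->
  measurable_fun setT (fun w => X w + a).
Proof. by move=> mX; exact: measurable_funD. Qed.

Definition unit_test (phi : R -> R) :=
  measurable_fun setT phi /\ forall x, `|phi x| <= 1.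

Lemma unit_test_cos (th : R) : unit_test (fun x => cos (x + th)).
Proof.
split; last by move=> x; exact: cos_max.
apply: (measurableT_comp (f := @cos R)); last exact: measurable_funD.
by apply: continuous_measurable_fun => x; exact: continuous_cos.
Qed.

Lemma unit_test_sin (th : R) : unit_test (fun x => sin (x + th)).
Proof.
split; last by move=> x; exact: sin_max.
apply: (measurableT_comp (f := @sin R)); last exact: measurable_funD.
by apply: continuous_measurable_fun => x; exact: continuous_sin.
Qed.

(** Unlike [min (x^2, 1)], this function is smooth, so that increments can be
    expanded to second order; its derivative is a bounded test function. *)
Definition satq (x : R) : R := x ^+ 2 / (1 + x ^+ 2).

Lemma satq_ge0 x : 0 <= satq x.
Proof. by rewrite divr_ge0// ?sqr_ge0// addr_ge0// sqr_ge0. Qed.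

Lemma satq_le1 x : satq x <= 1.
Proof.
by rewrite ler_pdivrMr ?mul1r ?lerDr// ltr_pwDl// sqr_ge0.
Qed.

Let satq' (x : R) : R := (2 * x) / (1 + x ^+ 2) ^+ 2.

Let den_gt0 (x : R) : 0 < 1 + x ^+ 2.
Proof. by rewrite ltr_pwDl// sqr_ge0. Qed.

Let satq'_le1 x : `|satq' x| <= 1.
Proof.
have a0 := den_gt0 x.
rewrite normrM normfV (ger0_norm (ltW (exprn_gt0 2 a0))).
rewrite ler_pdivrMr ?exprn_gt0// mul1r.
apply: (@le_trans _ _ (1 + x ^+ 2)); last by have := sqr_ge0 x; nra.
by rewrite ler_norml; apply/andP; split; have := sqr_ge0 (x + 1);
  have := sqr_ge0 (x - 1); nra.
Qed.

Lemma measurable_satq : measurable_fun setT satq.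
Proof.
apply: continuous_measurable_fun => x; apply: cvgM; last first.
  apply: cvgV; first by rewrite gt_eqF.
  by apply: cvgD; [exact: cvg_cst | exact: exprn_continuous].
exact: exprn_continuous.
Qed.

Let unit_satq' : unit_test satq'.
Proof.
split; last exact: satq'_le1.
apply: continuous_measurable_fun => x; apply: cvgM; last first.
  apply: cvgV; first by rewrite gt_eqF// exprn_gt0.
  apply: (continuous_comp (f := fun x : R => 1 + x ^+ 2) (g := fun y : R => y ^+ 2)); last exact: exprn_continuous.
  by apply: cvgD; [exact: cvg_cst | exact: exprn_continuous].
by apply: cvgM; [exact: cvg_cst | exact: cvg_id].
Qed.

Let satq_taylor s h : satq (s + h) <= satq s + satq' s * h + h ^+ 2.
Proof.
have a0 := den_gt0 s; have b0 := den_gt0 (s + h).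
have -> : satq s + satq' s * h + h ^+ 2 = satq (s + h) +
   h ^+ 2 * (1 - (1 + (s + h) ^+ 2 - (s + (s + h)) ^+ 2)
             / ((1 + s ^+ 2) ^+ 2 * (1 + (s + h) ^+ 2))).
  by rewrite /satq /satq'; field; rewrite !gt_eqF.
rewrite lerDl mulr_ge0// ?sqr_ge0// subr_ge0 ler_pdivrMr ?mulr_gt0 ?exprn_gt0//.
rewrite mul1r (@le_trans _ _ (1 + (s + h) ^+ 2))//; first by rewrite gerBl sqr_ge0.
by rewrite ler_peMl ?(ltW b0)// exprn_ege1// lerDl sqr_ge0.
Qed.

(** The linear term is replaced by [sin h], a bounded function, so that no
    moment of the increment is needed. *)
Let satq_step s h :
  satq (s + h) <= satq s + satq' s * sin h + 2 * Num.min (h ^+ 2) 1.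
Proof.
have := satq'_le1 s; rewrite ler_norml => /andP[d1 d2].
have [h1|h1] := leP (h ^+ 2) 1.
  apply: (le_trans (satq_taylor s h)).
  have hn1 : `|h| <= 1 by rewrite -(@ler_sqr _ `|h| 1) ?nnegrE// real_normK ?num_real// expr1n.
  have : `|satq' s * (sin h - h)| <= h ^+ 2.
    rewrite normrM -[leRHS]mul1r ler_pM ?satq'_le1//.
    rewrite (le_trans (sin_id_bound h))// -(@real_normK _ h) ?num_real//.
    rewrite exprS -mulrA (le_trans (ler_piMl _ hn1))// ?divr_ge0 ?sqr_ge0//.
    by rewrite ler_pdivrMr// ler_peMr ?sqr_ge0// ler1n.
  by rewrite ler_norml => /andP[? ?]; nra.
rewrite (le_trans (satq_le1 _))// mulr1.
have := satq_ge0 s; have : `|satq' s * sin h| <= 1.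
  by rewrite normrM mulr_ile1 ?satq'_le1 ?sin_max.
by rewrite ler_norml => /andP[? ?]; lra.
Qed.

Variables (m : nat) (V : nat -> T -> R) (al p q : R).
Hypothesis mV : forall i, (i < m)%N -> measurable_fun setT (V i).
Let S k w := \sum_(i < k) V i w.
Hypothesis Vcov : forall i (phi chi : R -> R), (i < m)%N ->
  unit_test phi -> unit_test chi ->
  `|Ex P (fun w => phi (S i w) * chi (V i w)) -
    Ex P (fun w => phi (S i w)) * Ex P (fun w => chi (V i w))| <= al.
Hypothesis Vp : forall i, (i < m)%N -> Ex P (fun w => cos (V i w)) = p.
Hypothesis Vq : forall i, (i < m)%N -> Ex P (fun w => sin (V i w)) = q.

Let mS k : (k <= m)%N -> measurable_fun setT (S k).
Proof.
move=> km; apply: measurable_sum => i; apply: mV.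
by rewrite (leq_trans _ km).
Qed.

Let SS k w : S k.+1 w = S k w + V k w.
Proof. by rewrite /S big_ord_recr. Qed.

Let unit_cos : unit_test (@cos R).
Proof. by have := unit_test_cos 0; under eq_fun do rewrite addr0. Qed.

Let unit_sin : unit_test (@sin R).
Proof. by have := unit_test_sin 0; under eq_fun do rewrite addr0. Qed.

(** [cos (S + V + th) = cos (S + th) cos V - sin (S + th) sin V] is exact, so
    appending one term multiplies the expectation by [p] up to two covariances
    and the term [E sin (S + th) * q]; as [|p| <= 1], these errors add up
    along the sum. *)
Lemma cos_chain (th : R) :
  `|Ex P (fun w => cos (S m w + th)) - p ^+ m * cos th| <=
  m%:R * (al *+ 2 + `|q|).
Proof.
suff : forall k, (k <= m)%N ->
   `|Ex P (fun w => cos (S k w + th)) - p ^+ k * cos th| <=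
     k%:R * (al *+ 2 + `|q|) by exact.
elim=> [_|k ih km].
  rewrite mul0r expr0 mul1r (_ : (fun _ => _) = fun=> cos th).
    by rewrite Ex_cst subrr normr0.
  by apply/funext => w; rewrite /S big_ord0 add0r.
have mSk := mS (ltnW km); have mVk := mV km.
have bc : bddmeas (fun w => cos (S k w + th)).
  by apply: bddmeas_cos; exact: measurable_fun_add_cst.
have bs : bddmeas (fun w => sin (S k w + th)).
  by apply: bddmeas_sin; exact: measurable_fun_add_cst.
have bcV := bddmeas_cos mVk; have bsV := bddmeas_sin mVk.
have -> : Ex P (fun w => cos (S k.+1 w + th)) =
  Ex P (fun w => cos (S k w + th) * cos (V k w)) -
  Ex P (fun w => sin (S k w + th) * sin (V k w)).
  rewrite -ExB; [|exact/bddmeas_integ/bddmeasM..].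
  by congr (Ex P); apply/funext => w; rewrite SS addrAC cosD.
have := Vcov km (unit_test_cos th) unit_cos; rewrite (Vp km) => h1.
have := Vcov km (unit_test_sin th) unit_sin; rewrite (Vq km) => h2.
have h3 := ih (ltnW km).
have p1 : `|p| <= 1.
  by rewrite -(Vp km); apply: Ex_bound => [|w]; [exact: bddmeas_integ|exact: cos_max].
have s1 : `|Ex P (fun w => sin (S k w + th))| <= 1.
  by apply: Ex_bound => [|w]; [exact: bddmeas_integ|exact: sin_max].
move: h1 h2 h3 s1; move: (Ex P _) => A; move: (Ex P _) => C.
move: (Ex P _) => B; move: (Ex P _) => D h1 h2 h3 s1.
have -> : A - B - p ^+ k.+1 * cos th =
  (A - C * p) - (B - D * q) + (p * (C - p ^+ k * cos th) - D * q).
  by rewrite exprS; ring.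
apply: le_trans (ler_normD _ _) _; rewrite -natr1 mulrDl mul1r.
have h4 : `|A - C * p - (B - D * q)| <= al + al.
  by rewrite (le_trans (ler_normB _ _))// lerD.
have h5 : `|p * (C - p ^+ k * cos th) - D * q| <= k%:R * (al *+ 2 + `|q|) + `|q|.
  rewrite (le_trans (ler_normB _ _))// lerD// normrM.
    by rewrite (le_trans _ h3)// ler_piMl.
  by rewrite ler_piMl.
by rewrite (le_trans (lerD h4 h5))//; lra.
Qed.

(** By [satq_step] each term contributes one covariance, a multiple of
    [|q|] coming from the linear part, and the truncated second moment. *)
Lemma satq_chain (B : R) :
  (forall i, (i < m)%N -> Ex P (fun w => Num.min (V i w ^+ 2) 1) = B) ->
  Ex P (fun w => satq (S m w)) <= m%:R * (al + `|q| + 2 * B).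
Proof.
move=> VB.
suff : forall k, (k <= m)%N ->
   Ex P (fun w => satq (S k w)) <= k%:R * (al + `|q| + 2 * B) by exact.
elim=> [_|k ih km].
  rewrite mul0r (_ : (fun _ => _) = fun=> 0) ?Ex_cst//.
  by apply/funext => w; rewrite /S big_ord0 /satq expr0n mul0r.
have mSk := mS (ltnW km); have mVk := mV km.
have bsV := bddmeas_sin mVk.
have bq k' : (k' <= m)%N -> bddmeas (fun w => satq (S k' w)).
  move=> k'm; apply: (@bddmeas_comp _ 1 _ measurable_satq _ (mS k'm)) => x.
  by rewrite ger0_norm ?satq_ge0// satq_le1.
have bq' : bddmeas (fun w => satq' (S k w)).
  by apply: (bddmeas_comp unit_satq'.1 unit_satq'.2).
have bm : bddmeas (fun w => Num.min (V k w ^+ 2) 1).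
  split; last first.
    exists 1 => w; rewrite ger0_norm ?ge_min ?lexx ?orbT//.
    by rewrite le_min sqr_ge0 ler01.
  by apply: measurable_minr => //; exact: measurable_funX.
apply: (@le_trans _ _ (Ex P (fun w => satq (S k w) +
   satq' (S k w) * sin (V k w) + 2 * Num.min (V k w ^+ 2) 1))).
  apply: Ex_le => [||w]; last by rewrite SS satq_step.
    exact: (bddmeas_integ _ (bq _ km)).
  apply: bddmeas_integ; apply: bddmeasD; last exact: bddmeasZ.
  by apply: bddmeasD; [exact: (bq _ (ltnW km)) | exact: bddmeasM].
have i1 := bddmeas_integ P (bq _ (ltnW km)).
have i2 := bddmeas_integ P (bddmeasM bq' bsV).
rewrite (ExD (integD i1 i2)) ?(ExD i1 i2) ?ExZ; [|exact: bddmeas_integ..|exact/bddmeas_integ/bddmeasZ].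
have h1 := ih (ltnW km).
have := Vcov km unit_satq' unit_sin; rewrite (Vq km) (VB _ km) => h2.
have s1 : `|Ex P (fun w => satq' (S k w))| <= 1.
  by apply: Ex_bound => [|w]; [exact: bddmeas_integ|exact: satq'_le1].
move: h1 h2 s1; move: (Ex P _) => A; move: (Ex P _) => B1.
move: (Ex P _) => C h1; rewrite ler_norml => /andP[_ h2] s1.
have : C * q <= `|q|.
  by rewrite (le_trans (ler_norm _))// normrM ler_piMl.
rewrite -natr1 mulrDl mul1r => h3; lra.
Qed.

End chain.

(** * Conditional probabilities and essential suprema *)
Section sub_measure.
Context {R : realType} {disp : measure_display} {T : measurableType disp}.
Variables (G : set (set T)) (Gm : <<s G >> `<=` measurable).
Variable mu : {finite_measure set T -> \bar R}.

(** The same set function, read on the measurable space generated by [G]; the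
    Radon-Nikodym theorem is applied there. *)
Definition sub_measure of <<s G >> `<=` measurable : set (g_sigma_algebraType G) -> \bar R := mu.

Local Notation nu := (sub_measure Gm).

Let nu0 : nu set0 = 0%E. Proof. exact: (measure0 mu). Qed.

Let nu_ge0 A : (0 <= nu A)%E. Proof. exact: (measure_ge0 mu). Qed.

Let nu_sigma_additive : semi_sigma_additive nu.
Proof.
move=> F mF tF mUF; apply: (@measure_semi_sigma_additive _ _ _ mu) => //.
- by move=> i; exact: (Gm (mF i)).
- exact: (Gm mUF).
Qed.

HB.instance Definition _ := isMeasure.Build _ _ _ nu nu0 nu_ge0 nu_sigma_additive.

Let nu_fin : fin_num_fun nu.
Proof. by move=> U mU; apply: (@fin_num_measure _ _ _ mu); exact: (Gm mU). Qed.

HB.instance Definition _ := @Measure_isFinite.Build _ _ _ nu nu_fin.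

Lemma measurable_sub_fun d' (Y : measurableType d')
   (f : g_sigma_algebraType G -> Y) : measurable_fun setT f ->
  measurable_fun setT (f : T -> Y).
Proof. by move=> mf _ B mB; rewrite setTI; apply: Gm; rewrite -[X in <<s G>> X]setTI; exact: mf. Qed.

Lemma ge0_integral_sub (A : set T) (f : g_sigma_algebraType G -> \bar R) :
  <<s G >> A -> measurable_fun setT f -> (forall x, 0 <= f x)%E ->
  (\int[nu]_(x in A) f x = \int[mu]_(x in A) f x)%E.
Proof.
move=> GA mf f0.
have mid : measurable_fun setT (id : T -> g_sigma_algebraType G).
  by move=> _ B mB; rewrite setTI; apply: Gm.
have := @ge0_integral_pushforward _ _ T (g_sigma_algebraType G) R id mid mu A f GA.
move=> /(_ (measurable_funTS mf)) <-//.
Qed.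

Lemma integral_sub (A : set T) (f : g_sigma_algebraType G -> \bar R) :
  <<s G >> A -> nu.-integrable setT f ->
  (\int[nu]_(x in A) f x = \int[mu]_(x in A) f x)%E.
Proof.
move=> GA /measurable_int mf.
rewrite integralE [RHS]integralE; congr (_ - _)%E.
- by apply: ge0_integral_sub => //; exact: measurable_funepos.
- by apply: ge0_integral_sub => //; exact: measurable_funeneg.
Qed.

Lemma integrable_sub (f : g_sigma_algebraType G -> \bar R) :
  nu.-integrable setT f -> mu.-integrable setT f.
Proof.
move=> /integrableP[mf fi]; apply/integrableP; split.
  exact: measurable_sub_fun.
rewrite -ge0_integral_sub//.
- exact: (@measurableT _ (g_sigma_algebraType G)).
- exact: measurableT_comp.
Qed.

End sub_measure.

Section cond_prob_exists.
Context {R : realType} {disp : measure_display} {T : measurableType disp}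
  (P : probability T R).

(** The density of [A |-> P (A `&` B)] with respect to [P], both restricted to
    the generated sigma-algebra, is a version of the conditional probability;
    hence so is the chosen one. *)
Lemma cond_prob_exists (G : set (set T)) (B : set T) :
  <<s G >> `<=` measurable -> measurable B ->
  is_cond_prob P <<s G >> B (cond_prob P <<s G >> B).
Proof.
move=> Gm mB; rewrite /cond_prob.
suff [h hh] : exists h, is_cond_prob P <<s G >> B h by exact: (xgetPex (cst 0) (ex_intro _ h hh)).
have Boo : (P B < +oo)%E := le_lt_trans (probability_le1 P mB) (ltry _).
pose nu : {finite_measure set (g_sigma_algebraType G) -> \bar R} := sub_measure (mfrestr mB Boo) Gm.
pose mu : {sigma_finite_measure set (g_sigma_algebraType G) -> \bar R} := sub_measure P Gm.
have numu : charge_of_finite_measure nu `<< mu.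
  apply/null_content_dominatesP => A mA muA0.
  apply/eqP; rewrite eq_le measure_ge0 andbT -muA0.
  apply: le_measure; rewrite ?inE//.
    by apply: measurableI => //; exact: (Gm _ mA).
  exact: (Gm _ mA).
pose f := Radon_Nikodym (charge_of_finite_measure nu) mu.
have fi := Radon_Nikodym_integrable numu.
have ff x : f x \is a fin_num := Radon_Nikodym_fin_num x numu.
have fE : EFin \o (fine \o f) = f.
  by apply/funext => x /=; rewrite fineK.
exists (fine \o f); split.
- move=> C mC; rewrite -[X in <<s G >> X]setTI.
  have : measurable_fun setT (fine \o f).
    by apply/measurable_EFinP; rewrite fE; exact: measurable_int fi.
  exact.
- by rewrite fE; exact: (@integrable_sub _ _ _ _ Gm P _ fi).
- move=> A GA; rewrite -[RHS]/(charge_of_finite_measure nu A).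
  rewrite (Radon_Nikodym_integral numu GA) (@integral_sub _ _ _ _ Gm P _ _ GA fi).
  by apply: eq_integral => x _; rewrite /= fineK.
Qed.

End cond_prob_exists.

Section ess_sup_exists.
Context {R : realType} {disp : measure_display} {T : measurableType disp}
  (P : probability T R).
Implicit Types g h : T -> \bar R.

Lemma measurable_contract g : measurable_fun setT g ->
  measurable_fun setT (fun w => contract (g w)).
Proof.
move=> mg mD; apply: (measurability _ (RGenOInfty.measurableE R)) => //.
move=> _ [_ [a ->] <-]; rewrite setTI.
have [a1|a1] := ltP 1 `|a|; last first.
  rewrite (_ : _ @^-1` _ = setT `&` g @^-1` [set` `]expand a, +oo[]).
    by apply: mg => //; exact: emeasurable_itv.
  rewrite setTI; apply/seteqP; split => w /=;
    by rewrite !in_itv/= !andbT -(leW_mono (@le_contract R)) expandK// inE.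
have [a0|a0] := leP 0 a.
  rewrite (_ : _ @^-1` _ = set0)//; apply/seteqP; split => w //=.
  rewrite in_itv/= andbT => ga.
  have := contract_le1 (g w); rewrite leNgt => /negP; apply.
  rewrite (ger0_norm a0) in a1.
  by rewrite (lt_le_trans (lt_trans a1 ga))// ler_norm.
rewrite (_ : _ @^-1` _ = setT)//; apply/seteqP; split => w //= _.
rewrite in_itv/= andbT; have := contract_le1 (g w).
by rewrite ler_norml => /andP[+ _]; apply: lt_le_trans; rewrite ltrNr -ltr0_norm.
Qed.

(** Strictly monotone up to null sets, and bounded: comparing values of [phi]
    detects almost sure equality of ordered functions. *)
Let phi g := Ex P (fun w => contract (g w)).

Let bddmeas_contract g : measurable_fun setT g -> bddmeas (fun w => contract (g w)).
Proof.
move=> mg; split; first exact: measurable_contract.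
by exists 1 => w; exact: contract_le1.
Qed.

Let phi_le g h : measurable_fun setT g -> measurable_fun setT h ->
  (forall w, (g w <= h w)%E) -> phi g <= phi h.
Proof.
move=> mg mh gh; apply: Ex_le => [||w]; last by rewrite le_contract.
  by apply: bddmeas_integ; exact: bddmeas_contract.
by apply: bddmeas_integ; exact: bddmeas_contract.
Qed.

Let phi_inj g h : measurable_fun setT g -> measurable_fun setT h ->
  (forall w, (g w <= h w)%E) -> phi h <= phi g ->
  {ae P, forall w, (h w <= g w)%E}.
Proof.
move=> mg mh gh hg.
have bg := bddmeas_contract mg; have bh := bddmeas_contract mh.
have bhg := bddmeasB bh bg.
pose f w := contract (h w) - contract (g w).
have f0 w : 0 <= f w by rewrite subr_ge0 le_contract.
have : (\int[P]_(w in setT) `|(EFin \o f) w| = 0)%E.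
  rewrite (_ : integral _ _ _ = (Ex P f)%:E).
    rewrite /f ExB; [|exact: bddmeas_integ..].
    apply/eqP; rewrite eqe eq_le subr_le0 hg/= subr_ge0.
    by apply: phi_le.
  rewrite EFin_Ex; last exact: bddmeas_integ.
  by apply: eq_integral => w _; rewrite /= ger0_norm.
move/(ae_eq_integral_abs _ measurableT) => /(_ _)[|].
  by apply/measurable_EFinP; exact: bhg.1.
move=> A [mA A0 NA]; exists A; split => // w /= nw; apply: NA => /= E0; apply: nw.
have [/(congr1 (+%R^~ (contract (g w))))] := E0 Logic.I; rewrite /f subrK add0r => hgw.
by rewrite -(le_contract) hgw.
Qed.

Let supseq (u : nat -> T -> \bar R) w := esups (fun n => u n w) 0.

Let supseq_ub u n w : (u n w <= supseq u w)%E.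
Proof. by apply: ereal_sup_ubound; exists n. Qed.

Let supseq_le u w x : (forall n, u n w <= x)%E -> (supseq u w <= x)%E.
Proof. by move=> ux; apply: ge_ereal_sup => _ [n _ <-]. Qed.

(** Among the suprema of countable subfamilies choose one that maximizes [phi];
    the maximum is attained because countably many countable subfamilies form
    a countable one.  Adding one more member cannot increase [phi], so it
    changes the supremum on a null set only. *)
Lemma ess_sup_family_exists (S : set (T -> \bar R)) : S !=set0 ->
  (forall h, S h -> measurable_fun setT h) ->
  is_ess_sup_family P S (ess_sup_family P S).
Proof.
move=> [h0 Sh0] mS; rewrite /ess_sup_family.
suff [g hg] : exists g, is_ess_sup_family P S g.
  by apply: (xgetPex (cst 0%E)); exists g.
have mu u : (forall n, S (u n)) -> measurable_fun setT (supseq u).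
  by move=> Su; apply: measurable_fun_esups => n; exact: mS.
pose V := [set phi (supseq u) | u in [set u | forall n, S (u n)]].
have hV : has_sup V.
  split; first by exists (phi (supseq (fun=> h0))), (fun=> h0).
  exists 1 => _ [u Su <-]; apply: le_trans (ler_norm _) _.
  apply: Ex_bound => [|w]; last exact: contract_le1.
  by apply: bddmeas_integ; apply: bddmeas_contract; exact: mu.
have near_sup (k : nat) : exists u, (forall n, S (u n)) /\
    sup V - k.+1%:R^-1 < phi (supseq u).
  have k0 : 0 < k.+1%:R^-1 :> R by rewrite invr_gt0.
  have [_ [u Su <-] hu] := sup_adherent k0 hV.
  by exists u.
have {near_sup}[v hv] := choice near_sup.
pose u n := if @unpickle (nat * nat)%type n is Some ki then v ki.1 ki.2 else h0.
have Su n : S (u n) by rewrite /u; case: unpickle => [[k i]|//]; exact: (hv k).1.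
have vu k w : (supseq (v k) w <= supseq u w)%E.
  apply: supseq_le => i; apply: le_trans (supseq_ub _ (pickle (k, i)) _).
  by rewrite /u pickleK.
have supVu : sup V <= phi (supseq u).
  apply/ler_addgt0Pr => e e0.
  have [k ke] : exists k : nat, k.+1%:R^-1 < e.
    have := @near_infty_natSinv_lt R (PosNum e0).
    by move=> [N _ hN]; exists N; exact: (hN N (leqnn N)).
  rewrite -lerBlDr; apply: le_trans (_ : phi (supseq (v k)) <= _).
    by apply: le_trans (ltW (hv k).2); rewrite lerD2l lerN2 ltW.
  by apply: phi_le => //; apply: mu => //; exact: (hv k).1.
exists (supseq u); split.
- exact: mu.
- move=> h Sh; pose u' n := if n is n'.+1 then u n' else h.
  have Su' n : S (u' n) by case: n => [|n] //=; exact: Su.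
  have uu' w : (supseq u w <= supseq u' w)%E.
    by apply: supseq_le => n; exact: (supseq_ub u' n.+1).
  have : {ae P, forall w, (supseq u' w <= supseq u w)%E}.
    apply: phi_inj => //; [exact: mu|exact: mu|].
    apply: le_trans supVu; apply: ub_le_sup; first exact: hV.2.
    by exists u'.
  apply: filterS => w; apply: le_trans; exact: (supseq_ub u' 0).
- move=> g' mg' Sg'.
  have : {ae P, forall w, forall n, (u n w <= g' w)%E}.
    by apply: ae_foralln => n; exact: Sg'.
  by apply: filterS => w ug'; exact: supseq_le.
Qed.

End ess_sup_exists.

(** * From mixing coefficients to covariances *)
Section alpha_le_beta.
Context {R : realType} {disp : measure_display} {T : measurableType disp}
  (P : probability T R) {d : nat}.
Variable X : nat -> nat -> T -> d.-tuple R.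

Lemma row_sigma_measurable n i j :
  (forall k, (i <= k <= j)%N -> measurable_fun setT (X n k)) ->
  row_sigma X n i j `<=` measurable.
Proof.
move=> mX; apply: smallest_sub; first exact: sigma_algebra_measurable.
by move=> _ [k /= kij [B mB <-]]; exact: mX.
Qed.

(** [P (A `&` B) - P A * P B] is the integral over [A] of
    [P (B | past) - P B], and the absolute value of this integrand is one of the
    functions in the essential supremum. *)
Lemma alpha_le_beta n k l A B :
  (forall i, (1 <= i <= n)%N -> measurable_fun setT (X n i)) ->
  (1 <= l)%N -> (l + k + 1 <= n)%N ->
  row_sigma X n 1 l A -> row_sigma X n (l + k + 1) n B ->
  (`|fine (P (A `&` B)) - fine (P A) * fine (P B)|%:E <= beta_mixing P X n k)%E.
Proof.
move=> mX l1 lkn GA GB.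
have Gm : row_sigma X n 1 l `<=` measurable.
  apply: row_sigma_measurable => i /andP[i1 il]; apply: mX; rewrite i1/=.
  by rewrite (leq_trans il)// (leq_trans _ lkn)// -addnA leq_addr.
have Hm : row_sigma X n (l + k + 1) n `<=` measurable.
  apply: row_sigma_measurable => i /andP[il iN]; apply: mX; rewrite iN andbT.
  by rewrite (leq_trans _ il)// addn1.
have mA := Gm _ GA; have mB := Hm _ GB.
set G := row_sigma X n 1 l in GA Gm.
pose dev B' w := `|cond_prob P G B' w - fine (P B')|.
have cpB B' : row_sigma X n (l + k + 1) n B' -> is_cond_prob P G B' (cond_prob P G B').
  by move=> HB'; apply: cond_prob_exists => //; exact: Hm.
have mcp B' : row_sigma X n (l + k + 1) n B' -> integ P (cond_prob P G B').
  by move=> /cpB[].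
have mdev B' : row_sigma X n (l + k + 1) n B' -> integ P (dev B').
  by move=> /mcp icp; apply: integ_norm; apply: integB => //; exact: integ_cst.
pose S := [set (fun w' => (dev B' w')%:E) | B' in row_sigma X n (l + k + 1) n].
have [mg gub _] : is_ess_sup_family P S (ess_sup_family P S).
  apply: ess_sup_family_exists; first by exists (fun w' => (dev B w')%:E), B.
  by move=> _ [B' HB' <-]; apply/measurable_EFinP; exact: (integ_meas (mdev _ HB')).
set g := ess_sup_family P S in mg gub.
have gB : {ae P, forall w, ((dev B w)%:E <= g w)%E} by apply: gub; exists B.
apply: (@le_trans _ _ (\int[P]_w (dev B w)%:E)%E); last first.
  apply: (@le_trans _ _ (\int[P]_w g w)%E); last first.
    by apply: ereal_sup_ubound; exists l.
  (* An essential supremum of nonnegative functions is nonnegative only almost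
     everywhere. *)
  rewrite [leRHS](_ : _ = (\int[P]_w (maxe (g w) 0))%E).
    apply: ae_ge0_le_integral => //.
    - by move=> w _; rewrite lee_fin normr_ge0.
    - by apply/measurable_EFinP; exact: (integ_meas (mdev _ GB)).
    - by move=> w _; rewrite le_max lexx orbT.
    - exact: measurable_maxe.
    - by apply: filterS gB => w gw _; rewrite le_max gw.
  apply: ae_eq_integral => //; first exact: measurable_maxe.
  by apply: filterS gB => w gw _; rewrite max_l// (le_trans _ gw)// lee_fin normr_ge0.
have [_ _ /(_ A GA) cpA] := cpB _ GB.
have bA : bddmeas (\1_A : T -> R) := bddmeas_indic mA.
have iA : integ P (fun w => \1_A w * cond_prob P G B w).
  apply: (@integ_le _ _ _ P _ (cond_prob P G B)) (mcp _ GB).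
    by apply: measurable_funM; [exact: bA.1 | exact: integ_meas (mcp _ GB)].
  move=> w; rewrite normrM indicE; case: (w \in A); rewrite ?normr1 ?mul1r//.
  by rewrite normr0 mul0r.
have cpA' : Ex P (fun w => \1_A w * cond_prob P G B w) = fine (P (A `&` B)).
  rewrite -cpA /Ex /Rintegral [in RHS]integral_mkcond; congr fine; apply: eq_integral => w _.
  by rewrite patchE indicE; case: ifPn => wA; rewrite ?mul1r ?mul0r.
rewrite -EFin_Ex; last exact: mdev.
rewrite lee_fin -cpA' -(Ex_indic P mA) -[X in _ - X]mulrC -ExZ; last exact: bddmeas_integ.
rewrite -ExB => //; last by apply: integZ; exact: bddmeas_integ.
apply: Ex_norm_le; [|exact: mdev|].
  by apply: integB => //; apply: integZ; exact: bddmeas_integ.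
move=> w; rewrite mulrC -mulrBl normrM /dev indicE.
by case: (w \in A); rewrite ?normr1 ?mulr1// normr0 mulr0.
Qed.

End alpha_le_beta.

Section layers.
Context {R : realType}.

Lemma floor_sum_bounds (N : nat) (x : R) : 0 <= x ->
  \sum_(i < N) (i.+1%:R <= x)%R%:R <= x /\
  (x <= N%:R -> x <= \sum_(i < N) (i.+1%:R <= x)%R%:R + 1).
Proof.
move=> x0; elim: N => [|N [ih1 ih2]].
  by rewrite big_ord0 add0r; split=> // /le_trans; apply; rewrite ler01.
have full : N%:R <= x -> \sum_(i < N) (i.+1%:R <= x)%R%:R = N%:R :> R.
  move=> Nx; rewrite (eq_bigr (fun=> 1)) ?sumr_const ?card_ord// => i _.
  by rewrite (le_trans _ Nx)// ler_nat.
rewrite big_ord_recr /=; split.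
  have [Nx|] := leP N.+1%:R x; last by rewrite addr0.
  by rewrite full ?natr1// (le_trans _ Nx)// ler_nat.
move=> xN; have [xN'|/ltW Nx] := leP x N%:R.
  by rewrite (le_trans (ih2 xN'))// lerD2r lerDl.
by rewrite full// (le_trans xN)// -natr1 lerD2r lerDl.
Qed.

(** A variable with values in [0, 1] is, up to [1/N], the mean of [N]
    indicators of its upper level sets. *)
Lemma layer_approx (N : nat) (x : R) : 0 <= x <= 1 ->
  `|x - N.+1%:R^-1 * \sum_(i < N.+1) (i.+1%:R / N.+1%:R <= x)%R%:R| <= N.+1%:R^-1.
Proof.
move=> /andP[x0 x1]; have N0 : 0 < N.+1%:R :> R by [].
have [] := floor_sum_bounds N.+1 (mulr_ge0 x0 (ltW N0)).
rewrite ler_piMl// => h1 /(_ isT) h2.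
rewrite (eq_bigr (fun i : 'I_N.+1 => (i.+1%:R <= x * N.+1%:R)%R%:R)); last first.
  by move=> i _; rewrite ler_pdivrMr.
move: h1 h2; set s := \sum_(_ < _) _ => h1 h2.
have -> : x - N.+1%:R^-1 * s = N.+1%:R^-1 * (x * N.+1%:R - s).
  by field; rewrite addrC natr1 gt_eqF.
rewrite normrM (@ger0_norm _ N.+1%:R^-1) ?invr_ge0// ler_piMr ?invr_ge0//.
by rewrite ger0_norm; lra.
Qed.

End layers.

Section covariance_bound.
Context {R : realType} {disp : measure_display} {T : measurableType disp}
  (P : probability T R).

Definition measurable_wrt (G : set (set T)) (U : T -> R) :=
  forall C, measurable C -> G (U @^-1` C).

Definition cov (U V : T -> R) :=
  Ex P (fun w => U w * V w) - Ex P U * Ex P V.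

Lemma cov_sym U V : cov U V = cov V U.
Proof.
by rewrite /cov mulrC; congr (Ex P _ - _); apply/funext => w; rewrite mulrC.
Qed.

Let covD U1 U2 V : bddmeas U1 -> bddmeas U2 -> bddmeas V ->
  cov (fun w => U1 w + U2 w) V = cov U1 V + cov U2 V.
Proof.
move=> b1 b2 bV; rewrite /cov ExD; [|exact: bddmeas_integ..].
rewrite (_ : (fun _ => _) = (fun w => U1 w * V w + U2 w * V w)); last first.
  by apply/funext => w; rewrite mulrDl.
rewrite ExD; [ring|exact/bddmeas_integ/bddmeasM|exact/bddmeas_integ/bddmeasM].
Qed.

Let covZ (a : R) U V : bddmeas U -> bddmeas V ->
  cov (fun w => a * U w) V = a * cov U V.
Proof.
move=> bU bV; rewrite /cov ExZ; last exact: bddmeas_integ.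
rewrite (_ : (fun _ => _) = (fun w => a * (U w * V w))); last first.
  by apply/funext => w; rewrite mulrA.
rewrite ExZ; [ring|exact/bddmeas_integ/bddmeasM].
Qed.

Let cov_cst (a : R) V : cov (fun=> a) V = 0 \/ ~ bddmeas V.
Proof.
have [bV|] := pselect (bddmeas V); last by right.
by left; rewrite /cov ExZ ?Ex_cst ?subrr//; exact: bddmeas_integ.
Qed.

Let cov_le U V (e : R) : bddmeas U -> bddmeas V -> (forall w, `|U w| <= e) ->
  (forall w, `|V w| <= 1) -> `|cov U V| <= e *+ 2.
Proof.
move=> bU bV Ue V1; rewrite mulr2n (le_trans (ler_normB _ _))// lerD//.
  apply: Ex_bound => [|w]; first exact/bddmeas_integ/bddmeasM.
  by rewrite normrM (le_trans _ (Ue w))// ler_piMr.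
rewrite normrM -[leRHS]mulr1 ler_pM//; apply: Ex_bound => //; exact: bddmeas_integ.
Qed.

Let cov_layers (G : set (set T)) (al : R) V : G `<=` measurable ->
  bddmeas V -> (forall w, `|V w| <= 1) ->
  (forall A, G A -> `|cov (\1_A) V| <= al) ->
  forall U, measurable_wrt G U -> (forall w, 0 <= U w <= 1) -> `|cov U V| <= al.
Proof.
move=> Gm bV V1 covA U GU U01.
have bU : bddmeas U.
  split; first by move=> _ C mC; rewrite setTI; apply: Gm; exact: GU.
  by exists 1 => w; have /andP[? ?] := U01 w; rewrite ger0_norm.
apply/ler_addgt0Pr => e e0.
have [k ke] : exists k : nat, k.+1%:R^-1 < e / 2.
  have e20 : 0 < e / 2 by rewrite divr_gt0.
  have [N _ hN] := @near_infty_natSinv_lt R (PosNum e20).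
  by exists N; exact: (hN N (leqnn N)).
pose A (i : 'I_k.+1) := U @^-1` [set x | i.+1%:R / k.+1%:R <= x].
have GA i : G (A i).
  apply: GU; rewrite (_ : [set x | _] = [set` `[i.+1%:R / k.+1%:R, +oo[]); first exact: measurable_itv.
  by apply/seteqP; split => x /=; rewrite in_itv/= andbT.
have bA i : bddmeas (\1_(A i) : T -> R) by apply: bddmeas_indic; exact/Gm.
pose W s w := \sum_(i <- s) (\1_(A i) w : R).
have bW s : bddmeas (W s).
  elim: s => [|i s ih]; first by rewrite /W; under eq_fun do rewrite big_nil; exact: bddmeas_cst.
  by rewrite /W; under eq_fun do rewrite big_cons; apply: bddmeasD.
have covW s : `|cov (W s) V| <= (size s)%:R * al.
  elim: s => [|i s ih].
    rewrite /W; under eq_fun do rewrite big_nil.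
    by have [->|//] := cov_cst 0 V; rewrite normr0 mul0r.
  rewrite /W; under eq_fun do rewrite big_cons.
  rewrite (covD (bA i) (bW s) bV) (le_trans (ler_normD _ _))// -natr1 mulrDl mul1r addrC lerD//.
  exact: covA.
pose W' w := k.+1%:R^-1 * W (index_enum 'I_k.+1) w.
have bW' : bddmeas W' by exact: bddmeasZ.
have -> : U = (fun w => W' w + (U w - W' w)) by apply/funext => w; rewrite addrC subrK.
rewrite covD//; last exact: bddmeasB.
rewrite (le_trans (ler_normD _ _))// lerD//.
  rewrite covZ// normrM ger0_norm ?invr_ge0// mulrC ler_pdivrMr// [leRHS]mulrC.
  have := covW (index_enum 'I_k.+1); congr (_ <= _%:R * _).
  by rewrite -sum1_size -[RHS]card_ord -sum1_card.
rewrite (_ : e = (e / 2) *+ 2); last by rewrite -mulr_natr; field.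
apply: cov_le => // [|w]; first exact: bddmeasB.
rewrite (le_trans _ (ltW ke))//.
rewrite (le_trans _ (layer_approx k (U01 w)))// /W' /W.
rewrite [in leLHS](eq_bigr (fun i : 'I_k.+1 => (i.+1%:R / k.+1%:R <= U w)%R%:R))//.
by move=> i _; rewrite indicE; congr ((nat_of_bool _)%:R); apply/idP/idP; rewrite inE.
Qed.

(** For [0, 1]-valued variables the layer decomposition reduces the bound to
    events, without a constant; the affine change [s] onto [0, 1] costs the
    factor 4. *)
Lemma cov_bound (G H : set (set T)) (al : R) :
  G `<=` measurable -> H `<=` measurable ->
  (forall A B, G A -> H B ->
     `|fine (P (A `&` B)) - fine (P A) * fine (P B)| <= al) ->
  forall U V, measurable_wrt G U -> measurable_wrt H V ->
  (forall w, `|U w| <= 1) -> (forall w, `|V w| <= 1) ->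
  `|cov U V| <= 4 * al.
Proof.
move=> Gm Hm GH.
have cov01 U V : measurable_wrt G U -> measurable_wrt H V ->
  (forall w, 0 <= U w <= 1) -> (forall w, 0 <= V w <= 1) -> `|cov U V| <= al.
  move=> GU HV U01 V01.
  have bV : bddmeas V.
    split; first by move=> _ C mC; rewrite setTI; apply: Hm; exact: HV.
    by exists 1 => w; have /andP[? ?] := V01 w; rewrite ger0_norm.
  apply: (cov_layers Gm bV) => // [w|A GA].
    by have /andP[? ?] := V01 w; rewrite ger0_norm.
  rewrite cov_sym; apply: (cov_layers Hm) HV V01.
  - by apply: bddmeas_indic; exact: Gm.
  - by move=> w; rewrite indicE; case: (w \in A); rewrite ?normr1 ?normr0.
  - move=> B HB; rewrite cov_sym /cov !Ex_indic; [|exact: Hm|exact: Gm].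
    rewrite (_ : (fun _ => _) = \1_(A `&` B)); last first.
      by rewrite indicI.
    rewrite Ex_indic; last by apply: measurableI; [exact: Gm|exact: Hm].
    exact: GH.
move=> U V GU HV U1 V1.
pose s (x : R) := (x + 1) / 2.
have cs : continuous s.
  by move=> x; apply: cvgM; [apply: cvgD; [exact: cvg_id|exact: cvg_cst]|exact: cvg_cst].
have ms : measurable_fun setT s by exact: continuous_measurable_fun.
have s01 x : `|x| <= 1 -> 0 <= s x <= 1.
  by rewrite ler_norml => /andP[? ?]; rewrite /s; apply/andP; split; lra.
have := cov01 (s \o U) (s \o V) _ _ (fun w => s01 _ (U1 w)) (fun w => s01 _ (V1 w)).
have sG K W : measurable_wrt K W -> measurable_wrt K (s \o W).
  by move=> KW C mC; rewrite comp_preimage; apply: KW; rewrite -[X in measurable X]setTI; exact: ms.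
move=> /(_ (sG _ _ GU) (sG _ _ HV)).
have bU : bddmeas U.
  by split; [move=> _ C mC; rewrite setTI; apply: Gm; exact: GU | exists 1].
have bV : bddmeas V.
  by split; [move=> _ C mC; rewrite setTI; apply: Hm; exact: HV | exists 1].
have shift U' V' : bddmeas U' -> bddmeas V' -> cov (s \o U') V' = 2^-1 * cov U' V'.
  move=> b1 b2; rewrite (_ : s \o U' = fun w => 2^-1 * U' w + 2^-1); last first.
    by apply/funext => w; rewrite /s/=; field.
  rewrite covD ?covZ//; last 2 first.
  - exact: bddmeasZ.
  - exact: bddmeas_cst.
  by have [->|//] := cov_cst 2^-1 V'; rewrite addr0.
have bsV : bddmeas (s \o V).
  split; first exact: measurableT_comp ms bV.1.
  by exists 1 => w; have /andP[? ?] := s01 _ (V1 w); rewrite ger0_norm.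
rewrite shift// (cov_sym U) shift// (cov_sym V) mulrA normrM ger0_norm; last by lra.
by move=> h; lra.
Qed.

End covariance_bound.

(** * Approximation by trigonometric polynomials *)
Section trig_approximation.
Context {R : realType} {k : nat}.
Local Notation V := 'rV[R]_k.
Implicit Types (x a : V) (h p q : V -> R).

Definition rowdot a x : R := \sum_j a ord0 j * x ord0 j.

(** Products need no constructor: they are sums by the product formula for
    cosines. *)
Inductive trigpoly : (V -> R) -> Prop :=
| TrigCos a th : trigpoly (fun x => cos (rowdot a x + th))
| TrigAdd p q : trigpoly p -> trigpoly q -> trigpoly (fun x => p x + q x)
| TrigScale c p : trigpoly p -> trigpoly (fun x => c * p x).

Let rowdotD a b x : rowdot (a + b) x = rowdot a x + rowdot b x.
Proof.
by rewrite /rowdot -big_split/=; apply: eq_bigr => j _; rewrite !mxE mulrDl.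
Qed.

Let rowdotN a x : rowdot (- a) x = - rowdot a x.
Proof.
by rewrite /rowdot -sumrN; apply: eq_bigr => j _; rewrite !mxE mulNr.
Qed.

Let trig_ext p q : trigpoly p -> p =1 q -> trigpoly q.
Proof. by move=> tp /funext <-. Qed.

Let trig_mul p q : trigpoly p -> trigpoly q -> trigpoly (fun x => p x * q x).
Proof.
move=> tp tq; elim: tp => [a th|p1 p2 _ ih1 _ ih2|c p1 _ ih]; first last.
- by apply: trig_ext (TrigScale c ih) _ => x; rewrite mulrA.
- by apply: trig_ext (TrigAdd ih1 ih2) _ => x; rewrite mulrDl.
elim: tq => [b ph|q1 q2 _ ih1 _ ih2|c q1 _ ih]; first last.
- by apply: trig_ext (TrigScale c ih) _ => x; rewrite mulrCA.
- by apply: trig_ext (TrigAdd ih1 ih2) _ => x; rewrite mulrDr.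
apply: trig_ext (TrigScale 2^-1 (TrigAdd (TrigCos (a + b) (th + ph))
  (TrigCos (a - b) (th - ph)))) _ => x.
rewrite rowdotD rowdotD rowdotN.
rewrite (_ : rowdot a x - _ + _ = (rowdot a x + th) - (rowdot b x + ph)); last by ring.
rewrite (_ : rowdot a x + _ + _ = (rowdot a x + th) + (rowdot b x + ph)); last by ring.
by rewrite [X in X + _]cosD cosB; field.
Qed.

Let trig_bounded p : trigpoly p -> exists M, forall x, `|p x| <= M.
Proof.
elim=> [a th|p1 p2 _ [M1 h1] _ [M2 h2]|c p1 _ [M h]].
- by exists 1 => x; exact: cos_max.
- by exists (M1 + M2) => x; rewrite (le_trans (ler_normD _ _))// lerD.
- by exists (`|c| * M) => x; rewrite normrM ler_wpM2l.
Qed.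

Let contD p q : continuous p -> continuous q -> continuous (fun x => p x + q x).
Proof. by move=> cp cq x; apply: (@cvgD _ _ _ _ (nbhs_filter x)); [exact: cp|exact: cq]. Qed.

Let contB p q : continuous p -> continuous q -> continuous (fun x => p x - q x).
Proof. by move=> cp cq x; apply: (@cvgB _ _ _ _ (nbhs_filter x)); [exact: cp|exact: cq]. Qed.

Let contM p q : continuous p -> continuous q -> continuous (fun x => p x * q x).
Proof. by move=> cp cq x; apply: (@cvgM _ _ _ (nbhs_filter x)); [exact: cp|exact: cq]. Qed.

Let contC (c : R) : continuous ((fun=> c) : V -> R).
Proof. by move=> x; apply: (@cvg_cst _ _ _ _ (nbhs_filter x)). Qed.

Let rowdot_continuous a : continuous (rowdot a).
Proof.
rewrite /rowdot; elim: (index_enum _) => [|j s ih].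
  by under eq_fun do rewrite big_nil; exact: contC.
under eq_fun do rewrite big_cons; apply: contD => //; apply: contM => //.
by move=> x; exact: coord_continuous.
Qed.

Let trig_continuous p : trigpoly p -> continuous p.
Proof.
elim=> [a th x|p1 p2 _ c1 _ c2|c p1 _ c1].
- apply: (continuous_comp (f := fun x => rowdot a x + th)); last exact: continuous_cos.
  by apply: contD; [exact: rowdot_continuous|].
- exact: contD.
- exact: contM.
Qed.

(** Uniform closure of the trigonometric polynomials on the whole space, where
    the elements stay bounded. *)
Let ap h := forall e, 0 < e -> exists2 p, trigpoly p & forall x, `|h x - p x| <= e.

Let ap_trig p : trigpoly p -> ap p.
Proof. by move=> tp e e0; exists p => // x; rewrite subrr normr0 ltW. Qed.

Let ap_bounded h : ap h -> exists2 M, 0 < M & forall x, `|h x| <= M.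
Proof.
move=> /(_ 1 ltr01)[p tp hp]; have [M pM] := trig_bounded tp.
exists (`|M| + 1) => [|x]; first by rewrite ltr_wpDl.
rewrite -(subrK (p x) (h x)) addrC (le_trans (ler_normD _ _))// lerD//.
exact: le_trans (ler_norm _).
Qed.

Let ap_continuous h : ap h -> continuous h.
Proof.
move=> ah x; apply/(@cvgrPdist_le _ _ _ _ (nbhs_filter x)) => e e0.
have e30 : 0 < e / 3 by rewrite divr_gt0.
have [p tp hp] := ah _ e30.
have /(@cvgrPdist_le _ _ _ _ (nbhs_filter x))/(_ _ e30) := @trig_continuous p tp x.
apply: (@filterS _ _ (nbhs_filter x)) => y pxy.
rewrite (_ : h x - h y = (h x - p x) + (p x - p y) - (h y - p y)); last by ring.
rewrite (le_trans (ler_normB _ _))// (_ : e = e / 3 + e / 3 + e / 3); last by field.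
by rewrite lerD// (le_trans (ler_normD _ _))// lerD.
Qed.

Let ap_ext h h' : ap h -> h =1 h' -> ap h'.
Proof. by move=> ah /funext <-. Qed.

Let apD h h' : ap h -> ap h' -> ap (fun x => h x + h' x).
Proof.
move=> ah ah' e e0; have e20 : 0 < e / 2 by rewrite divr_gt0.
have [p tp hp] := ah _ e20; have [q tq hq] := ah' _ e20.
exists (fun x => p x + q x) => [|x]; first exact: TrigAdd.
by rewrite opprD addrACA (splitr e) (le_trans (ler_normD _ _))// lerD.
Qed.

Let apZ c h : ap h -> ap (fun x => c * h x).
Proof.
move=> ah e e0; have c0 : 0 < `|c| + 1 by rewrite ltr_wpDl.
have [p tp hp] := ah (e / (`|c| + 1)) (divr_gt0 e0 c0).
exists (fun x => c * p x) => [|x]; first exact: TrigScale.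
rewrite -mulrBr normrM (le_trans (ler_wpM2l _ (hp x)))//.
by rewrite mulrCA ler_piMr ?(ltW e0)// ler_pdivrMr// mul1r lerDl.
Qed.

Let ap_cst c : ap (fun=> c).
Proof.
apply: (@ap_ext (fun x => c * cos (rowdot 0 x + 0))); first exact/apZ/ap_trig/TrigCos.
move=> x; rewrite addr0 (_ : rowdot 0 x = 0) ?cos0 ?mulr1//.
by rewrite /rowdot big1// => j _; rewrite mxE mul0r.
Qed.

Let apM h h' : ap h -> ap h' -> ap (fun x => h x * h' x).
Proof.
move=> ah ah' e e0.
have [M M0 hM] := ap_bounded ah.
have eM0 : 0 < e / 2 / M by rewrite !divr_gt0.
have [q tq hq] := ah' _ eM0.
have [N N0 qN] := ap_bounded (ap_trig tq).
have eN0 : 0 < e / 2 / N by rewrite !divr_gt0.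
have [p tp hp] := ah _ eN0.
exists (fun x => p x * q x) => [|x]; first exact: trig_mul.
rewrite (_ : _ - _ = h x * (h' x - q x) + (h x - p x) * q x); last by ring.
rewrite (le_trans (ler_normD _ _))// !normrM (splitr e) lerD//.
  by rewrite -[leRHS](divfK (lt0r_neq0 M0)) [leRHS]mulrC ler_pM.
by rewrite -[leRHS](divfK (lt0r_neq0 N0)) ler_pM.
Qed.

Let apB h h' : ap h -> ap h' -> ap (fun x => h x - h' x).
Proof.
move=> ah ah'; apply: ap_ext (apD ah (apZ (-1) ah')) _ => x.
by rewrite mulN1r.
Qed.

(** Newton-type iteration converging to [|t|] uniformly on [-1, 1]; it makes the
    closure stable under absolute values without the binomial series. *)
Let absit (t : R) n : R := iter n (fun u : R => u + (t ^+ 2 - u ^+ 2) / 2) 0.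

Let absit_bound (t : R) n : `|t| <= 1 ->
  0 <= `|t| - absit t n <= n.+2%:R^-1 * 2.
Proof.
move=> t1; have t0 := normr_ge0 t.
suff : 0 <= absit t n <= `|t| /\ `|t| - absit t n <= n.+2%:R^-1 * 2.
  by move=> [/andP[_ h1] h2]; rewrite subr_ge0 h1 h2.
rewrite /absit -(@real_normK _ t) ?num_real//; set s := `|t| in t1 t0 *.
elim: n => [|n [/andP[q0 qs] ih]]; first by rewrite /= lexx t0 subr0 mulVf.
rewrite iterS; set q := iter _ _ _ in q0 qs ih *.
have E : s - (q + (s ^+ 2 - q ^+ 2) / 2) = (s - q) * (1 - (s + q) / 2) by field.
split.
  apply/andP; split.
    by rewrite addr_ge0// divr_ge0// subr_ge0 ler_sqr ?nnegrE.
  by rewrite -subr_ge0 E mulr_ge0// ?subr_ge0//; lra.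
rewrite E; set d := s - q in ih *.
have d0 : 0 <= d by rewrite subr_ge0.
apply: (@le_trans _ _ (d * (1 - d / 2))).
  by rewrite ler_wpM2l// /d; lra.
have n20 : 0 < n.+2%:R :> R by [].
apply: (@le_trans _ _ (n.+2%:R^-1 * 2 * (1 - n.+2%:R^-1))).
  have y1 : n.+2%:R^-1 <= 2^-1 :> R by rewrite lef_pV2 ?posrE// ler_nat.
  by move: ih y1; set y := n.+2%:R^-1 => ih y1; nra.
rewrite -mulrA [2 * _]mulrC mulrA ler_wpM2r//.
rewrite -[n.+3%:R]natr1; set N := n.+2%:R in n20 *.
rewrite -[leRHS]mul1r ler_pdivlMr; last by lra.
rewrite (_ : _ * _ = 1 - N^-1 ^+ 2); last by field; rewrite gt_eqF.
by rewrite gerBl sqr_ge0.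
Qed.

Let ap_norm h : ap h -> ap (fun x => `|h x|).
Proof.
move=> ah; have [M M0 hM] := ap_bounded ah.
pose h1 x := M^-1 * h x.
have ah1 : ap h1 by exact: apZ.
have h11 x : `|h1 x| <= 1.
  by rewrite normrM gtr0_norm ?invr_gt0// mulrC ler_pdivrMr// mul1r.
have ait n : ap (fun x => absit (h1 x) n).
  elim: n => [|n ih]; first exact: ap_cst.
  have := apD ih (apZ 2^-1 (apB (apM ah1 ah1) (apM ih ih))).
  by move=> /ap_ext; apply => x; rewrite /absit iterS !expr2 [2^-1 * _]mulrC.
suff : ap (fun x => `|h1 x|).
  move=> /(apZ M) /ap_ext; apply => x.
  by rewrite /h1 normrM gtr0_norm ?invr_gt0// mulVKf// gt_eqF.
move=> e e0; have e40 : 0 < e / 4 by rewrite divr_gt0.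
have [N _ hN] := @near_infty_natSinv_lt R (PosNum e40).
have {}hN : N.+1%:R^-1 < e / 4 := hN N (leqnn N).
have e20 : 0 < e / 2 by rewrite divr_gt0.
have [p tp hp] := ait N _ e20; exists p => // x.
have /andP[d0 d1] := absit_bound N (h11 x).
rewrite -(subrK (absit (h1 x) N) `|h1 x|) -addrA (splitr e).
rewrite (le_trans (ler_normD _ _))// lerD// ger0_norm// (le_trans d1)//.
have : N.+2%:R^-1 <= N.+1%:R^-1 :> R by rewrite lef_pV2 ?posrE// ler_nat.
by move: hN; set u := N.+1%:R^-1; set v := N.+2%:R^-1 => uE vu; lra.
Qed.

Let ap_max h h' : ap h -> ap h' -> ap (fun x => Num.max (h x) (h' x)).
Proof.
move=> ah ah'; apply: ap_ext (apZ 2^-1 (apD (apD ah ah') (ap_norm (apB ah ah')))) _ => x.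
by rewrite maxr_absE mulrC.
Qed.

Let ap_min h h' : ap h -> ap h' -> ap (fun x => Num.min (h x) (h' x)).
Proof.
move=> ah ah'; apply: ap_ext (apZ 2^-1 (apB (apD ah ah') (ap_norm (apB ah ah')))) _ => x.
by rewrite minr_absE mulrC.
Qed.

Let ap_separates x y (u v : R) : (x = y -> u = v) ->
  exists h, [/\ ap h, h x = u & h y = v].
Proof.
move=> uv; have [xy|/eqP xy] := eqVneq x y.
  by exists (fun=> u); split; [exact: ap_cst|by []|exact: uv].
have [j xyj] : exists j, x ord0 j != y ord0 j.
  apply: contrapT => nE; apply: xy; apply/rowP => j; apply/eqP.
  by rewrite -[_ == _]negbK; apply/negP => ne; apply: nE; exists j.
pose s := (y ord0 j - x ord0 j)^-1.
pose a : V := s *: delta_mx ord0 j.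
have rd z : rowdot a z = s * z ord0 j.
  rewrite /rowdot (bigD1 j)//= !mxE !eqxx/= mulr1 big1 ?addr0// => i ij.
  by rewrite !mxE/= (negbTE ij)/= mulr0 mul0r.
have s0 : y ord0 j - x ord0 j != 0 by rewrite subr_eq0 eq_sym.
have s1 : sin 1 != 0 :> R by rewrite gt_eqF// sin2_gt0// ltr01 ltr1n.
exists (fun z => u + (v - u) / sin 1 * cos (rowdot a z + (- (s * x ord0 j) - pi / 2))).
split.
- by apply: apD; [exact: ap_cst|apply/apZ/ap_trig; exact: TrigCos].
- by rewrite addrA cosBpihalf rd subrr sin0 mulr0 addr0.
- rewrite addrA cosBpihalf rd -mulrBr mulVf//.
  by rewrite divfK// addrC subrK.
Qed.

(** Stone-Weierstrass on a cube, in lattice form: two functions of the closure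
    that agree with [g] at prescribed pairs of points are glued by finite maxima
    and minima.  Truncating at [M] stays in the closure, which gives the bound
    outside the cube. *)
Lemma trig_approx (g : V -> R) (M L e : R) : continuous g ->
  (forall x, `|g x| <= M) -> 0 < e ->
  exists p, [/\ trigpoly p,
    forall x, (forall j, `|x ord0 j| <= L) -> `|g x - p x| <= e &
    forall x, `|p x| <= M + e].
Proof.
move=> cg gM e0; have e20 : 0 < e / 2 by rewrite divr_gt0.
pose K := [set x : V | forall j, `|x ord0 j| <= L].
have cK : compact K.
  rewrite (_ : K = [set x | forall j, `[-L, L]%classic (x ord0 j)]).
    by apply: (@rV_compact _ _ (fun=> `[-L, L]%classic)) => j; exact: segment_compact.
  by apply/seteqP; split => x Kx j; have := Kx j; rewrite /= in_itv/= ler_norml.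
rewrite compact_cover in cK.
have M0 : 0 <= M := le_trans (normr_ge0 _) (gM 0).
have step1 x : exists h, [/\ ap h, h x = g x & forall z, K z -> g z - e / 2 < h z].
  have /choice[H hH] : forall y, exists h, [/\ ap h, h x = g x & h y = g y].
    by move=> y; apply: ap_separates => ->.
  pose U y := [set z | g z - e / 2 < H y z].
  have oU y : setT y -> open (U y).
    move=> _; rewrite (_ : U y = (fun z => H y z - (g z - e / 2)) @^-1` [set t | 0 < t]).
      apply: open_comp; last exact: open_gt.
      move=> z _; apply: contB; first by have [/ap_continuous] := hH y.
      exact: contB.
    by apply/seteqP; split => z; rewrite /U /= subr_gt0.
  have KU : K `<=` cover setT U.
    move=> y _; exists y => //; rewrite /U/=; have [_ _ ->] := hH y.
    by rewrite gtrBl.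
  have [D _ KD] := cK _ _ _ oU KU.
  suff [h [ah hx hs]] : exists h, [/\ ap h, h x = g x &
      forall y, y \in (finmap.enum_fset D) -> forall z, H y z <= h z].
    exists h; split => // z /KD[y yD Uz]; apply: lt_le_trans Uz _.
    exact: hs.
  elim: (finmap.enum_fset D) => [|y s [h [ah hx hs]]].
    by exists (fun=> g x); split => //; exact: ap_cst.
  have [aHy Hyx _] := hH y.
  exists (fun z => Num.max (H y z) (h z)); split.
  - exact: ap_max.
  - by rewrite Hyx hx maxxx.
  - move=> y'; rewrite inE => /orP[/eqP->|y's] z; first by rewrite le_max lexx.
    by rewrite le_max (hs y')// orbT.
have [h [ah hl hu]] : exists h, [/\ ap h, forall z, K z -> g z - e / 2 < h z &
    forall z, K z -> h z < g z + e / 2].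
  have /choice[H hH] := step1.
  pose U y := [set z | H y z < g z + e / 2].
  have oU y : setT y -> open (U y).
    move=> _; rewrite (_ : U y = (fun z => (g z + e / 2) - H y z) @^-1` [set t | 0 < t]).
      apply: open_comp; last exact: open_gt.
      move=> z _; apply: contB; last by have [/ap_continuous] := hH y.
      exact: contD.
    by apply/seteqP; split => z; rewrite /U /= subr_gt0.
  have KU : K `<=` cover setT U.
    move=> y _; exists y => //; rewrite /U/=; have [_ -> _] := hH y.
    by rewrite ltrDl.
  have [D _ KD] := cK _ _ _ oU KU.
  suff [h [ah hl hs]] : exists h, [/\ ap h, forall z, K z -> g z - e / 2 < h z &
      forall y, y \in (finmap.enum_fset D) -> forall z, h z <= H y z].
    exists h; split => // z Kz; have [y yD Uz] := KD _ Kz.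
    by apply: le_lt_trans Uz; exact: hs.
  elim: (finmap.enum_fset D) => [|y s [h [ah hl hs]]].
    exists (fun=> M); split => [|z _|//]; first exact: (ap_cst M).
    rewrite ltrBlDr (le_lt_trans (ler_norm _))//.
    by rewrite (le_lt_trans (gM z))// ltrDl.
  have [aHy _ Hyl] := hH y.
  exists (fun z => Num.min (H y z) (h z)); split.
  - exact: ap_min.
  - by move=> z Kz; rewrite lt_min Hyl// hl.
  - move=> y'; rewrite inE => /orP[/eqP->|y's] z; first by rewrite ge_min lexx.
    by rewrite ge_min (hs y')// orbT.
pose h' z := Num.max (- M) (Num.min M (h z)).
have ah' : ap h' := ap_max (ap_cst (- M)) (ap_min (ap_cst M) ah).
have h'M z : `|h' z| <= M.
  by rewrite ler_norml /h' le_max lexx/= ge_max ge_min lexx/= andbT; lra.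
have [p tp hp] := ah' _ e20; exists p; split => // x.
- move=> Kx; rewrite -(subrK (h' x) (g x)) -addrA (splitr e).
  rewrite (le_trans (ler_normD _ _))// lerD//.
  have := gM x; have := hl _ Kx; have := hu _ Kx; rewrite /h' !ler_norml.
  move=> h1 h2 /andP[h3 h4].
  rewrite /Num.max /Num.min.
  by case: (ltrP M (h x)) => ?; case: ltrP => ?; apply/andP; split; lra.
- rewrite -(subrK (h' x) (p x)) addrC (le_trans (ler_normD _ _))// lerD//.
  by rewrite distrC (le_trans (hp x))//; lra.
Qed.

End trig_approximation.

(** * The Loeb space of a sequence space *)
Section ultralimit.
Context {R : realType} (U : set_system nat) {FU : UltraFilter U}.

Definition ulim (u : nat -> R) : R := lim (u n @[n --> U]).

Lemma ulim_cvg (u : nat -> R) (M : R) : (\forall n \near U, `|u n| <= M) ->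
  u n @[n --> U] --> ulim u.
Proof.
move=> uM.
suff [l ul] : exists l : R, u n @[n --> U] --> l
  by rewrite /ulim; have -> := cvg_lim (@Rhausdorff R) ul.
have UF : ProperFilter (u n @[n --> U]) by exact: fmap_proper_filter.
have UK : (u n @[n --> U]) `[- M, M]%classic.
  by apply: filterS uM => n; rewrite ler_norml /= in_itv.
have [l [_ cl]] := @segment_compact R (- M) M _ UF UK.
exists l => B Bl; have [//|UnB] := in_ultra_setVsetC (u @^-1` B) FU.
by have [x []] := cl (~` B) B UnB Bl.
Qed.

Lemma ulimE (u : nat -> R) (l : R) : u n @[n --> U] --> l -> ulim u = l.
Proof. by move=> ul; rewrite /ulim (cvg_lim (@Rhausdorff R) ul). Qed.

Lemma ulim_le (u v : nat -> R) (M : R) : (\forall n \near U, `|u n| <= M) ->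
  (\forall n \near U, `|v n| <= M) -> (\forall n \near U, u n <= v n) ->
  ulim u <= ulim v.
Proof.
move=> uM vM uv; have cu := ulim_cvg uM; have cv := ulim_cvg vM.
by apply: ler_lim uv; apply/cvg_ex; eexists; [exact: cu|exact: cv].
Qed.

Lemma ulim_cst (a : R) : ulim (fun=> a) = a.
Proof. by apply: ulimE; exact: cvg_cst. Qed.

Lemma ulim_near (u v : nat -> R) : (\forall n \near U, u n = v n) ->
  ulim u = ulim v.
Proof.
move=> uv; rewrite /ulim; congr (lim _); apply/seteqP; split => B /= UB.
  by apply: filterS2 uv UB => n /= <-.
by apply: filterS2 uv UB => n /= ->.
Qed.

End ultralimit.

Section loeb_space.
Context (U : set_system nat) {FU : UltraFilter U} (Uoo : \oo `<=` U).
Context {disp : measure_display} {T : measurableType disp}.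

Definition internal (A : nat -> set T) : set (nat -> T) :=
  [set w | \forall n \near U, A n (w n)].

(** A transfer principle: otherwise a choice of points in [A n] outside [B n]
    would be an element of the left-hand side alone. *)
Lemma internal_sub A B : internal A `<=` internal B ->
  \forall n \near U, A n `<=` B n.
Proof.
move=> AB; have [//|UN] := in_ultra_setVsetC [set n | A n `<=` B n] FU.
have /choice[w hw] : forall n, exists x : T, (~ (A n `<=` B n)) -> A n x /\ ~ B n x.
  move=> n; have [|nAB] := pselect (A n `<=` B n); first by exists point.
  have [x xAB] : exists x, ~ (A n x -> B n x) by apply/existsNP.
  by exists x => _; exact/not_implyP.
have : internal A w by apply: filterS UN => n /= /hw[].
move=> /AB wB; exfalso; have : U set0 by apply: filterS2 wB UN => n Bw /hw[].
exact: filter_not_empty.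
Qed.

Lemma internalI A B : internal (fun n => A n `&` B n) = internal A `&` internal B.
Proof.
apply/seteqP; split => w /=.
  by move=> h; split; apply: filterS h => n [].
by move=> [hA hB]; apply: filterS2 hA hB.
Qed.

Lemma internalC A : internal (fun n => ~` A n) = ~` internal A.
Proof.
apply/seteqP; split => w /=.
  move=> hA hB; have : U set0 by apply: filterS2 hA hB => n.
  exact: filter_not_empty.
by move=> nA; have [/nA|] := in_ultra_setVsetC [set n | A n (w n)] FU.
Qed.

Lemma internal0 : internal (fun=> set0) = set0.
Proof. by apply/seteqP; split => w //= /filter_not_empty. Qed.

Lemma internalT : internal (fun=> setT) = setT.
Proof. by apply/seteqP; split => w //= _; exact: filterT. Qed.

Lemma internalU A B : internal (fun n => A n `|` B n) = internal A `|` internal B.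
Proof.
rewrite -[RHS]setCK setCU -!internalC -internalI -internalC; congr internal.
by apply/funext => n; rewrite -setCU setCK.
Qed.

(** Countable saturation of internal sets.  At index [n] pick a point of the
    deepest nonempty intersection of level at most [n]; because [U] contains the
    cofinite sets, every level is eventually reached. *)
Lemma internal_saturation (B : nat -> nat -> set T) :
  (forall k, internal (B k) !=set0) ->
  (forall k, internal (B k.+1) `<=` internal (B k)) ->
  (\bigcap_k internal (B k)) !=set0.
Proof.
move=> B0 Bdec.
pose C k n := \bigcap_(j in [set j | (j <= k)%N]) B j n.
have UC k : \forall n \near U, B k n `<=` C k n.
  elim: k => [|k ih]; first by apply: nearW => n x Bx j /=; rewrite leqn0 => /eqP->.
  have := internal_sub (Bdec k); apply: filterS2 ih => n BC Bk x Bx j /=.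
  rewrite leq_eqVlt => /orP[/eqP->//|]; rewrite ltnS; exact: BC (Bk _ Bx) _.
have UC0 k : \forall n \near U, C k n !=set0.
  have [w Bw] := B0 k; apply: filterS2 (UC k) Bw => n BC Bw.
  by exists (w n); exact: BC.
have Csub n k k' : (k <= k')%N -> C k' n `<=` C k n.
  by move=> kk x Cx j /= jk; apply: Cx; exact: leq_trans jk kk.
have pick n : exists x, forall k, (k <= n)%N -> C k n !=set0 -> C k n x.
  pose D := [set k | (k <= n)%N && `[< C k n !=set0 >]].
  suff : forall N, exists x, forall k, (k <= N)%N -> C k n !=set0 -> C k n x by exact.
  elim=> [|N [x hx]].
    have [[x Cx]|nC] := pselect (C 0%N n !=set0).
      by exists x => k; rewrite leqn0 => /eqP->.
    by exists point => k; rewrite leqn0 => /eqP-> /nC.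
  have [[y Cy]|nC] := pselect (C N.+1 n !=set0).
    by exists y => k kN _; exact: Csub Cy.
  exists x => k; rewrite leq_eqVlt => /orP[/eqP->/nC//|]; rewrite ltnS; exact: hx.
have [w hw] := choice pick.
exists w => k _; have nk : \forall n \near U, (k <= n)%N by apply: Uoo; exists k.
apply: filterS2 nk (UC0 k) => n kn /(hw n k kn); apply; exact: leqnn.
Qed.

End loeb_space.

(** An alias indexed by the ultrafilter, so that the algebra of internal sets
    can be attached to it canonically. *)
Definition loeb (U : set_system nat) (FU : UltraFilter U) (Uoo : \oo `<=` U)
  (T : Type) := nat -> T.

Definition loeb_display : measure_display -> measure_display.
Proof. exact: id. Qed.

Section loeb_algebra.
Context (U : set_system nat) (FU : UltraFilter U) (Uoo : \oo `<=` U).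
Context {disp : measure_display} {T : measurableType disp}.

HB.instance Definition _ := Pointed.on (loeb FU Uoo T).

Definition loeb_measurable : set (set (loeb FU Uoo T)) :=
  [set internal U A | A in [set A | forall n, measurable (A n : set T)]].

Let loeb0 : loeb_measurable set0.
Proof. by exists (fun=> set0) => //; exact: internal0. Qed.

Let loebU : setU_closed loeb_measurable.
Proof.
move=> _ _ [A mA <-] [B mB <-]; exists (fun n => A n `|` B n).
  by move=> n; exact: measurableU.
exact: internalU.
Qed.

Let loebC : setC_closed loeb_measurable.
Proof.
move=> _ [A mA <-]; exists (fun n => ~` A n).
  by move=> n; exact: measurableC.
exact: internalC.
Qed.

HB.instance Definition _ := isAlgebraOfSets.Build (loeb_display disp)
  (loeb FU Uoo T) loeb0 loebU loebC.

End loeb_algebra.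

Section loeb_measure.
Context {R : realType}.
Context (U : set_system nat) (FU : UltraFilter U) (Uoo : \oo `<=` U).
Context {disp : measure_display} {T : measurableType disp} (P : probability T R).
Local Notation LT := (loeb FU Uoo T).

Let prb (A : nat -> set T) n : R := fine (P (A n)).

Let prb_bound (A : nat -> set T) : (forall n, measurable (A n)) ->
  \forall n \near U, `|prb A n| <= 1.
Proof.
move=> mA; apply: nearW => n; rewrite ger0_norm ?fine_ge0//.
by rewrite -lee_fin fineK ?fin_num_measure// probability_le1.
Qed.

Definition loeb_content (S : set LT) : \bar R :=
  if pselect (loeb_measurable S) is left h then
    (ulim U (prb (projT1 (cid2 h))))%:E else 0%E.

Lemma loeb_contentE (A : nat -> set T) : (forall n, measurable (A n)) ->
  loeb_content (internal U A) = (ulim U (fun n => fine (P (A n))))%:E.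
Proof.
move=> mA; rewrite /loeb_content; case: pselect => [h|nA]; last first.
  by exfalso; apply: nA; exists A.
case: cid2 => B /= mB BA; congr EFin; apply: ulim_near.
have AB : \forall n \near U, A n `<=` B n.
  by apply: internal_sub; rewrite BA.
have BA' : \forall n \near U, B n `<=` A n.
  by apply: internal_sub; rewrite BA.
apply: filterS2 AB BA' => n AB BA'; rewrite /prb; congr (fine (P _)); exact/seteqP.
Qed.

Let loeb_content0 : loeb_content set0 = 0%E.
Proof.
rewrite -(internal0 (U := U)) loeb_contentE//; congr EFin.
rewrite (_ : (fun _ => _) = fun=> 0) ?ulim_cst//.
by apply/funext => n; rewrite measure0.
Qed.

Let loeb_content_ge0 (S : set LT) : (0 <= loeb_content S)%E.
Proof.
rewrite /loeb_content; case: pselect => // h; case: cid2 => A /= mA _.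
rewrite lee_fin -[leLHS](ulim_cst (U := U)).
apply: (ulim_le (M := 1)); [|exact: prb_bound|].
  by apply: nearW => n; rewrite normr0.
by apply: nearW => n; exact: fine_ge0.
Qed.

Let loeb_content_additive2 : semi_additive2 loeb_content.
Proof.
move=> _ _ [A mA <-] [B mB <-] _ AB0.
rewrite -internalU !loeb_contentE//; last by move=> n; exact: measurableU.
rewrite -EFinD; congr EFin; apply: ulimE.
have AB : \forall n \near U, A n `&` B n `<=` set0.
  have := @internal_sub U FU _ T (fun n => A n `&` B n) (fun=> set0).
  by apply; rewrite internalI AB0; exact: sub0set.
have c : prb A n + prb B n @[n --> U] --> ulim U (prb A) + ulim U (prb B).
  exact: cvgD (ulim_cvg (prb_bound mA)) (ulim_cvg (prb_bound mB)).
apply: cvg_trans c; apply: near_eq_cvg; apply: filterS AB => n /=; rewrite subset0 => AB.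
by rewrite measureU// fineD// fin_num_measure.
Qed.

(** By saturation a countable union of internal sets that is itself internal is
    already a finite union, so finite additivity suffices. *)
Let loeb_semi_sigma_additive : semi_sigma_additive loeb_content.
Proof.
move=> F mF tF mUF.
have addf := (additive2P loeb_content0).2.
have {}addf : measure_function.semi_additive loeb_content.
  by apply: addf; rewrite -semi_additive2E; exact: loeb_content_additive2.
have [N FN] : exists N, \bigcup_i F i `<=` \big[setU/set0]_(i < N) F i.
  apply: contrapT => /forallNP nN.
  pose D N := (\bigcup_i F i) `\` \big[setU/set0]_(i < N) F i.
  have mD N : measurable (D N).
    by apply: measurableD => //; apply: bigsetU_measurable => i _; exact: mF.
  have /choice[B hB] : forall N, exists B, (forall n, measurable (B n : set T)) /\ internal U B = D N.
    by move=> N; have [B mB BD] := mD N; exists B.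
  have [|k|w hw] := @internal_saturation U FU Uoo _ T B.
  - move=> k; rewrite (hB k).2; apply/set0P/eqP => Dk0; apply: (nN k).
    by move=> w Fw; apply: contrapT => nFw; have : D k w by []; rewrite Dk0.
  - rewrite (hB k).2 (hB k.+1).2 /D => w [Fw nw]; split => //.
    by move=> h; apply: nw; rewrite big_ord_recr; left.
  have [i _ Fi] : (\bigcup_i F i) w by have := hw 0%N I; rewrite (hB 0%N).2 => -[].
  have := hw i.+1 I; rewrite (hB i.+1).2 => -[_]; apply.
  by rewrite big_ord_recr; right.
have FE k : (N <= k)%N -> \bigcup_i F i = \big[setU/set0]_(i < k) F i.
  move=> Nk; apply/seteqP; split => w.
    move=> /FN; rewrite -!bigcup_mkord => -[i /= iN Fi]; exists i => //=.
    exact: leq_trans iN Nk.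
  by rewrite -bigcup_mkord => -[i _ Fi]; exists i.
apply: cvg_near_cst; exists N => // k /= Nk.
rewrite (FE k Nk) big_mkord; apply/esym/addf => //.
by rewrite -(FE k Nk).
Qed.

HB.instance Definition _ := isMeasure.Build _ _ _ loeb_content
  loeb_content0 loeb_content_ge0 loeb_semi_sigma_additive.

Definition loeb_prob := measure_extension loeb_content.
HB.instance Definition _ := Measure.on loeb_prob.

Lemma loeb_prob_internal (A : nat -> set T) : (forall n, measurable (A n)) ->
  loeb_prob (internal U A) = (ulim U (fun n => fine (P (A n))))%:E.
Proof.
move=> mA; rewrite /loeb_prob /measure_extension measurable_mu_extE.
  exact: loeb_contentE.
by exists A.
Qed.

Let loeb_setT : loeb_prob setT = 1%E.
Proof.
rewrite -(internalT (U := U)) loeb_prob_internal//; congr EFin.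
rewrite (_ : (fun _ => _) = fun=> 1) ?ulim_cst//.
by apply/funext => n; rewrite probability_setT.
Qed.

HB.instance Definition _ := @Measure_isProbability.Build _ _ R loeb_prob loeb_setT.

Lemma internal_measurable (A : nat -> set T) : (forall n, measurable (A n)) ->
  measurable (internal U A : set (g_sigma_algebraType (@measurable _ LT))).
Proof. by move=> mA; apply: sub_sigma_algebra; exists A. Qed.

End loeb_measure.

Section loeb_integral.
Context {R : realType}.
Context (U : set_system nat) (FU : UltraFilter U) (Uoo : \oo `<=` U).
Context {disp : measure_display} {T : measurableType disp} (P : probability T R).
Local Notation LT := (g_sigma_algebraType (@measurable _ (loeb FU Uoo T))).
Local Notation Q := (@loeb_prob R U FU Uoo disp T P).

(** The sequences along which [h] is finite in the limit. *)
Definition stdpart_dom (h : nat -> T -> R) : set LT :=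
  \bigcup_M internal U (fun n => [set x | `|h n x| <= M%:R]).

Definition stdpart (h : nat -> T -> R) (w : LT) : R :=
  if pselect (stdpart_dom h w) then ulim U (fun n => h n (w n)) else 0.

Lemma stdpart_cvg (h : nat -> T -> R) (w : LT) : stdpart_dom h w ->
  h n (w n) @[n --> U] --> stdpart h w.
Proof.
by rewrite /stdpart => hw; case: pselect => //= _; have [M _ hM] := hw; exact: ulim_cvg hM.
Qed.

Let gt_measurable (h : nat -> T -> R) (a : R) :
  (forall n, measurable_fun setT (h n)) ->
  measurable (internal U (fun n => [set x | a < h n x]) : set LT).
Proof.
move=> mh; apply: internal_measurable => n.
rewrite (_ : [set x | _] = h n @^-1` [set` `]a, +oo[]).
  by rewrite -[X in measurable X]setTI; exact: mh.
by apply/seteqP; split => x /=; rewrite in_itv/= andbT.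
Qed.

Let le_measurable (h : nat -> T -> R) (a : R) :
  (forall n, measurable_fun setT (h n)) ->
  forall n, measurable [set x | `|h n x| <= a].
Proof.
move=> mh n; rewrite (_ : [set x | _] = h n @^-1` [set` `[- a, a]]).
  by rewrite -[X in measurable X]setTI; exact: mh.
by apply/seteqP; split => x /=; rewrite in_itv/= ler_norml.
Qed.

Lemma measurable_stdpart_dom (h : nat -> T -> R) :
  (forall n, measurable_fun setT (h n)) -> measurable (stdpart_dom h).
Proof.
move=> mh; apply: bigcup_measurable => M _; apply: internal_measurable.
exact: le_measurable.
Qed.

Lemma measurable_stdpart (h : nat -> T -> R) :
  (forall n, measurable_fun setT (h n)) -> measurable_fun setT (stdpart h).
Proof.
move=> mh mD; apply: (measurability _ (RGenOInfty.measurableE R)) => //.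
move=> _ [_ [a ->] <-]; rewrite setTI.
have mC := measurable_stdpart_dom mh.
rewrite (_ : _ @^-1` _ = (stdpart_dom h `&`
    \bigcup_k internal U (fun n => [set x | a + k.+1%:R^-1 < h n x])) `|`
  (~` stdpart_dom h `&` [set _ | a < 0])).
  apply: measurableU; apply: measurableI => //; last first.
  - by have [a0|a0] := boolP (a < 0); [rewrite (_ : [set _ | _] = setT)//|rewrite (_ : [set _ | _] = set0)//];
      apply/seteqP; split => //.
  - exact: measurableC.
  - by apply: bigcup_measurable => k _; exact: gt_measurable.
apply/seteqP; split => w /=; rewrite in_itv/= andbT.
- move=> aw; have [dw|ndw] := pselect (stdpart_dom h w); last first.
    by right; split => //; move: aw; rewrite /stdpart; case: pselect.
  left; split=> //; have d0 : 0 < (stdpart h w - a) / 2 by rewrite divr_gt0 ?subr_gt0.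
  have [k _ hk] := @near_infty_natSinv_lt R (PosNum d0).
  have {}hk : k.+1%:R^-1 < (stdpart h w - a) / 2 := hk k (leqnn k).
  exists k => //; have /cvgrPdist_lt/(_ _ d0) := stdpart_cvg dw.
  apply: filterS => n /=; rewrite ltr_norml; move: hk.
  by move: (k.+1%:R^-1) (h n (w n)) (stdpart h w) => u v z hk /andP[? ?]; lra.
- move=> [[dw [k _ hk]]|[ndw a0]]; last by rewrite /stdpart; case: pselect.
  have : a + k.+1%:R^-1 <= stdpart h w.
    rewrite -(ulimE (stdpart_cvg dw)); move: dw => [M _ hM].
    rewrite -[leLHS](ulim_cst (U := U)).
    apply: (ulim_le (M := Num.max `|a + k.+1%:R^-1| M%:R)).
    + by apply: nearW => n; rewrite le_max lexx.
    + by apply: filterS hM => n /= hM; rewrite le_max hM orbT.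
    + by apply: filterS hk => n /= /ltW.
  by apply: lt_le_trans; rewrite ltrDl.
Qed.

Lemma stdpart_bdd (h : nat -> T -> R) (M : R) w : (forall n x, `|h n x| <= M) ->
  stdpart_dom h w.
Proof.
move=> hM; exists (Num.truncn M).+1 => //; apply: nearW => n /=.
by rewrite (le_trans (hM _ _))// ltW// truncnS_gt.
Qed.

(** Both sides are within [1/N] of the mean of the masses of [N] internal level
    sets, by the layer decomposition. *)
Let Ex01 (h : nat -> T -> R) : (forall n, measurable_fun setT (h n)) ->
  (forall n x, 0 <= h n x <= 1) ->
  Ex Q (stdpart h) = ulim U (fun n => Ex P (h n)).
Proof.
move=> mh h01.
have h1 n x : `|h n x| <= 1 by have /andP[? ?] := h01 n x; rewrite ger0_norm.
have iH : integ Q (stdpart h).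
  apply: bddmeas_integ; split; first exact: measurable_stdpart.
  exists 1 => w; have := stdpart_cvg (stdpart_bdd w h1).
  move=> /cvg_norm /ulimE <-; rewrite -[leRHS](ulim_cst (U := U)).
  apply: (ulim_le (M := 1)); apply: nearW => n; rewrite ?normr_id//.
  by rewrite normr1.
have ih n : integ P (h n).
  by apply: bddmeas_integ; split; [exact: mh|exists 1 => x; exact: h1].
apply/eqP; rewrite -subr_eq0 -normr_le0; apply/ler_addgt0Pr => e e0; rewrite add0r.
have e20 : 0 < e / 2 by rewrite divr_gt0.
have [k _ hk] := @near_infty_natSinv_lt R (PosNum e20).
have {}hk : k.+1%:R^-1 < e / 2 := hk k (leqnn k).
pose A (i : 'I_k.+1) n := [set x | i.+1%:R / k.+1%:R <= h n x].
have mA i n : measurable (A i n).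
  rewrite (_ : A i n = h n @^-1` [set` `[i.+1%:R / k.+1%:R, +oo[]).
    by rewrite -[X in measurable X]setTI; exact: mh.
  by apply/seteqP; split => x; rewrite /A /= in_itv/= andbT.
pose L n x := k.+1%:R^-1 * \sum_i (\1_(A i n) x : R).
have Lh n x : `|h n x - L n x| <= k.+1%:R^-1.
  rewrite (le_trans _ (layer_approx k (h01 n x)))// /L.
  rewrite [in leLHS](eq_bigr (fun i : 'I_k.+1 => (i.+1%:R / k.+1%:R <= h n x)%R%:R))//.
  by move=> i _; rewrite indicE; congr ((nat_of_bool _)%:R); apply/idP/idP; rewrite inE.
have iA i n : integ P (\1_(A i n)) by apply/bddmeas_integ/bddmeas_indic.
pose LL w := k.+1%:R^-1 * \sum_i (\1_(internal U (A i)) w : R).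
have miA i : measurable (internal U (A i) : set LT) by exact: internal_measurable.
have iiA i : integ Q (\1_(internal U (A i))) by apply/bddmeas_integ/bddmeas_indic.
have iL n : integ P (L n) by apply: integZ; exact: integ_sum.
have iLL : integ Q LL by apply: integZ; exact: integ_sum.
have cInd (w : LT) i : (\1_(A i n) (w n) : R) @[n --> U] --> (\1_(internal U (A i)) w : R).
  have [wA|wA] := pselect (internal U (A i) w).
    rewrite (_ : \1_ _ w = 1); last by rewrite indicE mem_set.
    by apply: cvg_near_cst; apply: filterS wA => n wA; rewrite indicE mem_set.
  rewrite (_ : \1_ _ w = 0); last by rewrite indicE memNset.
  apply: cvg_near_cst; have : internal U (fun n => ~` A i n) w by rewrite internalC.
  by apply: filterS => n {}wA; rewrite indicE memNset.
have cL (w : LT) : L n (w n) @[n --> U] --> LL w.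
  apply: cvgM; first exact: cvg_cst.
  by apply: cvg_big => [|i _]; [exact: add_continuous|exact: cInd].
have cE : Ex P (L n) @[n --> U] --> Ex Q LL.
  have EL n : Ex P (L n) = k.+1%:R^-1 * \sum_i fine (P (A i n)).
    rewrite /L ExZ; last exact: integ_sum.
    by rewrite Ex_sum//; congr (_ * _); apply: eq_bigr => i _; rewrite Ex_indic.
  have -> : Ex Q LL = k.+1%:R^-1 * \sum_i ulim U (fun n => fine (P (A i n))).
    rewrite /LL ExZ; last exact: integ_sum.
    rewrite Ex_sum//; congr (_ * _); apply: eq_bigr => i _.
    by rewrite Ex_indic//= loeb_prob_internal.
  under eq_fun do rewrite EL.
  apply: cvgM; first exact: cvg_cst.
  apply: cvg_big => [|i _]; first exact: add_continuous.
  apply: (@ulim_cvg _ _ _ _ 1); apply: nearW => n.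
  rewrite ger0_norm ?fine_ge0//.
  by rewrite -lee_fin fineK ?fin_num_measure// probability_le1.
have cH : Ex P (h n) @[n --> U] --> ulim U (fun n => Ex P (h n)).
  by apply: (@ulim_cvg _ _ _ _ 1); apply: nearW => n; exact: Ex_bound.
have d1 : `|Ex Q (stdpart h) - Ex Q LL| <= k.+1%:R^-1.
  rewrite -ExB//; apply: Ex_bound => [|w]; first exact: integB.
  have c : h n (w n) - L n (w n) @[n --> U] --> stdpart h w - LL w.
    by apply: cvgB; [exact: stdpart_cvg (stdpart_bdd w h1)|exact: cL].
  rewrite -(ulimE (cvg_norm c)).
  rewrite -[leRHS](ulim_cst (U := U)).
  apply: (ulim_le (M := k.+1%:R^-1)); apply: nearW => n; rewrite ?normr_id//.
  by rewrite ger0_norm.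
have d2 : `|ulim U (fun n => Ex P (h n)) - Ex Q LL| <= k.+1%:R^-1.
  have c : Ex P (h n) - Ex P (L n) @[n --> U] --> ulim U (fun n => Ex P (h n)) - Ex Q LL.
    by apply: cvgB.
  rewrite -(ulimE (cvg_norm c)).
  rewrite -[leRHS](ulim_cst (U := U)).
  apply: (ulim_le (M := k.+1%:R^-1)); apply: nearW => n; rewrite ?normr_id//; last 2 first.
  - by rewrite ger0_norm.
  - by rewrite -ExB//; apply: Ex_bound => //; exact: integB.
  by rewrite -ExB//; apply: Ex_bound => //; exact: integB.
rewrite -(subrK (Ex Q LL) (Ex Q (stdpart h))) -addrA (splitr e).
rewrite (le_trans (ler_normD _ _))// lerD//; first by rewrite (le_trans d1)// ltW.
by rewrite distrC (le_trans d2)// ltW.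
Qed.

Lemma Ex_stdpart (h : nat -> T -> R) (M : R) :
  (forall n, measurable_fun setT (h n)) -> (forall n x, `|h n x| <= M) ->
  Ex Q (stdpart h) = ulim U (fun n => Ex P (h n)).
Proof.
move=> mh hM; pose K := M + 1.
have M0 : 0 <= M by exact: le_trans (hM 0%N point).
have K0 : 0 < K by rewrite ltr_wpDl.
have hK n x : `|h n x| <= K by rewrite (le_trans (hM _ _))// lerDl.
pose h' n x := (2 * K)^-1 * h n x + 2^-1.
have mh' n : measurable_fun setT (h' n).
  by apply: measurable_funD => //; apply: measurable_funM.
have h'01 n x : 0 <= h' n x <= 1.
  have := hK n x; rewrite ler_norml => /andP[h1 h2].
  have hh : -1 <= K^-1 * h n x <= 1.
    by rewrite ler_pdivlMl// mulrN1 ler_pdivrMl// mulr1 h1.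
  rewrite /h' invfM -mulrA; move: hh => /andP[? ?]; apply/andP; split; lra.
have := Ex01 mh' h'01.
have ih n : integ P (h n) by apply: bddmeas_integ; split => //; exists M.
have sE w : stdpart h' w = (2 * K)^-1 * stdpart h w + 2^-1.
  have h'1 n x : `|h' n x| <= 1 by have /andP[? ?] := h'01 n x; rewrite ger0_norm.
  rewrite -(ulimE (stdpart_cvg (stdpart_bdd w h'1))); apply: ulimE.
  apply: cvgD; last exact: cvg_cst.
  apply: cvgM; first exact: cvg_cst.
  exact: stdpart_cvg (stdpart_bdd w hM).
have iS : integ Q (stdpart h).
  apply: bddmeas_integ; split; first exact: measurable_stdpart.
  exists M => w; have := stdpart_cvg (stdpart_bdd w hM).
  move=> /cvg_norm /ulimE <-; rewrite -[leRHS](ulim_cst (U := U)).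
  apply: (ulim_le (M := M)); apply: nearW => n; rewrite ?normr_id//.
  by rewrite ger0_norm.
rewrite (_ : stdpart h' = fun w => (2 * K)^-1 * stdpart h w + 2^-1); last exact/funext.
rewrite ExD ?ExZ ?Ex_cst//; [|exact: integZ|exact: integ_cst].
have -> : ulim U (fun n => Ex P (h' n)) =
   (2 * K)^-1 * ulim U (fun n => Ex P (h n)) + 2^-1.
  apply: ulimE; under eq_fun do
    (rewrite /h' ExD ?ExZ ?Ex_cst//; [|exact: integZ|exact: integ_cst]).
  apply: cvgD; last exact: cvg_cst.
  apply: cvgM; first exact: cvg_cst.
  apply: (@ulim_cvg _ _ _ _ M); apply: nearW => n; apply: Ex_bound => //.
move=> /addIr /mulfI; apply.
by rewrite invr_eq0 mulf_neq0// gt_eqF.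
Qed.

(** The complement is contained in the internal sets [{M < |h n|}], whose Loeb
    mass is the limit of their probabilities. *)
Lemma stdpart_dom_ae (h : nat -> T -> R) :
  (forall n, measurable_fun setT (h n)) ->
  (forall e, 0 < e -> exists M : R, \forall n \near U, Ex P (\1_[set x | M < `|h n x|]) <= e) ->
  {ae Q, forall w, stdpart_dom h w}.
Proof.
move=> mh tight; exists (~` stdpart_dom h); split; last by move=> w.
  by apply: measurableC; exact: measurable_stdpart_dom.
apply/eqP; rewrite -measure_le0; apply/lee_addgt0Pr => e e0; rewrite add0e.
have [M hM] := tight e e0.
pose N := (Num.truncn M).+1.
have MN : M <= N%:R by rewrite ltW// truncnS_gt.
pose A n := [set x | N%:R < `|h n x|].
have AE n : A n = ~` [set x | `|h n x| <= N%:R].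
  by apply/seteqP; split => x; rewrite /A /= ltNge => /negP.
have mA n : measurable (A n) by rewrite AE; apply: measurableC; exact: le_measurable.
have mB n : measurable [set x | M < `|h n x|].
  rewrite (_ : mkset _ = ~` [set x | `|h n x| <= M]).
    by apply: measurableC; exact: le_measurable.
  by apply/seteqP; split => x; rewrite /A /= ltNge => /negP.
apply: (@le_trans _ _ (Q (internal U A))).
  apply: le_measure; rewrite ?inE.
  - by apply: measurableC; exact: measurable_stdpart_dom.
  - exact: internal_measurable.
  - move=> w nw; rewrite (_ : A = fun n => ~` [set x | `|h n x| <= N%:R]); last exact/funext.
    by rewrite internalC => hw; apply: nw; exists N.
rewrite loeb_prob_internal// lee_fin -[leRHS](ulim_cst (U := U)).
apply: (ulim_le (M := Num.max 1 e)).
- apply: nearW => n; rewrite ger0_norm ?fine_ge0// le_max.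
  by rewrite -lee_fin fineK ?fin_num_measure// probability_le1.
- by apply: nearW => n; rewrite (ger0_norm (ltW e0)) le_max lexx orbT.
- apply: filterS hM => n; apply: le_trans; rewrite Ex_indic//.
  rewrite fine_le ?fin_num_measure// le_measure ?inE// => x; exact: le_lt_trans.
Qed.

End loeb_integral.

(** * Normal laws: moments and characteristic function *)
Lemma is_derive_quadratic (R : realType) (f : R -> R) (x d K : R) :
  (forall h, `|f (x + h) - f x - h * d| <= K * h ^+ 2) ->
  is_derive x (1 : R) f d.
Proof.
move=> fK.
have K0 : 0 <= K.
  by have := fK 1; rewrite expr1n mulr1; apply: le_trans.
have cv : (fun h : R => h^-1 *: (f (h *: (1 : R) + x) - f x)) @ 0^' --> d.
  apply/cvgrPdist_le => e e0.
  have eK : 0 < e / (K + 1) by rewrite divr_gt0// ltr_wpDl.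
  near=> h.
  have h0 : h != 0 by near: h; exact: nbhs_dnbhs_neq.
  have hk : `|h| < e / (K + 1).
    by near: h; apply: dnbhs0_lt.
  have -> : d - h^-1 *: (f (h *: (1 : R) + x) - f x) =
      - (h^-1 * (f (x + h) - f x - h * d)).
    by rewrite /GRing.scale/= mulr1 (addrC h x); field.
  rewrite normrN normrM normfV ler_pdivrMl ?normr_gt0//.
  rewrite (le_trans (fK h))// -(@real_normK _ h) ?num_real// expr2 mulrCA.
  rewrite ler_wpM2l//; move: hk; rewrite ltr_pdivlMr ?ltr_wpDl// => hk.
  by rewrite (le_trans _ (ltW hk))// mulrDr mulr1 mulrC lerDl.
apply: DeriveDef; first by apply/cvg_ex; exists d.
exact: (cvg_lim (@Rhausdorff R) cv).
Unshelve. all: by end_near. Qed.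

Section normal_law.
Context {R : realType}.
Variable s : R.
Hypothesis s_gt0 : 0 < s.
Let s0 : s != 0. Proof. by rewrite gt_eqF. Qed.
Local Notation mu := (@lebesgue_measure R).
Local Notation nu := (normal_prob 0 s).
Local Notation p := (normal_pdf 0 s).

Let p_ge0 x : 0 <= p x. Proof. exact: normal_pdf_ge0. Qed.

Let mp : measurable_fun setT (fun x => (p x)%:E).
Proof. by apply/measurable_EFinP; exact: measurable_normal_pdf. Qed.

Let ge0_integral_normal (f : R -> \bar R) : measurable_fun setT f ->
  (forall x, 0 <= f x)%E -> (\int[nu]_x f x = \int[mu]_x (f x * (p x)%:E))%E.
Proof.
move=> mf f0.
have dom := normal_prob_dominates 0 s.
rewrite -(Radon_Nikodym_SigmaFinite.change_of_variables (mu := mu) dom)//.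
have ae : ae_eq mu setT (Radon_Nikodym_SigmaFinite.f nu mu) (fun x => (p x)%:E).
  apply: integral_ae_eq => //.
    exact: Radon_Nikodym_SigmaFinite.f_integrable.
  by move=> A _ mA; rewrite -Radon_Nikodym_SigmaFinite.f_integral.
apply: ae_eq_integral => //.
- apply: emeasurable_funM => //.
  exact: measurable_int (Radon_Nikodym_SigmaFinite.f_integrable dom).
- exact: emeasurable_funM.
- by apply: filterS ae => x /(_ Logic.I) + _ => ->.
Qed.

Let lint (f : R -> R) := mu.-integrable setT (EFin \o f).

Let ge0_normal (f : R -> R) : integ nu f -> (forall x, 0 <= f x) ->
  lint (fun x => f x * p x) /\ Ex nu f = (\int[mu]_(x in setT) (f x * p x))%R.
Proof.
move=> nf f0.
have mf : measurable_fun setT f := integ_meas nf.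
have E : (\int[nu]_x (f x)%:E = \int[mu]_x (f x * p x)%:E)%E.
  rewrite ge0_integral_normal//; first exact/measurable_EFinP.
split; last by rewrite /Ex /Rintegral E.
apply/integrableP; split.
  by apply/measurable_EFinP/measurable_funM => //; exact: measurable_normal_pdf.
under eq_integral => x _ do rewrite /= ger0_norm ?mulr_ge0//.
rewrite -E; move/integrableP : nf => [_].
by under eq_integral => x _ do rewrite /= ger0_norm//.
Qed.

Lemma normal_Ex (f : R -> R) : integ nu f ->
  lint (fun x => f x * p x) /\ Ex nu f = (\int[mu]_(x in setT) (f x * p x))%R.
Proof.
move=> nf.
have [i1 e1] := ge0_normal (integ_norm nf) (fun x => normr_ge0 _).
have nB := integB (integ_norm nf) nf.
have [|i2 e2] := ge0_normal nB.
  by move=> x; rewrite subr_ge0 ler_norm.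
have fE : f = fun x => `|f x| - (`|f x| - f x) by apply/funext => x; rewrite opprB addrC subrK.
split.
  rewrite (_ : (fun x => f x * p x) = fun x => `|f x| * p x - (`|f x| - f x) * p x).
    by have := integrableB measurableT i1 i2.
  by apply/funext => x; rewrite -mulrBl opprB addrC subrK.
rewrite {1}fE ExB//; last exact: integ_norm.
rewrite e1 e2 -RintegralB//; apply: eq_Rintegral => x _.
by rewrite -mulrBl opprB addrC subrK.
Qed.

Let itv_n n : set R := `[- n.+1%:R, n.+1%:R]%classic.

Let FTC_sym (F f : R -> R) (n : nat) : (forall x : R, is_derive x (1 : R) F (f x)) ->
  continuous f ->
  (\int[mu]_(x in itv_n n) (f x)%:E = (F n.+1%:R - F (- n.+1%:R))%R%:E)%E.
Proof.
move=> dF cf.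
have cF : continuous F.
  move=> x; apply/differentiable_continuous/derivable1_diffP.
  exact: (@ex_derive _ _ _ _ _ _ _ (dF x)).
apply: continuous_FTC2.
- by rewrite -subr_gt0 opprK addr_gt0.
- exact: continuous_subspaceT.
- split.
  + by move=> x _; exact: (@ex_derive _ _ _ _ _ _ _ (dF x)).
  + exact: cvg_at_right_filter (cF _).
  + exact: cvg_at_left_filter (cF _).
- by move=> x _; rewrite derive1E; exact: (@derive_val _ _ _ _ _ _ _ (dF x)).
Qed.

(** An integrable function whose primitive vanishes at infinity has integral 0.
    This is integration by parts on the line in the form used below. *)
Let FTC_line (F f : R -> R) (K : R) : (forall x : R, is_derive x (1 : R) F (f x)) ->
  continuous f -> lint f -> (forall x, 1 <= `|x| -> `|F x| <= K / `|x|) ->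
  (\int[mu]_(x in setT) f x)%R = 0.
Proof.
move=> dF cf lf FK.
have mf : measurable_fun setT f by exact: continuous_measurable_fun.
have h : (\int[mu]_x ((EFin \o f) \_ (itv_n n)) x @[n --> \oo] --> \int[mu]_x (EFin \o f) x)%E.
  have [] := @dominated_convergence _ _ R mu setT measurableT
    (fun n => (EFin \o f) \_ (itv_n n)) (EFin \o f) (abse \o (EFin \o f)) => //.
  - move=> n; apply/(measurable_restrictT _ (measurable_itv _)).
    by apply: measurable_funTS; exact/measurable_EFinP.
  - exact/measurable_EFinP.
  - apply: aeW => x _; apply: cvg_near_cst.
    exists (Num.truncn `|x|).+1 => // n /= xn; rewrite patchE mem_set//.
    rewrite /itv_n /= in_itv/= -ler_norml ltW// (lt_le_trans (truncnS_gt _))//.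
    by rewrite ler_nat ltnW.
  - exact: integrable_abse.
  - apply: aeW => x n _; rewrite patchE; case: ifP => // _.
    by rewrite abse0 abse_ge0.
have h2 : (\int[mu]_x ((EFin \o f) \_ (itv_n n)) x @[n --> \oo] --> 0%:E)%E.
  under eq_fun do rewrite -integral_mkcond (FTC_sym _ dF cf).
  apply: cvg_EFin; first by near=> n.
  apply/cvgrPdist_le => e e0.
  have K0 : 0 <= K by have := FK 1; rewrite normr1 divr1 => /(_ (lexx _)); apply: le_trans.
  near=> n; rewrite sub0r normrN /=.
  have n1 : 1 <= `|n.+1%:R : R| by rewrite ger0_norm// ler1n.
  have n1' : 1 <= `|- n.+1%:R : R| by rewrite normrN.
  have := FK _ n1; have := FK _ n1'; rewrite normrN (@ger0_norm _ n.+1%:R)// => a1 a2.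
  rewrite (le_trans (ler_normB _ _))// (le_trans (lerD a2 a1))//.
  rewrite -mulrDl -mulr2n -(mulr_natr K) ler_pdivrMr// -ler_pdivrMl//.
  near: n; exists (Num.truncn (e^-1 * (K * 2))) => // n /= xn.
  by rewrite ltW// (lt_le_trans (truncnS_gt _))// ler_nat ltnS.
by rewrite /Rintegral (cvg_unique _ h h2).
Unshelve. all: by end_near. Qed.

Let p_derive (x : R) : is_derive x (1 : R) p (- (x / s ^+ 2) * p x).
Proof.
have -> : p = fun x => normal_peak s * expR (- (2 * s ^+ 2)^-1 * x ^+ 2).
  apply/funext => y; rewrite /normal_pdf (negbTE s0) /normal_fun; congr (_ * expR _).
  by rewrite subr0 -mulr_natl mulrC mulrN mulNr.
apply: is_derive_eq.
rewrite /GRing.scale/=; field.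
exact: s0.
Qed.

Let p_continuous : continuous p. Proof. exact: continuous_normal_pdf. Qed.

Let K1 := normal_peak s * (2 * s ^+ 2).

Let p_decay (x : R) : x ^+ 2 * p x <= K1.
Proof.
rewrite /normal_pdf (negbTE s0) /normal_fun mulrCA ler_wpM2l ?normal_peak_ge0//.
rewrite subr0 mulNr expRN ler_pdivrMr ?expR_gt0//.
have ss : 0 < s ^+ 2 *+ 2 by rewrite pmulrn_lgt0// exprn_gt0.
apply: (@le_trans _ _ (2 * s ^+ 2 * (x ^+ 2 / (s ^+ 2 *+ 2)))).
  by rewrite le_eqVlt; apply/orP; left; apply/eqP; rewrite -(mulr_natl (s ^+ 2)); field; exact: s0.
have ss0 : 0 <= 2 * s ^+ 2 by rewrite mulr_ge0// sqr_ge0.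
rewrite ler_wpM2l//.
by rewrite (le_trans _ (expR_ge1Dx _))// lerDr.
Qed.

Let decay_x (x : R) : 1 <= `|x| -> `|x * p x| <= K1 / `|x|.
Proof.
move=> x1; have x0 : 0 < `|x| by rewrite (lt_le_trans ltr01).
rewrite ler_pdivlMr// normrM (ger0_norm (p_ge0 x)) mulrAC -expr2 real_normK ?num_real//.
Qed.

Let decay_b (b : R -> R) (x : R) : (forall x, `|b x| <= 1) -> 1 <= `|x| ->
  `|b x * p x| <= K1 / `|x|.
Proof.
move=> b1 x1; apply: le_trans (decay_x x1).
by rewrite !normrM ler_wpM2r// (le_trans (b1 x)).
Qed.

Let lint_p : lint p. Proof. exact: integrable_normal_pdf. Qed.

Let d_xp (x : R) : is_derive x (1 : R) (fun x => x * p x) (p x - x ^+ 2 / s ^+ 2 * p x).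
Proof.
have := p_derive x => dp.
apply: is_derive_eq; rewrite /GRing.scale/= mulr1; field; exact: s0.
Qed.

Let c_x2p : continuous (fun x : R => x ^+ 2 * p x).
Proof. by move=> x; apply: cvgM; [exact: exprn_continuous|exact: p_continuous]. Qed.

Let c_xp' : continuous (fun x : R => p x - x ^+ 2 / s ^+ 2 * p x).
Proof.
move=> x; apply: cvgB; first exact: p_continuous.
apply: cvgM; last exact: p_continuous.
by apply: cvgM; [exact: exprn_continuous|exact: cvg_cst].
Qed.

Let lint_x2p : lint (fun x : R => x ^+ 2 * p x).
Proof.
have x2p0 (x : R) : 0 <= x ^+ 2 * p x by rewrite mulr_ge0// sqr_ge0.
have mx2p := continuous_measurable_fun c_x2p.
have citv (f : R -> R) n : continuous f -> mu.-integrable (itv_n n) (EFin \o f).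
  by move=> cf; apply: continuous_compact_integrable; [exact: segment_compact|exact: continuous_subspaceT].
apply/integrableP; split; first exact/measurable_EFinP.
under eq_integral => x _ do rewrite /= ger0_norm//.
apply: (@le_lt_trans _ _ (s ^+ 2)%:E); last exact: ltry.
have itvT : \bigcup_n itv_n n = setT.
  apply/seteqP; split => // x _; exists (Num.truncn `|x|).+1 => //.
  by rewrite /itv_n /= in_itv/= -ler_norml ltW// (lt_le_trans (truncnS_gt _))// ler_nat.
rewrite -itvT.
have nd_itv : nondecreasing_seq itv_n.
  move=> m n mn; rewrite subsetEset => x; rewrite /itv_n /= !in_itv/= -!ler_norml.
  by move=> /le_trans; apply; rewrite ler_nat ltnS.
have cv : (\int[mu]_(x in itv_n n) (x ^+ 2 * p x)%:E @[n --> \oo] -->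
    \int[mu]_(x in \bigcup_n itv_n n) (x ^+ 2 * p x)%:E)%E.
  apply: ge0_nondecreasing_set_cvg_integral => //.
  - by move=> n; exact: measurable_itv.
  - by move=> n; apply: measurable_funTS; exact/measurable_EFinP.
  - by move=> n x _; rewrite lee_fin.
rewrite -(cvg_lim _ cv)//; apply: lime_le; first by apply/cvg_ex; eexists; exact: cv.
apply: nearW => n.
have iA := citv _ n c_x2p; have iB := citv _ n p_continuous; have iC := citv _ n c_xp'.
have := FTC_sym n d_xp c_xp'.
have -> : (\int[mu]_(x in itv_n n) (p x - x ^+ 2 / s ^+ 2 * p x)%:E =
  \int[mu]_(x in itv_n n) (p x)%:E - (s ^- 2)%:E * \int[mu]_(x in itv_n n) (x ^+ 2 * p x)%:E)%E.
  rewrite -integralZl//; last exact: measurable_itv.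
  rewrite -integralB_EFin//; first last.
  - by apply: (integrableZl _ _ iA); exact: measurable_itv.
  - exact: measurable_itv.
  by apply: eq_integral => x _ /=; rewrite -EFinD; congr (_%:E); field.
have pn1 : (\int[mu]_(x in itv_n n) (p x)%:E <= 1)%E.
  rewrite -(integral_normal_pdf 0 s); apply: ge0_subset_integral => //.
  - exact: measurable_itv.
  - by move=> x _; rewrite lee_fin.
have Fn0 : 0 <= n.+1%:R * p n.+1%:R - - n.+1%:R * p (- n.+1%:R).
  by rewrite mulNr opprK addr_ge0// mulr_ge0.
have fA : (\int[mu]_(x in itv_n n) (x ^+ 2 * p x)%:E)%E \is a fin_num.
  by apply: integrable_fin_num iA; exact: measurable_itv.
have fB : (\int[mu]_(x in itv_n n) (p x)%:E)%E \is a fin_num.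
  by apply: integrable_fin_num iB; exact: measurable_itv.
move: pn1; rewrite -(fineK fA) -(fineK fB) -EFinM -EFinB !lee_fin.
move: (fine _) (fine _) => a b b1 [E].
have : 0 <= b - s ^- 2 * a by rewrite E.
rewrite subr_ge0 ler_pdivrMl ?exprn_gt0// => /le_trans; apply.
by rewrite ler_piMr// sqr_ge0.
Qed.

Lemma integ_normal_sq : integ nu (fun x => x ^+ 2).
Proof.
apply/integrableP; split; first exact/measurable_EFinP/measurable_funX.
rewrite ge0_integral_normal//; last first.
  by apply: measurableT_comp => //; exact/measurable_EFinP/measurable_funX.
move/integrableP : lint_x2p => [_]; congr (_ < _)%E.
apply: eq_integral => x _ /=; rewrite !ger0_norm ?sqr_ge0//.
by rewrite mulr_ge0// sqr_ge0.
Qed.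

(** Apply [FTC_line] to [x * p x], whose derivative is
    [p x - x^2 / s^2 * p x]. *)
Lemma Ex_normal_sq : Ex nu (fun x => x ^+ 2) = s ^+ 2.
Proof.
have [_ ->] := normal_Ex integ_normal_sq.
have l2 : lint (fun x => s ^- 2 * (x ^+ 2 * p x)) := integrableZl measurableT (s ^- 2) lint_x2p.
have fE (x : R) : p x - x ^+ 2 / s ^+ 2 * p x = p x - s ^- 2 * (x ^+ 2 * p x) by field.
have := FTC_line d_xp c_xp' _ decay_x.
rewrite (eq_Rintegral mu (g := fun x => p x - s ^- 2 * (x ^+ 2 * p x))); last by move=> x _; exact: fE.
have -> : lint (fun x => p x - x ^+ 2 / s ^+ 2 * p x).
  rewrite (_ : (fun _ => _) = (fun x => p x - s ^- 2 * (x ^+ 2 * p x))); last exact/funext.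
  by have := integrableB measurableT lint_p l2.
move=> /(_ isT); rewrite (RintegralB measurableT lint_p l2) (RintegralZl _ measurableT lint_x2p).
rewrite {1}/Rintegral integral_normal_pdf/= => /eqP.
rewrite subr_eq0 eq_sym -(inj_eq (mulfI (_ : s ^+ 2 != 0))) ?expf_neq0//.
by rewrite mulVKf ?expf_neq0// mulr1 => /eqP.
Qed.

Lemma integ_normal_id : integ nu (fun x : R => x).
Proof.
apply: (@integ_le _ _ _ nu _ (fun x => 1 + x ^+ 2)) => [||].
- exact: measurable_id.
- move=> x; rewrite [leRHS]ger0_norm ?addr_ge0 ?sqr_ge0//.
  by rewrite ler_norml; apply/andP; split; have := sqr_ge0 (x + 1); have := sqr_ge0 (x - 1); nra.
- by apply: integD; [exact: integ_cst|exact: integ_normal_sq].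
Qed.

Lemma Ex_normal_id : Ex nu (fun x : R => x) = 0.
Proof.
have [lx ->] := normal_Ex integ_normal_id.
have l2 : lint (fun x => - s ^- 2 * (x * p x)) := integrableZl measurableT (- s ^- 2) lx.
have fE (x : R) : - (x / s ^+ 2) * p x = - s ^- 2 * (x * p x) by field.
have cxp : continuous (fun x : R => - (x / s ^+ 2) * p x).
  move=> x; apply: cvgM; last exact: p_continuous.
  by apply: cvgN; apply: cvgM; [exact: cvg_id|exact: cvg_cst].
have := FTC_line p_derive cxp.
rewrite (_ : (fun x => _) = (fun x => - s ^- 2 * (x * p x))); last exact/funext.
move=> /(_ K1 l2) h.
have {h} : (\int[mu]_(x in setT) (- s ^- 2 * (x * p x)))%R = 0.
  by apply: h => x x1; have := decay_b (b := fun=> 1) (x := x); rewrite mul1r; apply => // y; rewrite normr1.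
rewrite (RintegralZl _ measurableT lx) => /eqP; rewrite mulf_eq0 oppr_eq0 invr_eq0 expf_eq0/= (negbTE s0)/=.
by move/eqP.
Qed.

Section charfun.
Variable th : R.

Let cosu (u x : R) := cos (u * x + th).
Let sinu (u x : R) := sin (u * x + th).

Let c_lin u : continuous (fun x : R => u * x + th).
Proof.
move=> x; apply: cvgD; last exact: cvg_cst.
by apply: cvgM; [exact: cvg_cst|exact: cvg_id].
Qed.

Let c_cosu u : continuous (cosu u).
Proof. by move=> x; apply: (continuous_comp (f := fun x : R => u * x + th)); [exact: c_lin|exact: continuous_cos]. Qed.

Let c_sinu u : continuous (sinu u).
Proof. by move=> x; apply: (continuous_comp (f := fun x : R => u * x + th)); [exact: c_lin|exact: continuous_sin]. Qed.

Let i_cosu u : integ nu (cosu u).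
Proof.
apply: bddmeas_integ; split; first by apply: continuous_measurable_fun => x; exact: c_cosu.
by exists 1 => x; exact: cos_max.
Qed.

Let i_xsinu u : integ nu (fun x => x * sinu u x).
Proof.
apply: integ_le integ_normal_id.
  by apply: measurable_funM; [exact: measurable_id|apply: continuous_measurable_fun => x; exact: c_sinu].
by move=> x; rewrite normrM ler_piMr// sin_max.
Qed.

(** Stein's identity for the sine, from the derivative of [sin (u x + th) p x]. *)
Let stein u : Ex nu (fun x => x * sinu u x) = s ^+ 2 * u * Ex nu (cosu u).
Proof.
have [l1 ->] := normal_Ex (i_xsinu u); have [l2 ->] := normal_Ex (i_cosu u).
pose f (x : R) := u * cosu u x * p x - sinu u x * (x / s ^+ 2 * p x).
have dF (x : R) : is_derive x (1 : R) (fun x : R => sinu u x * p x) (f x).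
  have dp := p_derive x.
  apply: is_derive_eq; rewrite /f /cosu /sinu /GRing.scale/=; ring.
have cf : continuous f.
  move=> x; apply: cvgB.
    apply: cvgM; last exact: p_continuous.
    by apply: cvgM; [exact: cvg_cst|exact: c_cosu].
  apply: cvgM; first exact: c_sinu.
  apply: cvgM; last exact: p_continuous.
  by apply: cvgM; [exact: cvg_id|exact: cvg_cst].
have fE x : f x = u * (cosu u x * p x) - s ^- 2 * (x * sinu u x * p x).
  by rewrite /f; field.
have l1' : lint (fun x => s ^- 2 * (x * sinu u x * p x)) := integrableZl measurableT _ l1.
have l2' : lint (fun x => u * (cosu u x * p x)) := integrableZl measurableT _ l2.
have lf : lint f.
  rewrite (_ : f = fun x => u * (cosu u x * p x) - s ^- 2 * (x * sinu u x * p x)); last exact/funext.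
  by have := integrableB measurableT l2' l1'.
have := FTC_line dF cf lf (fun x => decay_b (fun y => sin_max (u * y + th))).
rewrite (eq_Rintegral mu (g := fun x => u * (cosu u x * p x) - s ^- 2 * (x * sinu u x * p x))); last first.
  by move=> x _; exact: fE.
rewrite (RintegralB measurableT l2' l1') (RintegralZl _ measurableT l1) (RintegralZl _ measurableT l2) => /eqP; rewrite subr_eq0 => /eqP E.
by rewrite -mulrA E mulVKf// expf_neq0.
Qed.

Let C u := Ex nu (cosu u).

(** The remainder is quadratic with a constant given by the second moment, so
    [C] is differentiable without interchanging limits and integrals. *)
Let C_quad u h : `|C (u + h) - C u + h * (s ^+ 2 * u * C u)| <= h ^+ 2 * (3 * s ^+ 2).
Proof.
rewrite -stein -ExZ// /C -ExB// -ExD; [|exact: integB|exact: integZ].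
rewrite mulrA -Ex_normal_sq -ExZ; last exact: integ_normal_sq.
apply: Ex_norm_le.
- by apply: integD; [exact: integB|exact: integZ].
- by apply: integZ; exact: integ_normal_sq.
move=> x; rewrite /cosu /sinu; set y := u * x + th.
have -> : (u + h) * x + th = y + h * x by rewrite /y; ring.
rewrite cosD; set k := h * x.
have -> : cos y * cos k - sin y * sin k - cos y + h * (x * sin y) =
   - (cos y * (1 - cos k)) - sin y * (sin k - k) by rewrite /k; ring.
have -> : h ^+ 2 * 3 * x ^+ 2 = k ^+ 2 + 2 * k ^+ 2 by rewrite /k; ring.
rewrite (le_trans (ler_normB _ _))// normrN !normrM lerD//.
  have /andP[k0 k1] := cos_bounds k.
  rewrite (ger0_norm k0) (le_trans (ler_piMl k0 (cos_max y)))// (le_trans k1)//.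
  by have := sqr_ge0 k; lra.
rewrite (le_trans (ler_piMl _ (sin_max y)))//.
rewrite -(@real_normK _ k) ?num_real//; have k0 := normr_ge0 k.
have [k1|k1] := leP `|k| 1.
  rewrite (le_trans (sin_id_bound k))//; set z := `|k| in k0 k1 *.
  rewrite exprS ler_pdivrMr// -mulrA; have : 0 <= z ^+ 2 by exact: sqr_ge0.
  by set w := z ^+ 2 => w0; nra.
rewrite (le_trans (ler_normB _ _))//; have := sin_le_norm k.
by set z := `|k| in k0 k1 *; nra.
Qed.

(** By [stein] and [C_quad], [C] solves [C' u = - s^2 u C u], so
    [C u * exp (s^2 u^2 / 2)] is constant. *)
Lemma normal_charfun u :
  Ex nu (fun x => cos (u * x + th)) = expR (- (u ^+ 2 * s ^+ 2 / 2)) * cos th.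
Proof.
have dC (v : R) : is_derive v (1 : R) C (- (s ^+ 2 * v * C v)).
  apply: is_derive_quadratic (3 * s ^+ 2) _ => h.
  by rewrite mulrN opprK (mulrC (_ * _) (h ^+ 2)) C_quad.
pose G (v : R) := C v * expR (s ^+ 2 / 2 * v ^+ 2).
have dG (v : R) : is_derive v (1 : R) G 0.
  have dCv := dC v.
  apply: is_derive_eq; rewrite /GRing.scale/=.
  by move: (C v) (expR _) => a b; field.
have := is_derive_0_is_cst u 0 dG.
rewrite /G expr0n mulr0 expR0 mulr1 => E.
have -> : Ex nu (fun x => cos (u * x + th)) = C u by [].
rewrite expRN mulrC; apply: (canRL (mulfK _)); first by rewrite gt_eqF// expR_gt0.
have <- : C 0 = cos th.
  rewrite /C (_ : cosu 0 = fun=> cos th) ?Ex_cst//.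
  by apply/funext => x; rewrite /cosu mul0r add0r.
by rewrite -E; congr (_ * expR _); field.
Qed.

End charfun.

End normal_law.

(** * Weak convergence from characteristic functions *)
Section bounded_convergence.
Context {R : realType} {disp : measure_display} {T : measurableType disp}
  (P : probability T R).

Lemma Ex_bounded_cvg (h : nat -> T -> R) (f : T -> R) (M : R) :
  (forall n, measurable_fun setT (h n)) -> (forall n w, `|h n w| <= M) ->
  (forall w, h n w @[n --> \oo] --> f w) ->
  bddmeas f /\ Ex P (h n) @[n --> \oo] --> Ex P f.
Proof.
move=> mh hM hf.
have mf : measurable_fun setT f by apply: (measurable_fun_cvg mh) => w _; exact: hf.
have fM w : `|f w| <= M.
  rewrite -(cvg_lim (@Rhausdorff R) (cvg_norm (hf w))).
  apply: limr_le; first by apply/cvg_ex; eexists; exact: cvg_norm (hf w).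
  exact: nearW.
have bf : bddmeas f by split => //; exists M.
split=> //.
have bh n : bddmeas (h n) by split; [exact: mh|exists M].
have [|||||_ _ c] := @dominated_convergence _ T R P setT measurableT
    (fun n => EFin \o h n) (EFin \o f) (cst M%:E).
- by move=> n; exact/measurable_EFinP.
- exact/measurable_EFinP.
- by apply: aeW => w _; apply: cvg_EFin; [exact: nearW|exact: hf].
- exact: integ_cst.
- by apply: aeW => w n _; rewrite /= lee_fin.
rewrite /Ex /Rintegral; apply: fine_cvg; rewrite fineK; first exact: c.
exact: integrable_fin_num (bddmeas_integ P bf).
Qed.

Lemma measurable_gt_set (Y : T -> R) (a : R) : measurable_fun setT Y ->
  measurable [set w | a < `|Y w|].
Proof.
move=> mY; rewrite (_ : mkset _ = (fun w => `|Y w|) @^-1` [set` `]a, +oo[]).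
  rewrite -[X in measurable X]setTI.
  have mn : measurable_fun setT (fun w => `|Y w|) by exact: measurableT_comp.
  exact: mn.
by apply/seteqP; split => x /=; rewrite in_itv/= andbT.
Qed.

Lemma tail_small (Y : T -> R) (e : R) : measurable_fun setT Y -> 0 < e ->
  exists L : nat, Ex P (\1_[set w | L%:R < `|Y w|]) <= e.
Proof.
move=> mY e0; pose h n : T -> R := \1_[set w | n%:R < `|Y w|].
have [|||_ c] := @Ex_bounded_cvg h (fun=> 0) 1.
- by move=> n; apply: (bddmeas_indic _).1; exact: measurable_gt_set.
- by move=> n w; rewrite /h indicE; case: (_ \in _); rewrite ?normr1 ?normr0.
- move=> w; apply: cvg_near_cst; exists (Num.truncn `|Y w|).+1 => // n /= Yn.
  rewrite /h indicE memNset//=; apply/negP; rewrite -leNgt.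
  by rewrite ltW// (lt_le_trans (truncnS_gt _))// ler_nat.
rewrite Ex_cst in c; move/cvgrPdist_le : c => /(_ e e0)[N _ hN].
exists N; have := hN N (leqnn N); rewrite sub0r normrN.
by apply: le_trans; exact: ler_norm.
Qed.

End bounded_convergence.

Section weak_comparison.
Context {R : realType} {k : nat}.
Local Notation V := 'rV[R]_k.

Definition measurable_row {disp : measure_display} {T : measurableType disp}
  (X : T -> V) := forall j, measurable_fun setT (fun w => X w ord0 j).

Lemma measurable_rowdot {disp : measure_display} {T : measurableType disp}
  (X : T -> V) a : measurable_row X ->
  measurable_fun setT (fun w => rowdot a (X w)).
Proof.
move=> mX; apply: measurable_sum => j; apply: measurable_funM => //.
Qed.

Lemma bddmeas_trigpoly {disp : measure_display} {T : measurableType disp}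
  (X : T -> V) p : measurable_row X -> trigpoly p -> bddmeas (fun w => p (X w)).
Proof.
move=> mX; elim=> [a th|p1 p2 _ b1 _ b2|c p1 _ b1].
- apply: bddmeas_cos; apply: measurable_fun_add_cst; exact: measurable_rowdot.
- exact: bddmeasD.
- exact: bddmeasZ.
Qed.

Lemma bddmeas_continuous_row {disp : measure_display} {T : measurableType disp}
  (X : T -> V) (g : V -> R) (M : R) : measurable_row X -> continuous g ->
  (forall x, `|g x| <= M) -> bddmeas (fun w => g (X w)).
Proof.
move=> mX cg gM.
have n0 (n : nat) : 0 < n.+1%:R^-1 :> R by rewrite invr_gt0.
have /choice[p hp] : forall n : nat, exists p : V -> R, [/\ trigpoly p,
    forall x : V, (forall j, `|x ord0 j| <= n%:R) -> `|g x - p x| <= n.+1%:R^-1 &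
    forall x, `|p x| <= M + n.+1%:R^-1].
  by move=> n; exact: trig_approx.
split; last by exists M.
apply: (@measurable_fun_cvg _ _ _ _ (fun n w => p n (X w))).
  by move=> n; apply: (bddmeas_trigpoly mX _).1; have [] := hp n.
move=> w _; apply/cvgrPdist_le => e e0.
pose L := \sum_j `|X w ord0 j|.
have [N _ hN] := @near_infty_natSinv_lt R (PosNum e0).
exists (maxn N (Num.truncn L).+1) => // n /=; rewrite geq_max => /andP[Nn Ln].
have [_ h _] := hp n; apply: le_trans (h _ _) _; last exact/ltW/(hN n Nn).
move=> j; apply: (@le_trans _ _ L).
  by rewrite /L (bigD1 j)//= lerDl sumr_ge0.
by rewrite ltW// (lt_le_trans (truncnS_gt _))// ler_nat.
Qed.

(** One trigonometric polynomial serves all row vectors [X] on all probability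
    spaces: the error depends on [X] through the tails of its coordinates. *)
Lemma weak_comparison (g : V -> R) (M L e : R) : continuous g ->
  (forall x, `|g x| <= M) -> 0 < e ->
  exists2 p, trigpoly p & forall (disp : measure_display)
    (T : measurableType disp) (P : probability T R) (X : T -> V),
    measurable_row X ->
    `|Ex P (fun w => g (X w)) - Ex P (fun w => p (X w))| <=
      e + (2 * M + e) * \sum_j Ex P (\1_[set w | L < `|X w ord0 j|]).
Proof.
move=> cg gM e0; have [p [tp pK pM]] := trig_approx L cg gM e0.
exists p => // disp T P X mX.
have bg := bddmeas_continuous_row mX cg gM.
have bp := bddmeas_trigpoly mX tp.
have ii j : integ P (\1_[set w | L < `|X w ord0 j|]).
  by apply: bddmeas_integ; apply: bddmeas_indic; exact: measurable_gt_set.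
have is_ := integ_sum (index_enum 'I_k) ii.
rewrite -ExB; [|exact: bddmeas_integ|exact: bddmeas_integ].
rewrite -Ex_sum// -ExZ// -[X in X + _](Ex_cst P) -ExD; [|exact: integ_cst|exact: integZ].
apply: Ex_norm_le; [exact/bddmeas_integ/bddmeasB|by apply: integD; [exact: integ_cst|exact: integZ]|].
move=> w.
have M0 : 0 <= M := le_trans (normr_ge0 _) (gM 0).
have c0 : 0 <= 2 * M + e by rewrite addr_ge0 ?mulr_ge0// ltW.
have s0 : 0 <= \sum_j (\1_[set w | L < `|X w ord0 j|] w : R).
  by apply: sumr_ge0 => j _; rewrite indicE.
have [/pK h|/existsNP[j /negP]] := pselect (forall j, `|X w ord0 j| <= L).
  by rewrite (le_trans h)// lerDl mulr_ge0.
rewrite -ltNge => Lj.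
have s1 : 1 <= \sum_j (\1_[set w | L < `|X w ord0 j|] w : R).
  rewrite (bigD1 j)//= indicE mem_set//= lerDl.
  by apply: sumr_ge0 => i _; rewrite indicE.
apply: (@le_trans _ _ (2 * M + e)).
  by rewrite (le_trans (ler_normB _ _))//; have := gM (X w); have := pM (X w); lra.
rewrite -[X in X <= _]mulr1.
by rewrite (le_trans (ler_wpM2l c0 s1))// lerDr ltW.
Qed.

(** Levy's continuity theorem without a limit law: the expectations converge as
    a Cauchy sequence, because those of the approximating trigonometric
    polynomial do and the tails are uniformly small. *)
Lemma levy_cvg {disp : measure_display} {T : measurableType disp}
  (P : probability T R) (X : nat -> T -> V) (g : V -> R) (M : R) :
  (forall n, measurable_row (X n)) ->
  (forall a th, cvgn (fun n => Ex P (fun w => cos (rowdot a (X n w) + th)))) ->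
  (forall j e, 0 < e -> exists L : R,
     \forall n \near \oo, Ex P (\1_[set w | L < `|X n w ord0 j|]) <= e) ->
  continuous g -> (forall x, `|g x| <= M) ->
  cvgn (fun n => Ex P (fun w => g (X n w))).
Proof.
move=> mX cX tX cg gM; apply/cauchy_cvgP; apply: cauchy_exP => e e0.
have M0 : 0 <= M := le_trans (normr_ge0 _) (gM 0).
have e40 : 0 < e / 4 by rewrite divr_gt0.
pose c := 2 * M + e / 4.
have c0 : 0 < c by rewrite ltr_wpDl// mulr_ge0.
pose eta := e / 4 / (c * k.+1%:R).
have eta0 : 0 < eta by rewrite !divr_gt0// mulr_gt0.
have /choice[Lj hLj] : forall j, exists L : R,
     \forall n \near \oo, Ex P (\1_[set w | L < `|X n w ord0 j|]) <= eta.
  by move=> j; exact: tX.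
pose L := \sum_j `|Lj j|.
have LL j : Lj j <= L.
  rewrite (le_trans (ler_norm _))// /L (bigD1 j)//= lerDl.
  by apply: sumr_ge0.
have [p tp hp] := weak_comparison L cg gM e40.
have cp : cvgn (fun n => Ex P (fun w => p (X n w))).
  elim: tp => [a th|p1 p2 t1 c1 t2 c2|b p1 t1 c1]; first exact: cX.
  - under eq_fun do rewrite (ExD (bddmeas_integ P (bddmeas_trigpoly (mX _) t1))
      (bddmeas_integ P (bddmeas_trigpoly (mX _) t2))).
    exact: is_cvgD.
  - under eq_fun do rewrite (ExZ _ (bddmeas_integ P (bddmeas_trigpoly (mX _) t1))).
    exact: is_cvgMr.
exists (limn (fun n => Ex P (fun w => p (X n w)))).
have tails : \forall n \near \oo, forall j, Ex P (\1_[set w | L < `|X n w ord0 j|]) <= eta.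
  apply: filter_forall => j; apply: filterS (hLj j) => n; apply: le_trans.
  have mI a := bddmeas_integ P (bddmeas_indic (measurable_gt_set a (mX n j))).
  apply: Ex_le => // w; rewrite !indicE ler_nat.
  case: (boolP (w \in [set w | L < _])) => //; rewrite inE/= => Lw.
  by rewrite mem_set//=; exact: le_lt_trans Lw.
move/cvgrPdist_lt : cp => /(_ _ e40) cp.
apply: filterS2 cp tails => n cp tn /=; rewrite /ball/=.
rewrite -(subrK (Ex P (fun w => p (X n w))) (limn _)) -addrA.
rewrite (le_lt_trans (ler_normD _ _))//.
rewrite (_ : e = e / 4 + e * 3 / 4); last by field.
rewrite ltrD// distrC (le_lt_trans (hp _ _ _ _ (mX n)))//.
have : \sum_j Ex P (\1_[set w | L < `|X n w ord0 j|]) <= k.+1%:R * eta.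
  apply: (@le_trans _ _ (\sum_(j < k) eta)); first exact: ler_sum.
  by rewrite sumr_const card_ord -(mulr_natl eta) ler_wpM2r ?(ltW eta0)// ler_nat.
rewrite -/c => h; have : c * (k.+1%:R * eta) = e / 4.
  by rewrite /eta; field; rewrite addrC natr1 !gt_eqF.
have : c * (\sum_j Ex P (\1_[set w | L < `|X n w ord0 j|])) <= c * (k.+1%:R * eta).
  by rewrite ler_wpM2l// ltW.
by move: (_ * \sum_(_ < _) _) => z h1 h2; lra.
Qed.

End weak_comparison.

(** * Uniqueness of the characteristic function on the line *)
Section law_uniqueness.
Context {R : realType} {disp : measure_display} {T : measurableType disp}
  (P : probability T R) (mu : probability (measurableTypeR R) R).
Variable Y : T -> R.
Hypothesis mY : measurable_fun setT Y.
Hypothesis charfun_eq : forall u th,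
  Ex P (fun w => cos (u * Y w + th)) = Ex mu (fun x : R => cos (u * x + th)).

Let mY' : measurable_fun setT (Y : T -> measurableTypeR R).
Proof. exact: mY. Qed.
Let mY_mixin := isMeasurableFun.Build _ _ _ _ _ mY'.
Let Y_pack : {mfun T >-> measurableTypeR R} := HB.pack Y mY_mixin.

Let Ex_eq (g : R -> R) (M : R) : continuous g -> (forall x, `|g x| <= M) ->
  Ex P (fun w => g (Y w)) = Ex mu g.
Proof.
move=> cg gM; apply/eqP; rewrite -subr_eq0 -normr_le0.
apply/ler_addgt0Pr => e e0; rewrite add0r.
have M0 : 0 <= M := le_trans (normr_ge0 _) (gM 0).
have e40 : 0 < e / 4 by rewrite divr_gt0.
pose c := 2 * M + e / 4.
have c0 : 0 < c by rewrite ltr_wpDl// mulr_ge0.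
have eta0 : 0 < e / 4 / c by rewrite divr_gt0.
have [L1 hL1] := tail_small P mY eta0.
have [L2 hL2] := @tail_small _ _ _ mu id _ (@measurable_id _ _ _) eta0.
pose L := maxn L1 L2.
pose gv (x : 'rV[R]_1) := g (x ord0 ord0).
have cgv : continuous gv.
  move=> x; apply: (continuous_comp (f := fun x : 'rV[R]_1 => x ord0 ord0)); last exact: cg.
  exact: coord_continuous.
have [p tp hp] := weak_comparison L%:R cgv (fun x => gM _) e40.
pose X1 w : 'rV[R]_1 := \row_j Y w.
pose X2 (x : measurableTypeR R) : 'rV[R]_1 := \row_j x.
have m1 : measurable_row X1 by move=> j; under eq_fun do rewrite mxE.
have m2 : measurable_row X2 by move=> j; under eq_fun do rewrite mxE; exact: measurable_id.
have pE : Ex P (fun w => p (X1 w)) = Ex mu (fun x => p (X2 x)).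
  elim: tp => [a th|p1 p2 t1 c1 t2 c2|b p1 t1 c1].
  - have := charfun_eq (a ord0 ord0) th.
    congr (_ = _); congr (Ex _ _); apply/funext => w;
      by rewrite /rowdot big_ord1 mxE.
  - rewrite !ExD ?c1 ?c2//; apply: bddmeas_integ; exact: bddmeas_trigpoly.
  - rewrite !ExZ ?c1//; apply: bddmeas_integ; exact: bddmeas_trigpoly.
have tail (d' : measure_display) (T' : measurableType d') (P' : probability T' R)
    (Z : T' -> R) (L' : nat) : measurable_fun setT Z -> (L' <= L)%N ->
    Ex P' (\1_[set w | L'%:R < `|Z w|]) <= e / 4 / c ->
    Ex P' (\1_[set w | L%:R < `|Z w|]) <= e / 4 / c.
  move=> mZ L'L; apply: le_trans.
  have mI a := bddmeas_integ P' (bddmeas_indic (measurable_gt_set a mZ)).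
  apply: Ex_le => // w; rewrite !indicE ler_nat.
  case: (boolP (w \in [set w | L%:R < _])) => //; rewrite inE/= => Lw.
  by rewrite mem_set//=; apply: le_lt_trans Lw; rewrite ler_nat.
have h1 := hp _ _ P X1 m1; have h2 := hp _ _ mu X2 m2.
have t1 := tail _ _ P Y L1 mY (leq_maxl _ _) hL1.
have t2 := tail _ _ mu id L2 (@measurable_id _ _ _) (leq_maxr _ _) hL2.
rewrite big_ord1 -/c in h1; rewrite big_ord1 -/c in h2.
have E1 : [set w | L%:R < `|X1 w ord0 ord0|] = [set w | L%:R < `|Y w|].
  by apply/seteqP; split => w /=; rewrite mxE.
have E2 : [set w | L%:R < `|X2 w ord0 ord0|] = [set w | L%:R < `|w|].
  by apply/seteqP; split => w /=; rewrite mxE.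
rewrite E1 in h1; rewrite E2 in h2.
rewrite ler_pdivlMr// mulrC in t1; rewrite ler_pdivlMr// mulrC in t2.
have g1 : Ex P (fun w => g (Y w)) = Ex P (fun w => gv (X1 w)).
  by congr (Ex P _); apply/funext => w; rewrite /gv mxE.
have g2 : Ex mu g = Ex mu (fun x => gv (X2 x)).
  by congr (Ex mu _); apply/funext => x; rewrite /gv mxE.
rewrite g1 g2 -(subrK (Ex P (fun w => p (X1 w))) (Ex P (fun w => gv (X1 w)))) -addrA.
rewrite (le_trans (ler_normD _ _))// (_ : e = e / 2 + e / 2); last by field.
rewrite lerD//.
  by rewrite (le_trans h1)//; move: t1; move: (c * _) => z t1; lra.
by rewrite pE distrC (le_trans h2)//; move: t2; move: (c * _) => z t2; lra.
Qed.

(** Continuous functions that decrease to the indicator of [[a, +oo[]. *)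
Let ramp (a : R) (n : nat) (x : R) : R := Num.max 0 (Num.min 1 (1 + n%:R * (x - a))).

Let ramp01 a n x : 0 <= ramp a n x <= 1.
Proof. by rewrite /ramp le_max lexx/= ge_max ler01/= ge_min lexx. Qed.

Let ramp_continuous a n : continuous (ramp a n).
Proof.
move=> x; apply: (@continuous_max _ _ (cst 0) (cst 1 \min (fun x : R => 1 + n%:R * (x - a)))).
  exact: cst_continuous.
apply: continuous_min; first exact: cst_continuous.
apply: cvgD; first exact: cvg_cst.
apply: cvgM; first exact: cvg_cst.
by apply: cvgB; [exact: cvg_id|exact: cvg_cst].
Qed.

Let ramp_cvg a x : ramp a n x @[n --> \oo] --> (\1_(`[a, +oo[%classic) x : R).
Proof.
apply: cvg_near_cst; have [ax|xa] := leP a x.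
  apply: nearW => n; rewrite indicE mem_set/=; last by rewrite in_itv/= ax.
  have : 1 <= 1 + n%:R * (x - a) by rewrite lerDl mulr_ge0// subr_ge0.
  by move=> /min_idPl h; rewrite /ramp h; apply/max_idPr.
have xa0 : 0 < a - x by rewrite subr_gt0.
exists (Num.truncn (a - x)^-1).+1 => // n /= hn.
rewrite indicE memNset/=; last by rewrite in_itv/= andbT; apply/negP; rewrite -ltNge.
have : 1 + n%:R * (x - a) <= 0.
  have : (a - x)^-1 <= n%:R.
    by rewrite ltW// (lt_le_trans (truncnS_gt _))// ler_nat.
  by rewrite -(ler_pM2r xa0) mulVf ?gt_eqF//; lra.
move=> h; rewrite /ramp; apply/max_idPl; rewrite ge_min h orbT//.
Qed.

Lemma law_unique (B : set (measurableTypeR R)) : measurable B ->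
  P (Y @^-1` B) = mu B.
Proof.
move=> mB; rewrite -[LHS]/(distribution P Y_pack B).
pose G := [set A : set R | exists x, A = `[x, +oo[%classic].
apply: (@measure_unique _ R (measurableTypeR R) G (fun n : nat => `[- n%:R, +oo[%classic) _ _ _ _ (distribution P Y_pack) mu) => //.
- exact: RGenCInfty.measurableE.
- move=> _ _ [x ->] [y ->]; exists (Num.max x y); apply/seteqP; split => z /=.
    by rewrite !in_itv/= !andbT => -[xz yz]; rewrite ge_max xz.
  by rewrite !in_itv/= !andbT ge_max => /andP[].
- by move=> n; exists (- n%:R).
- apply/seteqP; split => // x _; exists (Num.truncn `|x|).+1 => //=.
  rewrite in_itv/= andbT lerNl (le_trans (ler_norm _))// normrN.
  by rewrite ltW// truncnS_gt.
- move=> _ [a ->].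
  have [|||b1 c1] := @Ex_bounded_cvg _ _ _ P (fun n w => ramp a n (Y w)) (fun w => \1_(`[a, +oo[%classic) (Y w)) 1.
  + move=> n; apply: measurableT_comp mY.
    by apply: continuous_measurable_fun => x; exact: ramp_continuous.
  + by move=> n w; have /andP[? ?] := ramp01 a n (Y w); rewrite ger0_norm.
  + by move=> w; exact: ramp_cvg.
  have [|||b2 c2] := @Ex_bounded_cvg _ _ _ mu (ramp a) (\1_(`[a, +oo[%classic)) 1.
  + move=> n; by apply: continuous_measurable_fun => x; exact: ramp_continuous.
  + by move=> n w; have /andP[? ?] := ramp01 a n w; rewrite ger0_norm.
  + by move=> w; exact: ramp_cvg.
  have EE n : Ex P (fun w => ramp a n (Y w)) = Ex mu (ramp a n).
    apply: (@Ex_eq _ 1) => [|x]; first exact: ramp_continuous.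
    by have /andP[? ?] := ramp01 a n x; rewrite ger0_norm.
  have : Ex P (fun w => \1_(`[a, +oo[%classic) (Y w)) = Ex mu (\1_(`[a, +oo[%classic)).
    have c1' : Ex P (fun w => ramp a n (Y w)) @[n --> \oo] --> Ex mu (\1_(`[a, +oo[%classic)).
      by under eq_fun do rewrite EE; exact: c2.
    exact: (cvg_unique (@Rhausdorff R) c1 c1').
  rewrite [in RHS]Ex_indic; last exact: measurable_itv.
  rewrite (_ : (fun w => _) = \1_(Y @^-1` `[a, +oo[%classic)); last first.
    by apply/funext => w; rewrite !indicE; congr ((nat_of_bool _)%:R); apply/idP/idP; rewrite !inE.
  rewrite Ex_indic; last by rewrite -[X in measurable X]setTI; exact: mY.
  move=> E.
  have f1 : distribution P Y_pack `[a, +oo[%classic \is a fin_num.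
    by apply: fin_num_measure; exact: measurable_itv.
  have f2 : mu `[a, +oo[%classic \is a fin_num.
    by apply: fin_num_measure; exact: measurable_itv.
  by apply: etrans (esym (fineK f1)) (etrans _ (fineK f2)); congr EFin; exact: E.
- by move=> n; rewrite (le_lt_trans (probability_le1 _ _)) ?ltry//; exact: measurable_itv.
Qed.

End law_uniqueness.

(** * Triangular arrays: the Lindeberg calculus of one block *)
Section negligible_arrays.
Context {R : realType} {disp : measure_display} {T : measurableType disp}
  (P : probability T R).
Variable m : nat -> nat.
Implicit Types h g : nat -> T -> R.

(** [m n] is the number of blocks and [h n] belongs to a single block, so this
    says that the sum over all blocks tends to 0 in mean. *)
Definition negl h := (\forall n \near \oo, integ P (h n)) /\
  (m n)%:R * Ex P (fun w => `|h n w|) @[n --> \oo] --> (0 : R).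

Lemma negl_le h g : (\forall n \near \oo, measurable_fun setT (h n)) ->
  (\forall n \near \oo, forall w, `|h n w| <= g n w) -> negl g -> negl h.
Proof.
move=> mh hg [ig cg]; split.
  apply: filterS3 mh hg ig => n mh hg ig; apply: integ_le ig => // w.
  by rewrite (le_trans (hg w))// ler_norm.
apply: (@squeeze_cvgr _ _ _ _ (fun=> 0)) cg; last exact: cvg_cst.
apply: filterS3 mh hg ig => n mh hg ig; rewrite mulr_ge0 ?Ex_ge0//=.
rewrite ler_wpM2l// Ex_le//; last first.
- by move=> w; rewrite (le_trans (hg w))// ler_norm.
- exact: integ_norm.
apply: integ_norm; apply: integ_le ig => // w.
by rewrite (le_trans (hg w))// ler_norm.
Qed.

Lemma neglD h g : negl h -> negl g -> negl (fun n w => h n w + g n w).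
Proof.
move=> [ih ch] [ig cg]; split; first by apply: filterS2 ih ig => n; exact: integD.
have c : (m n)%:R * Ex P (fun w => `|h n w|) + (m n)%:R * Ex P (fun w => `|g n w|)
    @[n --> \oo] --> (0 : R) by rewrite -(addr0 0); exact: cvgD.
apply: (@squeeze_cvgr _ _ _ _ (fun=> 0)) c; last exact: cvg_cst.
apply: filterS2 ih ig => n ih ig; rewrite mulr_ge0 ?Ex_ge0//=.
have nh := integ_norm ih; have ng := integ_norm ig.
rewrite -mulrDr -ExD// ler_wpM2l// Ex_le//.
- exact/integ_norm/integD.
- exact: integD.
- by move=> w; exact: ler_normD.
Qed.

Lemma neglZ (a : R) h : negl h -> negl (fun n w => a * h n w).
Proof.
move=> [ih ch]; split; first by apply: filterS ih => n; exact: integZ.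
have : `|a| * ((m n)%:R * Ex P (fun w => `|h n w|)) @[n --> \oo] --> `|a| * 0.
  by apply: cvgM; [exact: cvg_cst|exact: ch].
rewrite mulr0; apply: cvg_trans; apply: near_eq_cvg.
apply: filterS ih => n ih; rewrite mulrCA -(ExZ _ (integ_norm ih)).
by congr (_ * Ex P _); apply/funext => w; rewrite normrM.
Qed.

Lemma negl_mean h : negl h -> (m n)%:R * Ex P (h n) @[n --> \oo] --> (0 : R).
Proof.
move=> [ih ch]; apply/cvgr0Pnorm_le => e e0.
move/cvgr0Pnorm_le : ch => /(_ e e0); apply: filterS2 ih => n ih.
apply: le_trans; rewrite !normrM ler_wpM2l// (le_trans (Ex_norm ih))//.
exact: ler_norm.
Qed.

Definition bounded_sq h := (\forall n \near \oo, measurable_fun setT (h n) /\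
    integ P (fun w => h n w ^+ 2)) /\
  exists C, \forall n \near \oo, (m n)%:R * Ex P (fun w => h n w ^+ 2) <= C.

(** As [m E g^2] stays bounded, the coefficient [e] of [g^2] can be made
    harmless; Lindeberg-type splittings have this form. *)
Lemma negl_eps h g : (\forall n \near \oo, measurable_fun setT (h n)) ->
  bounded_sq g ->
  (forall e, 0 < e -> exists2 g', negl g' &
     \forall n \near \oo, forall w, `|h n w| <= e * g n w ^+ 2 + g' n w) ->
  negl h.
Proof.
move=> mh [ig [C gC]] H.
have ih : \forall n \near \oo, integ P (h n).
  have [g' [ig' _] hg'] := H 1 ltr01.
  apply: filterS2 (filterI mh ig) (filterI hg' ig') => n [mhn [_ ign]] [hgn ig'n].
  apply: integ_le (integD (integZ 1 ign) ig'n) => // w.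
  by rewrite (le_trans (hgn w))// ler_norm.
split => //; apply/cvgr0Pnorm_le => e e0.
pose e' := e / 2 / (`|C| + 1).
have C0 : 0 < `|C| + 1 by rewrite ltr_wpDl.
have e'0 : 0 < e' by rewrite !divr_gt0.
have e20 : 0 < e / 2 by rewrite divr_gt0.
have [g' [ig' cg'] hg'] := H _ e'0.
move/cvgr0Pnorm_le : cg' => /(_ _ e20) cg'.
near=> n.
have ihn : integ P (h n) by near: n.
have ign : integ P (fun w => g n w ^+ 2) by near: n; apply: filterS ig => n [].
have ig'n : integ P (g' n) by near: n.
have hgn : forall w, `|h n w| <= e' * g n w ^+ 2 + g' n w by near: n.
have gCn : (m n)%:R * Ex P (fun w => g n w ^+ 2) <= C by near: n.
have cg'n : `|(m n)%:R * Ex P (fun w => `|g' n w|)| <= e / 2 by near: n.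
rewrite ger0_norm ?mulr_ge0 ?Ex_ge0//.
apply: (@le_trans _ _ ((m n)%:R * (e' * Ex P (fun w => g n w ^+ 2) + Ex P (fun w => `|g' n w|)))).
  rewrite ler_wpM2l// -ExZ// -ExD; [|exact: integZ|exact: integ_norm].
  apply: Ex_le; [exact: integ_norm| |].
    by apply: integD; [exact: integZ|exact: integ_norm].
  by move=> w; rewrite (le_trans (hgn w))// lerD2l ler_norm.
rewrite mulrDr (splitr e) lerD//; last by rewrite (le_trans (ler_norm _)).
rewrite mulrCA (le_trans (ler_wpM2l (ltW e'0) gCn))//.
rewrite /e' mulrAC ler_pdivrMr// ler_wpM2l ?(ltW e20)//.
by rewrite (le_trans (ler_norm _))// lerDl.
Unshelve. all: by end_near. Qed.

Lemma bounded_sqD h g : bounded_sq h -> bounded_sq g ->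
  bounded_sq (fun n w => h n w + g n w).
Proof.
move=> [ih [C hC]] [ig [D gD]].
have le2 (x y : R) : (x + y) ^+ 2 <= 2 * x ^+ 2 + 2 * y ^+ 2.
  by have := sqr_ge0 (x - y); nra.
have i2 : \forall n \near \oo, integ P (fun w => (h n w + g n w) ^+ 2).
  apply: filterS2 ih ig => n [mh ihn] [mg ign].
  apply: integ_le (integD (integZ 2 ihn) (integZ 2 ign)).
    by apply: measurable_funX; exact: measurable_funD.
  by move=> w; rewrite ger0_norm ?sqr_ge0// (le_trans (le2 _ _))// ler_norm.
split.
  by apply: filterS3 ih ig i2 => n [mh _] [mg _] i2; split => //; exact: measurable_funD.
exists (2 * C + 2 * D); apply: filterS3 (filterI ih hC) (filterI ig gD) i2.
move=> n [[_ ihn] hCn] [[_ ign] gDn] i2.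
apply: (@le_trans _ _ ((m n)%:R * (2 * Ex P (fun w => h n w ^+ 2) + 2 * Ex P (fun w => g n w ^+ 2)))).
  rewrite ler_wpM2l// -!ExZ// -ExD; [|exact: integZ|exact: integZ].
  by apply: Ex_le => //; apply: integD; exact: integZ.
by move: hCn gDn; move: (Ex P _) (Ex P _) => x y; lra.
Qed.

Lemma bounded_sqZ a h : bounded_sq h -> bounded_sq (fun n w => a * h n w).
Proof.
move=> [ih [C hC]].
have E n : (fun w => (a * h n w) ^+ 2) = (fun w => a ^+ 2 * h n w ^+ 2).
  by apply/funext => w; rewrite exprMn.
split.
  by apply: filterS ih => n [mh ihn]; rewrite E; split; [exact: measurable_funM|exact: integZ].
exists (a ^+ 2 * C); apply: filterS2 ih hC => n [_ ihn] hCn.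
by rewrite E ExZ// mulrCA ler_wpM2l// sqr_ge0.
Qed.

End negligible_arrays.

Section lindeberg_arrays.
Context {R : realType} {disp : measure_display} {T : measurableType disp}
  (P : probability T R).
Variable m : nat -> nat.
Local Notation negl := (negl P m).
Local Notation bounded_sq := (bounded_sq P m).
Implicit Types (xi de : nat -> T -> R).

(** The truncated second moment controls both the large and the small values of
    a remainder that need not be square integrable. *)
Definition sqmin (x : R) : R := Num.min (x ^+ 2) 1.

Lemma sqmin_ge0 x : 0 <= sqmin x.
Proof. by rewrite /sqmin le_min sqr_ge0 ler01. Qed.

Lemma sqmin_le1 x : sqmin x <= 1. Proof. by rewrite /sqmin ge_min lexx orbT. Qed.

Lemma sqmin_le x : sqmin x <= x ^+ 2. Proof. by rewrite /sqmin ge_min lexx. Qed.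

Lemma sqmin_cases x :
  (sqmin x = x ^+ 2 /\ x ^+ 2 <= 1) \/ (sqmin x = 1 /\ 1 < x ^+ 2).
Proof. by rewrite /sqmin; case: leP => h; [left|right]. Qed.

Lemma sqminD x y : sqmin (x + y) <= 2 * sqmin x + 2 * sqmin y.
Proof.
have x0 := sqmin_ge0 x; have y0 := sqmin_ge0 y; have z1 := sqmin_le1 (x + y).
have [[-> x1]|[-> x1]] := sqmin_cases x; last by lra.
have [[-> y1]|[-> y1]] := sqmin_cases y; last by have := sqr_ge0 x => ?; lra.
by rewrite (le_trans (sqmin_le _))//; have := sqr_ge0 (x - y); nra.
Qed.

Lemma sqminZ a x : sqmin (a * x) <= (a ^+ 2 + 1) * sqmin x.
Proof.
have a0 := sqr_ge0 a; have [[-> x1]|[-> x1]] := sqmin_cases x.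
  by rewrite (le_trans (sqmin_le _))// exprMn mulrDl mul1r lerDl sqr_ge0.
by rewrite (le_trans (sqmin_le1 _))// mulr1 lerDr.
Qed.

Lemma cos_sqmin x : 0 <= 1 - cos x <= 2 * sqmin x.
Proof.
have /andP[h1 h2] := cos_bounds x; rewrite h1/= /sqmin; have h3 := cos_geN1 x.
by have x0 := sqr_ge0 x; case: (leP (x ^+ 2) 1) => x1; lra.
Qed.

Lemma sin_sqmin x : sin x ^+ 2 <= sqmin x.
Proof.
rewrite /sqmin le_min; apply/andP; split.
  have := sin_le_norm x; rewrite -(@ler_sqr _ `|sin x|) ?nnegrE//.
  by rewrite !real_normK ?num_real.
by rewrite sin2cos2 gerBl sqr_ge0.
Qed.

Lemma sin_scale_bound a x : `|sin (a * x) - a * sin x| <= (`|a| + 1) ^+ 3 * sqmin x.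
Proof.
have a0 := normr_ge0 a; have b1 : 1 <= `|a| + 1 by rewrite lerDr.
rewrite /sqmin; have [x1|x1] := leP (x ^+ 2) 1; last first.
  rewrite mulr1 (le_trans (ler_normB _ _))// (@le_trans _ _ (1 + `|a|))//.
    by rewrite lerD ?sin_max// normrM ler_piMr// sin_max.
  by rewrite addrC exprS ler_peMr ?exprn_ege1// ltW// (lt_le_trans ltr01).
have x1' : `|x| <= 1 by rewrite -(@ler_sqr _ `|x| 1) ?nnegrE// real_normK ?num_real// expr1n.
have -> : sin (a * x) - a * sin x = (sin (a * x) - a * x) - a * (sin x - x) by ring.
rewrite (le_trans (ler_normB _ _))// normrM.
apply: (@le_trans _ _ (`|a * x| ^+ 3 / 2 + `|a| * (`|x| ^+ 3 / 2))).
  by rewrite lerD ?sin_id_bound// ler_wpM2l// sin_id_bound.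
rewrite normrM -(@real_normK _ x) ?num_real//.
have y3 : `|x| ^+ 3 <= `|x| ^+ 2 by rewrite exprS ler_piMl// sqr_ge0.
have -> : (`|a| * `|x|) ^+ 3 / 2 + `|a| * (`|x| ^+ 3 / 2) = ((`|a| ^+ 3 + `|a|) / 2) * `|x| ^+ 3.
  by field.
apply: ler_pM => //; rewrite ?mulr_ge0 ?exprn_ge0 ?addr_ge0 ?exprn_ge0//.
by set b := `|a| in a0 *; have := sqr_ge0 b; have := exprn_ge0 3 a0; nra.
Qed.

Lemma sin_add_bound x y : `|sin (x + y) - (sin x + sin y)| <= 2 * sqmin x + 2 * sqmin y.
Proof.
rewrite sinD (_ : _ - _ = - (sin x * (1 - cos y) + sin y * (1 - cos x))); last by ring.
rewrite normrN (le_trans (ler_normD _ _))// addrC !normrM.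
have /andP[x0 xx] := cos_sqmin x; have /andP[y0 yy] := cos_sqmin y.
rewrite (ger0_norm x0) (ger0_norm y0) lerD//.
  by rewrite (le_trans _ xx)// ler_piMl// sin_max.
by rewrite (le_trans _ yy)// ler_piMl// sin_max.
Qed.

Definition large (e : R) (x : R) : R := if e < `|x| then x ^+ 2 else 0.

Lemma large_ge0 e x : 0 <= large e x.
Proof. by rewrite /large; case: ifP => // _; exact: sqr_ge0. Qed.

Lemma measurable_large e (f : T -> R) : measurable_fun setT f ->
  measurable_fun setT (fun w => large e (f w)).
Proof.
move=> mf; apply: measurable_fun_ifT => //.
  by apply: measurable_fun_ltr => //; exact: measurableT_comp.
exact: measurable_funX.
Qed.

Lemma measurable_sqmin (f : T -> R) : measurable_fun setT f ->
  measurable_fun setT (fun w => sqmin (f w)).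
Proof. by move=> mf; apply: measurable_minr => //; exact: measurable_funX. Qed.

Lemma largeD e x y : large e (x + y) <= 4 * large (e / 2) x + 4 * large (e / 2) y.
Proof.
rewrite {1}/large; case: ifPn => [exy|_]; last by rewrite addr_ge0// mulr_ge0// large_ge0.
wlog xy : x y exy / `|y| <= `|x|.
  move=> H; have [/H|/ltW xy] := leP `|y| `|x|; first exact.
  by rewrite addrC [leRHS]addrC; apply: H => //; rewrite addrC.
have n2 : `|x + y| <= 2 * `|x| by rewrite (le_trans (ler_normD _ _))//; lra.
have ex : e / 2 < `|x| by lra.
rewrite [large _ x]/large ex (@le_trans _ _ (4 * x ^+ 2))//.
  rewrite -(@real_normK _ (x + y)) ?num_real// -(@real_normK _ x) ?num_real//.
  by have := normr_ge0 (x + y); nra.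
by rewrite lerDl mulr_ge0// large_ge0.
Qed.

Lemma largeZ e a x : large e (a * x) <= a ^+ 2 * large (e / (`|a| + 1)) x.
Proof.
rewrite /large normrM; have a0 : 0 < `|a| + 1 by rewrite ltr_wpDl.
case: ifPn => [eax|_]; last first.
  by rewrite mulr_ge0 ?sqr_ge0//; case: ifP => // _; exact: sqr_ge0.
rewrite ltr_pdivrMr// ifT ?exprMn// (lt_le_trans eax)// mulrC ler_wpM2l//.
by rewrite lerDl.
Qed.

(** [xi] is the contribution of a full block and [de] the part lost by
    truncating it.  The first three fields are the usual Lindeberg conditions;
    the last two are what survives of [m E de^2 --> 0] and [E de = 0] when [de]
    has truncated moments only.  Stating the mean condition for [sin] rather
    than for a truncation makes it stable under linear combinations. *)
Record lindeberg_pair xi de : Prop := LindebergPair {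
  pair_bounded_sq : bounded_sq xi ;
  pair_lindeberg : forall e, 0 < e -> negl (fun n w => large e (xi n w)) ;
  pair_mean : \forall n \near \oo, Ex P (xi n) = 0 ;
  pair_measurable : \forall n \near \oo, measurable_fun setT (de n) ;
  pair_small : negl (fun n w => sqmin (de n w)) ;
  pair_sin : (m n)%:R * Ex P (fun w => sin (de n w)) @[n --> \oo] --> (0 : R) }.

Lemma sq_integ (f : T -> R) : measurable_fun setT f ->
  integ P (fun w => f w ^+ 2) -> integ P f.
Proof.
move=> mf if2; apply: integ_le mf _ (integD (integ_cst P 1) if2) => w.
rewrite [leRHS]ger0_norm ?addr_ge0 ?sqr_ge0// -(@real_normK _ (f w)) ?num_real//.
by have := sqr_ge0 (`|f w| - 1); have := normr_ge0 (f w); nra.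
Qed.

Lemma mE_cvg (l : R) (h g : nat -> T -> R) :
  (\forall n \near \oo, integ P (h n)) -> (\forall n \near \oo, integ P (g n)) ->
  negl (fun n w => h n w - g n w) ->
  (m n)%:R * Ex P (g n) @[n --> \oo] --> l ->
  (m n)%:R * Ex P (h n) @[n --> \oo] --> l.
Proof.
move=> ih ig /negl_mean c1 c2.
have c : (m n)%:R * Ex P (fun w => h n w - g n w) + (m n)%:R * Ex P (g n)
    @[n --> \oo] --> l by rewrite -(add0r l); exact: cvgD.
apply: cvg_trans c; apply: near_eq_cvg; apply: filterS2 ih ig => n ih ig /=.
by rewrite ExB// -mulrDr subrK.
Qed.

Lemma lindeberg_pairD xi de xi' de' : lindeberg_pair xi de -> lindeberg_pair xi' de' ->
  lindeberg_pair (fun n w => xi n w + xi' n w) (fun n w => de n w + de' n w).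
Proof.
move=> [sq lind mean meas small sn] [sq' lind' mean' meas' small' sn'].
have md : \forall n \near \oo, measurable_fun setT (fun w => de n w + de' n w).
  by apply: filterS2 meas meas' => n; exact: measurable_funD.
have bsin (f : nat -> T -> R) : (\forall n \near \oo, measurable_fun setT (f n)) ->
    \forall n \near \oo, integ P (fun w => sin (f n w)).
  by move=> mf; apply: filterS mf => n mf; exact: bddmeas_integ (bddmeas_sin mf).
split => //.
- exact: bounded_sqD.
- move=> e e0; have e20 : 0 < e / 2 by rewrite divr_gt0.
  have [[s1 _] [s2 _]] := (sq, sq').
  apply: negl_le (neglD (neglZ 4 (lind _ e20)) (neglZ 4 (lind' _ e20))).
    by apply: filterS2 s1 s2 => n [mx _] [mx' _]; apply: measurable_large; exact: measurable_funD.
  by apply: nearW => n w; rewrite ger0_norm ?large_ge0// largeD.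
- have [[s1 _] [s2 _]] := (sq, sq').
  apply: filterS2 (filterI s1 mean) (filterI s2 mean') => n [[mx sx] ex] [[mx' sx'] ex'].
  by rewrite ExD ?ex ?ex' ?addr0//; exact: sq_integ.
- apply: negl_le (neglD (neglZ 2 small) (neglZ 2 small')).
    by apply: filterS md => n; exact: measurable_sqmin.
  by apply: nearW => n w; rewrite ger0_norm ?sqmin_ge0// sqminD.
- apply: (mE_cvg (g := fun n w => sin (de n w) + sin (de' n w))).
  + exact: bsin.
  + by apply: filterS2 (bsin _ meas) (bsin _ meas') => n; exact: integD.
  + apply: negl_le (neglD (neglZ 2 small) (neglZ 2 small')).
      apply: filterS3 (bsin _ md) (bsin _ meas) (bsin _ meas') => n i1 i2 i3.
      exact: integ_meas (integB i1 (integD i2 i3)).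
    by apply: nearW => n w; exact: sin_add_bound.
  + have c : (m n)%:R * Ex P (fun w => sin (de n w)) +
        (m n)%:R * Ex P (fun w => sin (de' n w)) @[n --> \oo] --> (0 : R).
      by rewrite -(addr0 0); exact: cvgD.
    apply: cvg_trans c; apply: near_eq_cvg.
    apply: filterS2 (bsin _ meas) (bsin _ meas') => n i1 i2 /=.
    by rewrite ExD// mulrDr.
Qed.

Lemma lindeberg_pairZ a xi de : lindeberg_pair xi de ->
  lindeberg_pair (fun n w => a * xi n w) (fun n w => a * de n w).
Proof.
move=> [sq lind mean meas small sn].
have md : \forall n \near \oo, measurable_fun setT (fun w => a * de n w).
  by apply: filterS meas => n md; exact: measurable_funM.
have bsin (f : nat -> T -> R) : (\forall n \near \oo, measurable_fun setT (f n)) ->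
    \forall n \near \oo, integ P (fun w => sin (f n w)).
  by move=> mf; apply: filterS mf => n mf; exact: bddmeas_integ (bddmeas_sin mf).
have [s1 _] := sq.
split => //.
- exact: bounded_sqZ.
- move=> e e0; have ea : 0 < e / (`|a| + 1) by rewrite divr_gt0// ltr_wpDl.
  apply: negl_le (neglZ (a ^+ 2) (lind _ ea)).
    by apply: filterS s1 => n [mx _]; apply: measurable_large; exact: measurable_funM.
  by apply: nearW => n w; rewrite ger0_norm ?large_ge0// largeZ.
- apply: filterS2 s1 mean => n [mx sx] ex.
  by rewrite ExZ ?ex ?mulr0//; exact: sq_integ.
- apply: negl_le (neglZ (a ^+ 2 + 1) small).
    by apply: filterS md => n; exact: measurable_sqmin.
  by apply: nearW => n w; rewrite ger0_norm ?sqmin_ge0// sqminZ.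
- apply: (mE_cvg (g := fun n w => a * sin (de n w))).
  + exact: bsin.
  + by apply: filterS (bsin _ meas) => n; exact: integZ.
  + apply: negl_le (neglZ ((`|a| + 1) ^+ 3) small).
      apply: filterS2 (bsin _ md) (bsin _ meas) => n i1 i2.
      exact: integ_meas (integB i1 (integZ a i2)).
    by apply: nearW => n w; exact: sin_scale_bound.
  + have c : a * ((m n)%:R * Ex P (fun w => sin (de n w))) @[n --> \oo] --> (0 : R).
      by rewrite -(mulr0 a); apply: cvgM; [exact: cvg_cst|exact: sn].
    apply: cvg_trans c; apply: near_eq_cvg.
    by apply: filterS (bsin _ meas) => n i1 /=; rewrite ExZ// mulrCA.
Qed.

End lindeberg_arrays.

Section row_asymptotics.
Context {R : realType} {disp : measure_display} {T : measurableType disp}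
  (P : probability T R).
Variable m : nat -> nat.
Implicit Types (xi de : nat -> T -> R).
Local Notation negl := (negl P m).
Local Notation lindeberg_pair := (lindeberg_pair P m).

Lemma lindeberg_pair0 : lindeberg_pair (fun _ _ => 0) (fun _ _ => 0).
Proof.
have z : (m n)%:R * Ex P (fun=> 0) @[n --> \oo] --> (0 : R).
  by under eq_fun do rewrite Ex_cst mulr0; exact: cvg_cst.
split.
- split; first by apply: nearW => n; split => //; exact: integ_cst.
  by exists 0; apply: nearW => n; rewrite expr0n/= Ex_cst mulr0.
- move=> e e0; rewrite /large expr0n/=.
  have -> : (fun (_ : nat) (_ : T) => if e < `|0 : R| then 0 else 0) = (fun _ _ => 0 : R).
    by apply/funext => n; apply/funext => w; case: ifP.
  by split; [apply: nearW => n; exact: integ_cst|rewrite normr0].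
- by apply: nearW => n; rewrite Ex_cst.
- by apply: nearW => n.
- rewrite /sqmin expr0n/= (min_idPl ler01).
  by split; [apply: nearW => n; exact: integ_cst|rewrite normr0].
- by rewrite sin0.
Qed.

Lemma lindeberg_pair_lin_comb (I : Type) (s : seq I) (a : I -> R) (xi de : I -> nat -> T -> R) :
  (forall i, lindeberg_pair (xi i) (de i)) ->
  lindeberg_pair (fun n w => \sum_(i <- s) a i * xi i n w) (fun n w => \sum_(i <- s) a i * de i n w).
Proof.
move=> g; elim: s => [|i s ih].
  have -> : (fun (n : nat) w => \sum_(i <- [::]) a i * xi i n w) = (fun _ _ => 0).
    by apply/funext => n; apply/funext => w; rewrite big_nil.
  have -> : (fun (n : nat) w => \sum_(i <- [::]) a i * de i n w) = (fun _ _ => 0).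
    by apply/funext => n; apply/funext => w; rewrite big_nil.
  exact: lindeberg_pair0.
have -> : (fun (n : nat) w => \sum_(i <- i :: s) a i * xi i n w) =
    (fun n w => a i * xi i n w + \sum_(i <- s) a i * xi i n w).
  by apply/funext => n; apply/funext => w; rewrite big_cons.
have -> : (fun (n : nat) w => \sum_(i <- i :: s) a i * de i n w) =
    (fun n w => a i * de i n w + \sum_(i <- s) a i * de i n w).
  by apply/funext => n; apply/funext => w; rewrite big_cons.
exact: lindeberg_pairD (lindeberg_pairZ _ (g i)) ih.
Qed.

Variables (xi de : nat -> T -> R).
Hypothesis gxd : lindeberg_pair xi de.

Let mxi : \forall n \near \oo, measurable_fun setT (xi n).
Proof. by have [s _] := pair_bounded_sq gxd; apply: filterS s => n []. Qed.

Let mde : \forall n \near \oo, measurable_fun setT (de n).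
Proof. exact: pair_measurable gxd. Qed.

Let ixi : \forall n \near \oo, integ P (xi n).
Proof. by have [s _] := pair_bounded_sq gxd; apply: filterS s => n [? ?]; exact: sq_integ. Qed.

Let bsin (f : nat -> T -> R) : (\forall n \near \oo, measurable_fun setT (f n)) ->
    \forall n \near \oo, bddmeas (fun w => sin (f n w)).
Proof. by move=> mf; apply: filterS mf => n mf; exact: bddmeas_sin. Qed.

Let bcos (f : nat -> T -> R) : (\forall n \near \oo, measurable_fun setT (f n)) ->
    \forall n \near \oo, bddmeas (fun w => cos (f n w)).
Proof. by move=> mf; apply: filterS mf => n mf; exact: bddmeas_cos. Qed.

Let mxd : \forall n \near \oo, measurable_fun setT (fun w => xi n w - de n w).
Proof. by apply: filterS2 mxi mde => n; exact: measurable_funB. Qed.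

(** For [|x| <= e] the error [|x|^3 / 2] is at most [e x^2]; beyond [e] it is at
    most [2 |x| <= (2 / e) x^2], which the Lindeberg condition controls. *)
Let negl_sin_id : negl (fun n w => sin (xi n w) - xi n w).
Proof.
apply: (negl_eps _ (pair_bounded_sq gxd)).
  by apply: filterS2 (bsin mxi) mxi => n [h _] h'; exact: measurable_funB.
move=> e e0; exists (fun n w => 2 / e * large e (xi n w)).
  exact: neglZ (pair_lindeberg gxd e0).
apply: nearW => n w; move: (xi n w) => x; rewrite /large.
case: ifPn => [ex|]; last rewrite -leNgt => xe.
- apply: (@le_trans _ _ (2 / e * x ^+ 2)); last by rewrite lerDr mulr_ge0 ?(ltW e0)// sqr_ge0.
  rewrite (le_trans (ler_normB _ _))// (le_trans (lerD (sin_le_norm x) (lexx _)))//.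
  rewrite -(@real_normK _ x) ?num_real// mulrAC ler_pdivlMr//.
  by have := normr_ge0 x; nra.
- rewrite mulr0 addr0 (le_trans (sin_id_bound x))// -(@real_normK _ x) ?num_real//.
  by have := normr_ge0 x; have := sqr_ge0 `|x|; nra.
Qed.

Let negl_sin_cos : negl (fun n w => sin (xi n w) * (1 - cos (de n w))).
Proof.
apply: negl_le (neglZ 2 (pair_small gxd)).
  apply: filterS2 (bsin mxi) (bcos mde) => n bs bc.
  by apply: (bddmeasM bs (bddmeasB (bddmeas_cst 1) bc)).1.
apply: nearW => n w; have /andP[h1 h2] := cos_sqmin (de n w).
by rewrite normrM (ger0_norm h1) (le_trans _ h2)// ler_piMl// sin_max.
Qed.

Let negl_cos_cos : negl (fun n w => cos (xi n w) * (1 - cos (de n w))).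
Proof.
apply: negl_le (neglZ 2 (pair_small gxd)).
  apply: filterS2 (bcos mxi) (bcos mde) => n bs bc.
  by apply: (bddmeasM bs (bddmeasB (bddmeas_cst 1) bc)).1.
apply: nearW => n w; have /andP[h1 h2] := cos_sqmin (de n w).
by rewrite normrM (ger0_norm h1) (le_trans _ h2)// ler_piMl// cos_max.
Qed.

(** Where [|sin de| <= e] the product is at most [e xi^2]; elsewhere
    [1 <= sin de ^ 2 / e^2]. *)
Let negl_cos_sin : negl (fun n w => (1 - cos (xi n w)) * sin (de n w)).
Proof.
apply: (negl_eps _ (pair_bounded_sq gxd)).
  apply: filterS2 (bcos mxi) (bsin mde) => n bc bs.
  by apply: (bddmeasM (bddmeasB (bddmeas_cst 1) bc) bs).1.
move=> e e0; have ee0 : 0 < e ^+ 2 by exact: exprn_gt0.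
exists (fun n w => 2 / e ^+ 2 * sqmin (de n w)).
  exact: neglZ (pair_small gxd).
apply: nearW => n w; move: (xi n w) (de n w) => x y.
have /andP[c1 c2] := cos_bounds x; have c3 := cos_geN1 x.
have s1 := sin_sqmin y; rewrite normrM (ger0_norm c1).
have [se|es] := leP `|sin y| e.
  apply: (@le_trans _ _ (e * x ^+ 2)); last by rewrite lerDl !mulr_ge0 ?sqmin_ge0// invr_ge0 ltW.
  have c4 : 1 - cos x <= x ^+ 2 by have := sqr_ge0 x => ?; lra.
  by rewrite mulrC ler_pM.
apply: (@le_trans _ _ (2 / e ^+ 2 * sqmin y)); last by rewrite lerDr mulr_ge0 ?(ltW e0)// sqr_ge0.
rewrite mulrAC ler_pdivlMr//.
have : e ^+ 2 <= sqmin y.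
  rewrite (le_trans _ s1)// -(@real_normK _ (sin y)) ?num_real//.
  by rewrite ler_sqr ?nnegrE ?(ltW e0)// ltW.
move=> ey; apply: ler_pM ey; rewrite ?sqr_ge0 ?mulr_ge0//.
by rewrite -[leRHS]mulr1 ler_pM ?sin_max//; lra.
Qed.

Let negl_sin_sin : negl (fun n w => sin (xi n w) * sin (de n w)).
Proof.
apply: (negl_eps _ (pair_bounded_sq gxd)).
  apply: filterS2 (bsin mxi) (bsin mde) => n bc bs.
  by apply: (bddmeasM bc bs).1.
move=> e e0; exists (fun n w => e^-1 * sqmin (de n w)).
  exact: neglZ (pair_small gxd).
apply: nearW => n w; move: (xi n w) (de n w) => x y.
have s1 := sin_sqmin y; have s2 := sin_le_norm x; rewrite normrM.
apply: (@le_trans _ _ (e * `|x| ^+ 2 + e^-1 * `|sin y| ^+ 2)); last first.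
  by rewrite !real_normK ?num_real// lerD2l ler_wpM2l// invr_ge0 ltW.
have -> : e * `|x| ^+ 2 + e^-1 * `|sin y| ^+ 2 = e^-1 * ((e * `|x|) ^+ 2 + `|sin y| ^+ 2).
  by rewrite mulrDr; congr (_ + _); field; rewrite gt_eqF.
rewrite [leRHS]mulrC ler_pdivlMr//.
have := sqr_ge0 (e * `|x| - `|sin y|); have := normr_ge0 x; have := normr_ge0 (sin y).
have : 0 <= e * (`|x| - `|sin x|) by rewrite mulr_ge0 ?(ltW e0)// subr_ge0.
have := normr_ge0 (sin x).
move: (`|sin y|) (`|x|) (`|sin x|) => b a c.
by nra.
Qed.

Let negl_cos_quadratic : negl (fun n w => 1 - cos (xi n w) - xi n w ^+ 2 / 2).
Proof.
apply: (negl_eps _ (pair_bounded_sq gxd)).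
  apply: filterS2 (bcos mxi) mxi => n [mc _] mx.
  apply: measurable_funB; first exact: measurable_funB.
  by apply: measurable_funM => //; exact: measurable_funX.
move=> e e0; have d0 : 0 < Num.min e 1 by rewrite lt_min e0 ltr01.
exists (fun n w => large (Num.min e 1) (xi n w)); first exact: (pair_lindeberg gxd d0).
apply: nearW => n w; move: (xi n w) => x; rewrite /large.
have /andP[c1 c2] := cos_bounds x; have x2 := sqr_ge0 x.
case: ifPn => [_|].
  by rewrite ler_norml; apply/andP; split; nra.
rewrite -leNgt le_min => /andP[xe x1]; rewrite addr0.
rewrite (le_trans (cos_quadratic_bound x))//.
have -> : x ^+ 4 = x ^+ 2 * x ^+ 2 by rewrite -exprD.
have : x ^+ 2 <= e.
  by rewrite -(@real_normK _ x) ?num_real//; have := normr_ge0 x; nra.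
by nra.
Qed.

(** The addition theorem splits [sin (xi - de)] into [xi - sin de], which has
    vanishing mean, and three negligible products. *)
Lemma pair_sin_limit : (m n)%:R * Ex P (fun w => sin (xi n w - de n w)) @[n --> \oo] --> (0 : R).
Proof.
apply: (mE_cvg (g := fun n w => xi n w - sin (de n w))).
- by apply: filterS (bsin mxd) => n; exact: bddmeas_integ.
- by apply: filterS2 ixi (bsin mde) => n i /(bddmeas_integ P); exact: integB.
- have -> : (fun n w => sin (xi n w - de n w) - (xi n w - sin (de n w))) = (fun n w =>
    (sin (xi n w) - xi n w) + (-1) * (sin (xi n w) * (1 - cos (de n w)))
    + (1 - cos (xi n w)) * sin (de n w)).
    by apply/funext => n; apply/funext => w; rewrite sinB; ring.
  by apply: neglD => //; apply: neglD => //; exact: neglZ.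
- have c : - ((m n)%:R * Ex P (fun w => sin (de n w))) @[n --> \oo] --> (0 : R).
    by rewrite -oppr0; apply: cvgN; exact: pair_sin gxd.
  apply: cvg_trans c; apply: near_eq_cvg.
  apply: filterS3 ixi (bsin mde) (pair_mean gxd) => n i /(bddmeas_integ P) j e.
  by rewrite ExB// e sub0r mulrN.
Qed.

(** Of [1 - cos (xi - de)] only [xi^2 / 2] is not negligible. *)
Lemma pair_cos_limit (s2 : R) : (m n)%:R * Ex P (fun w => xi n w ^+ 2) @[n --> \oo] --> s2 ->
  (m n)%:R * (1 - Ex P (fun w => cos (xi n w - de n w))) @[n --> \oo] --> s2 / 2.
Proof.
move=> c2.
have [s _] := pair_bounded_sq gxd.
have c : (m n)%:R * Ex P (fun w => 1 - cos (xi n w - de n w)) @[n --> \oo] --> s2 / 2.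
  apply: (mE_cvg (g := fun n w => 2^-1 * xi n w ^+ 2)).
  - apply: filterS (bcos mxd) => n b; apply: bddmeas_integ.
    exact: (bddmeasB (bddmeas_cst 1) b).
  - by apply: filterS s => n [_]; exact: integZ.
  - have -> : (fun n w => 1 - cos (xi n w - de n w) - 2^-1 * xi n w ^+ 2) = (fun n w =>
      (1 - cos (xi n w) - xi n w ^+ 2 / 2) + cos (xi n w) * (1 - cos (de n w))
      + (-1) * (sin (xi n w) * sin (de n w))).
      by apply/funext => n; apply/funext => w; rewrite cosB; field.
    by apply: neglD; [exact: neglD|exact: neglZ].
  - have c : 2^-1 * ((m n)%:R * Ex P (fun w => xi n w ^+ 2)) @[n --> \oo] --> s2 / 2.
      by rewrite mulrC; apply: cvgM => //; exact: cvg_cst.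
    apply: cvg_trans c; apply: near_eq_cvg; apply: filterS s => n [_ i].
    by rewrite ExZ// mulrCA.
apply: cvg_trans c; apply: near_eq_cvg; apply: filterS (bcos mxd) => n /(bddmeas_integ P) i.
by rewrite (ExB (integ_cst P 1) i) Ex_cst.
Qed.

End row_asymptotics.

(** [exp (- (1 - p))] differs from [p] by at most [(1 - p)^2], and both lie in
    the unit interval, so the errors of the [n] factors add. *)
Lemma power_expR_bound (R : realType) (p : R) (n : nat) : 0 <= p <= 1 ->
  `|p ^+ n - expR (- (n%:R * (1 - p)))| <= n%:R * (1 - p) ^+ 2.
Proof.
move=> /andP[p0 p1]; set y := 1 - p.
have y0 : 0 <= y by rewrite subr_ge0.
have yp : p = 1 - y by rewrite /y; ring.
have e0 : 0 <= expR (- y) <= 1 by rewrite expR_ge0 -expR0 ler_expR oppr_le0 y0.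
have e1 : 0 <= expR (- y) - p <= y ^+ 2.
  have := expR_ge1Dx (- y) => h1; rewrite subr_ge0 {1}yp h1/=.
  have h2 := expR_ge1Dx y.
  have : expR (- y) * (1 + y) <= 1.
    by rewrite expRN mulrC ler_pdivrMr ?expR_gt0// mul1r.
  by rewrite yp; case/andP: e0 => [? ?]; nra.
elim: n => [|n ih]; first by rewrite !mul0r oppr0 expR0 expr0 subrr normr0.
have -> : expR (- (n.+1%:R * y)) = expR (- y) * expR (- (n%:R * y)).
  by rewrite -expRD -natr1; congr expR; ring.
have -> : p ^+ n.+1 - expR (- y) * expR (- (n%:R * y)) =
  p * (p ^+ n - expR (- (n%:R * y))) - (expR (- y) - p) * expR (- (n%:R * y)).
  by rewrite exprS; ring.
rewrite (le_trans (ler_normB _ _))// -natr1 [leRHS]mulrDl mul1r lerD//.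
  by rewrite normrM (le_trans _ ih)// ler_piMl// ger0_norm.
case/andP: e1 => e1 e2; rewrite normrM (ger0_norm e1) (le_trans _ e2)// ler_piMr//.
rewrite ger0_norm ?expR_ge0// -expR0 ler_expR oppr_le0 mulr_ge0//.
Qed.

Lemma power_cvg_expR (R : realType) (p : nat -> R) (m : nat -> nat) (t : R) :
  (m n)%:R @[n --> \oo] --> (+oo : set_system R) -> (\forall n \near \oo, p n <= 1) ->
  (m n)%:R * (1 - p n) @[n --> \oo] --> t -> p n ^+ m n @[n --> \oo] --> expR (- t).
Proof.
move=> moo p1 ct.
have mi : ((m n)%:R)^-1 @[n --> \oo] --> (0 : R).
  apply/cvgr0Pnorm_lt => e e0; move/cvgryPgt : moo => /(_ e^-1).
  apply: filterS => n h; have m0 : 0 < (m n)%:R :> R by rewrite (lt_trans _ h)// invr_gt0.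
  by rewrite ger0_norm ?invr_ge0// invf_plt.
have m0 : \forall n \near \oo, 0 < (m n)%:R :> R by move/cvgryPgt : moo => /(_ 0).
have cp : 1 - p n @[n --> \oo] --> (0 : R).
  have c : (m n)%:R^-1 * ((m n)%:R * (1 - p n)) @[n --> \oo] --> (0 : R).
    by rewrite -(mul0r t); exact: cvgM.
  apply: cvg_trans c; apply: near_eq_cvg; apply: filterS m0 => n m0.
  by rewrite mulKf// gt_eqF.
have p0 : \forall n \near \oo, 0 <= p n.
  move/cvgr0Pnorm_lt : cp => /(_ 1 ltr01); apply: filterS => n.
  by rewrite ltr_norml => /andP[? ?]; lra.
have ce : expR (- ((m n)%:R * (1 - p n))) @[n --> \oo] --> expR (- t).
  apply: (@cvg_comp _ _ _ _ expR _ (nbhs (- t))); last exact: continuous_expR.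
  exact: cvgN.
have cb : (m n)%:R * (1 - p n) ^+ 2 @[n --> \oo] --> (0 : R).
  have c : (m n)%:R * (1 - p n) * (1 - p n) @[n --> \oo] --> (0 : R).
    by rewrite -(mulr0 t); exact: cvgM.
  by under eq_fun do rewrite expr2 mulrA.
have cd : p n ^+ m n - expR (- ((m n)%:R * (1 - p n))) @[n --> \oo] --> (0 : R).
  apply/norm_cvg0P; apply: (@squeeze_cvgr _ _ _ _ (fun=> 0)) cb; last exact: cvg_cst.
  by apply: filterS2 p0 p1 => n p0 p1; rewrite normr_ge0/= power_expR_bound// p0 p1.
have c : p n ^+ m n - expR (- ((m n)%:R * (1 - p n))) + expR (- ((m n)%:R * (1 - p n)))
  @[n --> \oo] --> expR (- t) by rewrite -(add0r (expR (- t))); exact: cvgD.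
by apply: cvg_trans c; apply: near_eq_cvg; apply: nearW => n; rewrite subrK.
Qed.

(** * Windows of a stationary row *)
Definition window (R : realType) (d : nat) (T : Type)
    (X : nat -> nat -> T -> d.-tuple R) (n a k : nat) (w : T) :=
  [seq X n i w | i <- iota a k].

(** Only the restriction to [Ecup E] matters, as in the definition of a cluster
    functional; on it the window of a row takes its values. *)
Definition seq_measurable (R : realType) (d : nat) (E : set (d.-tuple R))
    (k : nat) (H : seq (d.-tuple R) -> R) :=
  measurable_fun [set x : k.-tuple (d.-tuple R) | Ecup E x]
    (fun x : k.-tuple (d.-tuple R) => H x).

Section windows.
Context {R : realType} {d : nat} (E : set (d.-tuple R)) (mE : measurable E).
Context {disp : measure_display} {T : measurableType disp} (P : probability T R).
Variable X : nat -> nat -> T -> d.-tuple R.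
Hypothesis mX : forall n i, (1 <= i <= n)%N -> measurable_fun setT (X n i).
Hypothesis XE : forall n i w, (1 <= i <= n)%N -> E (X n i w).
Implicit Types (n a k : nat) (H : seq (d.-tuple R) -> R).

Let wtuple n a k w : k.-tuple (d.-tuple R) := [tuple X n (i + a) w | i < k].

Let windowE n a k w : window X n a k w = wtuple n a k w.
Proof.
apply: (@eq_from_nth _ (vzero R d)); first by rewrite size_map size_iota size_tuple.
move=> i; rewrite size_map size_iota => ik.
rewrite (nth_map 0%N) ?size_iota// nth_iota// addnC.
by rewrite -(tnth_nth _ _ (Ordinal ik)) tnth_mktuple.
Qed.

Local Notation dom k := [set x : k.-tuple (d.-tuple R) | Ecup E x].

Let domE k : (0 < k)%N -> dom k = \bigcap_(i in [set: 'I_k]) ((fun x : k.-tuple (d.-tuple R) => tnth x i) @^-1` E).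
Proof.
move=> k0; apply/seteqP; split => x /=.
  by move=> [_ Ex] i _ /=; apply: Ex; exact: mem_tnth.
move=> h; split; first by move=> x0; have := size_tuple x; rewrite x0 /= => kE; rewrite -kE in k0.
by move=> v /tnthP[i ->]; exact: h.
Qed.

Lemma measurable_Ecup_tuple k : (0 < k)%N ->
  measurable [set x : k.-tuple (d.-tuple R) | Ecup E x].
Proof.
move=> k0; rewrite domE//; apply: fin_bigcap_measurable => // i _.
by rewrite -[X in measurable X]setTI; exact: measurable_tnth.
Qed.

Let dom_wtuple n a k w : (0 < k)%N -> (1 <= a)%N -> (a + k <= n.+1)%N ->
  dom k (wtuple n a k w).
Proof.
move=> k0 a1 akn; rewrite domE// => i _ /=; rewrite tnth_mktuple; apply: XE.
by have := ltn_ord i; lia.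
Qed.

Local Notation total k H := ((fun x : k.-tuple (d.-tuple R) => H x) \_ (dom k)).

Let measurable_total k H : (0 < k)%N -> seq_measurable E k H -> measurable_fun setT (total k H).
Proof. by move=> k0 mH; exact: (measurable_restrictT _ (measurable_Ecup_tuple k0)).1 mH. Qed.

Let totalE n a k H w : (0 < k)%N -> (1 <= a)%N -> (a + k <= n.+1)%N ->
  H (window X n a k w) = total k H (wtuple n a k w).
Proof.
by move=> k0 a1 akn; rewrite patchE mem_set ?windowE//; exact: dom_wtuple.
Qed.

Let measurable_wtuple n a k : (1 <= a)%N -> (a + k <= n.+1)%N ->
  measurable_fun setT (wtuple n a k).
Proof.
move=> a1 akn; apply/measurable_fun_tnthP => i.
rewrite (_ : _ \o _ = X n (i + a)); last by apply/funext => w /=; rewrite tnth_mktuple.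
by apply: mX; have := ltn_ord i; lia.
Qed.

Lemma measurable_window n a k H : (0 < k)%N -> (1 <= a)%N -> (a + k <= n.+1)%N ->
  seq_measurable E k H -> measurable_fun setT (fun w => H (window X n a k w)).
Proof.
move=> k0 a1 akn mH.
rewrite (_ : (fun w => _) = total k H \o wtuple n a k); last first.
  by apply/funext => w /=; exact: totalE.
by apply: measurableT_comp; [exact: measurable_total|exact: measurable_wtuple].
Qed.

Let gen n lo hi := \bigcup_(k in [set k | (lo <= k <= hi)%N])
        preimage_set_system setT (X n k) measurable.

Lemma row_measurable_window n a k lo hi H : (0 < k)%N -> (1 <= a)%N -> (a + k <= n.+1)%N ->
  (lo <= a)%N -> (a + k <= hi.+1)%N -> seq_measurable E k H ->
  measurable_fun [set: g_sigma_algebraType (gen n lo hi)] (fun w => H (window X n a k w)).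
Proof.
move=> k0 a1 akn loa akh mH.
rewrite (_ : (fun w => _) = total k H \o wtuple n a k); last first.
  by apply/funext => w /=; exact: totalE.
apply: measurableT_comp; first exact: measurable_total.
apply/measurable_fun_tnthP => i.
rewrite (_ : _ \o _ = X n (i + a)); last by apply/funext => w /=; rewrite tnth_mktuple.
move=> _ B mB; apply: sub_sigma_algebra; exists (i + a)%N => /=.
  by have := ltn_ord i; lia.
by exists B.
Qed.

Lemma measurable_wrt_row n lo hi (U : T -> R) :
  measurable_fun [set: g_sigma_algebraType (gen n lo hi)] U ->
  measurable_wrt (row_sigma X n lo hi) U.
Proof. by move=> mU C mC; have := mU measurableT C mC; rewrite setTI. Qed.

Hypothesis Xstat : rowwise_stationary P X.

(** Equality in law of two windows, valid for every measurable [chi], with the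
    convention that both sides are the same default value when the integral is
    undefined. *)
Lemma Ex_window n a k H (chi : R -> R) : (0 < k)%N -> (1 <= a)%N -> (a + k <= n.+1)%N ->
  seq_measurable E k H -> measurable_fun setT chi ->
  Ex P (fun w => chi (H (window X n a k w))) = Ex P (fun w => chi (H (window X n 1 k w))).
Proof.
move=> k0 a1 akn mH mchi; have kn : (1 + k <= n.+1)%N by lia.
have ma := measurable_wtuple a1 akn; have m1 := measurable_wtuple (leqnn 1) kn.
have eqA A : measurable A -> P (wtuple n a k @^-1` A) = P (wtuple n 1 k @^-1` A).
  move=> mA; pose t : k.-tuple nat := [tuple i.+1 | i < k].
  have ta w : wtuple n a k w = [tuple X n (tnth t i + a.-1) w | i < k].
    by apply: eq_from_tnth => i; rewrite !tnth_mktuple addSnnS prednK.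
  have t1 w : wtuple n 1 k w = [tuple X n (tnth t i) w | i < k].
    by apply: eq_from_tnth => i; rewrite !tnth_mktuple addn1.
  rewrite (funext ta) (funext t1); apply: Xstat => // i.
  by rewrite tnth_mktuple; have := ltn_ord i; lia.
have ge0 (psi : k.-tuple (d.-tuple R) -> \bar R) : measurable_fun setT psi ->
    (forall x, (0 <= psi x)%E) ->
    (\int[P]_w psi (wtuple n a k w) = \int[P]_w psi (wtuple n 1 k w))%E.
  move=> mpsi psi0.
  have := ge0_integral_pushforward ma P measurableT mpsi (fun x _ => psi0 x).
  have := ge0_integral_pushforward m1 P measurableT mpsi (fun x _ => psi0 x).
  rewrite !preimage_setT => <- <-.
  apply: (@eq_measure_integral _ _ _ _ (pushforward P (wtuple n 1 k)) (pushforward P (wtuple n a k))).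
  by move=> A mA _; exact: eqA.
pose g x := (chi (total k H x))%:E.
have mg : measurable_fun setT g.
  by apply/measurable_EFinP; apply: measurableT_comp => //; exact: measurable_total.
have EE b : (1 <= b)%N -> (b + k <= n.+1)%N ->
    Ex P (fun w => chi (H (window X n b k w))) = fine (\int[P]_w g (wtuple n b k w))%E.
  by move=> b1 bk; rewrite /Ex /Rintegral; congr fine; apply: eq_integral => w _; rewrite totalE.
rewrite !EE//; congr fine; rewrite integralE [RHS]integralE.
have pc b : (fun w => g (wtuple n b k w))^\+%E = g^\+%E \o wtuple n b k by exact: funepos_comp.
have nc b : (fun w => g (wtuple n b k w))^\-%E = g^\-%E \o wtuple n b k by exact: funeneg_comp.
rewrite !pc !nc; congr (_ - _)%E.
  exact: (ge0 _ (measurable_funepos mg) (funepos_ge0 g)).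
exact: (ge0 _ (measurable_funeneg mg) (funeneg_ge0 g)).
Qed.

Lemma take_window n a p k w : (p <= k)%N ->
  take p (window X n a k w) = window X n a p w.
Proof. by move=> pk; rewrite /window -map_take take_iota (minn_idPl pk). Qed.

End windows.

Lemma seq_measurable_take (R : realType) (d : nat) (E : set (d.-tuple R)) (p k : nat) (f : seq (d.-tuple R) -> R) :
  measurable E -> (p <= k)%N -> (forall q, seq_measurable E q f) ->
  seq_measurable E k (fun x => f (take p x)).
Proof.
move=> mE pk mf; have [p0|p0] := posnP p.
  rewrite /seq_measurable p0 (_ : (fun x => _) = fun=> f [::]); first exact: measurable_cst.
  by apply/funext => x; rewrite take0.
pose phi (x : k.-tuple (d.-tuple R)) : p.-tuple (d.-tuple R) :=
  [tuple tnth x (widen_ord pk i) | i < p].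
have phiE (x : k.-tuple (d.-tuple R)) : take p x = phi x :> seq _.
  apply: (@eq_from_nth _ (vzero R d)); first by rewrite size_takel ?size_tuple.
  move=> i; rewrite size_takel ?size_tuple// => ip; rewrite nth_take//.
  rewrite -[RHS](tnth_nth _ _ (Ordinal ip)) tnth_mktuple.
  by rewrite (tnth_nth (vzero R d)).
have mphi : measurable_fun setT phi.
  apply/measurable_fun_tnthP => i.
  rewrite (_ : _ \o _ = fun x : k.-tuple (d.-tuple R) => tnth x (widen_ord pk i)); first exact: measurable_tnth.
  by apply/funext => x /=; rewrite tnth_mktuple.
rewrite /seq_measurable (_ : (fun x => _) = (fun y : p.-tuple (d.-tuple R) => f y) \o phi); last first.
  by apply/funext => x /=; rewrite phiE.
apply: (@measurable_comp _ _ _ _ _ _ [set x : p.-tuple (d.-tuple R) | Ecup E x]).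
- exact: measurable_Ecup_tuple.
- move=> _ [x [_ Ex] <-]; rewrite /= -phiE; split.
    by move=> /(congr1 size); rewrite size_takel ?size_tuple//= => p00; rewrite p00 in p0.
  by move=> u /mem_take; exact: Ex.
- exact: mf.
- exact: measurable_funTS.
Qed.

(** * Sums over separated windows *)
Section window_chains.
Context {R : realType} {d : nat} (E : set (d.-tuple R)) (mE : measurable E).
Context {disp : measure_display} {T : measurableType disp} (P : probability T R).
Variable X : nat -> nat -> T -> d.-tuple R.
Hypothesis mX : forall n i, (1 <= i <= n)%N -> measurable_fun setT (X n i).
Hypothesis XE : forall n i w, (1 <= i <= n)%N -> E (X n i w).
Hypothesis Xstat : rowwise_stationary P X.
Variables (n g a k p M : nat) (H : seq (d.-tuple R) -> R) (b : R).
Hypotheses (k0 : (0 < k)%N) (a1 : (1 <= a)%N) (kgp : (k + g <= p)%N).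
Hypothesis Mn : forall i, (i < M)%N -> (a + i * p + k <= n.+1)%N.
Hypothesis mH : seq_measurable E k H.
Hypotheses (b0 : 0 <= b) (beta_b : (beta_mixing P X n g <= b%:E)%E).

Let V i w := H (window X n (a + i * p) k w).

Let mV i : (i < M)%N -> measurable_fun setT (V i).
Proof. by move=> iM; apply: (measurable_window mE) => //; [lia|exact: Mn]. Qed.

(** The windows before the [i]-th one end at least [g] indices before it
    starts.  For [i = 0] the partial sum is constant. *)
Let cov_window i (phi chi : R -> R) : (i < M)%N ->
  unit_test phi -> unit_test chi ->
  `|Ex P (fun w => phi (\sum_(q < i) V q w) * chi (V i w)) -
    Ex P (fun w => phi (\sum_(q < i) V q w)) * Ex P (fun w => chi (V i w))| <= 4 * b.
Proof.
move=> iM [mphi phi1] [mchi chi1].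
have [i0|i0] := posnP i.
  have Si : (fun w => \sum_(q < i) V q w) = (fun=> 0 : R).
    by apply/funext => w; rewrite i0 big_ord0.
  under eq_fun do rewrite (congr1 (@^~ _) Si).
  under [in X in _ - X]eq_fun do rewrite (congr1 (@^~ _) Si).
  rewrite Ex_cst ExZ ?subrr ?normr0 ?mulr_ge0//.
  by apply: bddmeas_integ; exact: (bddmeas_comp mchi chi1 (mV iM)).
have aip : (k + g <= i * p)%N by rewrite (leq_trans kgp)// leq_pmull.
(* [lo] is the last index of the past; the preceding windows end before it. *)
have [lo lo1 loE] : exists2 lo, (1 <= lo)%N & (lo + g + 1 = a + i * p)%N.
  by exists (a + i * p - g - 1)%N; lia.
have iMn := Mn iM.
have Gm : row_sigma X n 1 lo `<=` measurable.
  by apply: row_sigma_measurable => j ?; apply: mX; lia.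
have Hm : row_sigma X n (lo + g + 1) n `<=` measurable.
  by apply: row_sigma_measurable => j ?; apply: mX; lia.
apply: (cov_bound (P := P) Gm Hm) => //.
- move=> A B GA HB; rewrite -lee_fin; apply: le_trans beta_b.
  by apply: alpha_le_beta GA HB; [exact: mX|exact: lo1|lia].
- apply: measurable_wrt_row.
  apply: (measurableT_comp mphi); apply: measurable_sum => q.
  have qi := ltn_ord q; have qp : (q * p + p <= i * p)%N by rewrite -mulSnr leq_mul2r qi orbT.
  have qM := Mn (ltn_trans qi iM).
  by apply: (row_measurable_window mE XE) => //; lia.
- apply: measurable_wrt_row; apply: (measurableT_comp mchi).
  by apply: (row_measurable_window mE XE) => //; lia.
Qed.

Let V1 w := H (window X n 1 k w).

Let Ex_V i (chi : R -> R) : (i < M)%N -> measurable_fun setT chi ->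
  Ex P (fun w => chi (V i w)) = Ex P (fun w => chi (V1 w)).
Proof. by move=> iM; apply: (Ex_window mE mX XE Xstat) => //; [lia|exact: Mn]. Qed.

Let mcos : measurable_fun setT (@cos R).
Proof. by apply: continuous_measurable_fun => x; exact: continuous_cos. Qed.

Let msin : measurable_fun setT (@sin R).
Proof. by apply: continuous_measurable_fun => x; exact: continuous_sin. Qed.

Lemma window_cos (th : R) :
  `|Ex P (fun w => cos (\sum_(i < M) H (window X n (a + i * p) k w) + th)) -
    Ex P (fun w => cos (V1 w)) ^+ M * cos th| <=
  M%:R * (8 * b + `|Ex P (fun w => sin (V1 w))|).
Proof.
rewrite (_ : 8 * b = (4 * b) *+ 2); last by ring.
apply: (@cos_chain _ _ _ P M V) => // i iM.
  exact: Ex_V.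
exact: Ex_V.
Qed.

Lemma window_satq :
  Ex P (fun w => satq (\sum_(i < M) H (window X n (a + i * p) k w))) <=
  M%:R * (4 * b + `|Ex P (fun w => sin (V1 w))| + 2 * Ex P (fun w => sqmin (V1 w))).
Proof.
apply: (@satq_chain _ _ _ P M V) => // i iM.
  exact: Ex_V.
apply: (@Ex_V i (fun x => sqmin x)) => //.
exact: (measurable_sqmin (f := id)).
Qed.

End window_chains.

(** * Limit of block sums *)
Lemma sum_even_odd (V : nmodType) (F : nat -> V) n :
  \sum_(i < n) F i = \sum_(i < uphalf n) F i.*2 + \sum_(i < n./2) F i.*2.+1.
Proof.
elim: n => [|n ih]; first by rewrite !big_ord0 addr0.
rewrite big_ord_recr ih /= uphalf_half; have := odd_double_half n.
case: (odd n) => /= ne; rewrite ?add0n ?add1n !big_ord_recr/= -[in F n]ne.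
  by rewrite add1n addrA.
by rewrite addrAC.
Qed.

Lemma cvg0D (R : realType) (u v : nat -> R) : u n @[n --> \oo] --> (0 : R) ->
  v n @[n --> \oo] --> (0 : R) -> u n + v n @[n --> \oo] --> (0 : R).
Proof. by move=> cu cv; rewrite -(addr0 0); exact: cvgD. Qed.

Lemma cvg0Z (R : realType) (a : R) (u : nat -> R) : u n @[n --> \oo] --> (0 : R) ->
  a * u n @[n --> \oo] --> (0 : R).
Proof. by move=> cu; rewrite -(mulr0 a); apply: cvgM => //; exact: cvg_cst. Qed.

Lemma satq_ge_half (R : realType) (z : R) : 1 < `|z| -> 1 <= 2 * satq z.
Proof.
move=> z1; have : 1 <= z ^+ 2 by rewrite -(@real_normK _ z) ?num_real// exprn_ege1// ltW.
move=> h; rewrite /satq mulrA ler_pdivlMr; last by rewrite ltr_pwDl// sqr_ge0.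
by rewrite mul1r; lra.
Qed.

Lemma cos_lipschitz (R : realType) (x y : R) : `|cos (x + y) - cos x| <= `|y|.
Proof.
pose u := x + y / 2; pose v := y / 2.
have -> : x + y = u + v by rewrite /u /v; field.
have -> : cos x = cos (u - v) by congr cos; rewrite /u /v; ring.
have -> : cos (u + v) - cos (u - v) = - (sin u * (2 * sin v)).
  by rewrite cosD cosB; ring.
rewrite normrN normrM (le_trans (ler_piMl _ (sin_max _)))// normrM ger0_norm//.
rewrite (le_trans (ler_wpM2l _ (sin_le_norm v)))// /v normrM.
by rewrite (ger0_norm (_ : 0 <= 2^-1 :> R))// mulrCA divff// mulr1.
Qed.

(** If [|y|] or [|z|] exceeds [eta], the corresponding [satq] term is at least
    [1 / 2], and the difference of cosines is at most 2. *)
Lemma cos_perturb (R : realType) (x y z eta : R) : 0 < eta ->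
  `|cos (x + (y + z)) - cos x| <=
    2 * eta + 4 * satq (eta^-1 * y) + 4 * satq (eta^-1 * z).
Proof.
move=> eta0; have y0 := satq_ge0 (eta^-1 * y); have z0 := satq_ge0 (eta^-1 * z).
have big u : eta < `|u| -> 1 <= 2 * satq (eta^-1 * u).
  move=> h; apply: satq_ge_half.
  by rewrite normrM gtr0_norm ?invr_gt0// mulrC ltr_pdivlMr// mul1r.
have two : `|cos (x + (y + z)) - cos x| <= 2.
  by rewrite (le_trans (ler_normB _ _))// (le_trans (lerD (cos_max _) (cos_max _))).
have [ye|/big h] := leP `|y| eta; last by lra.
have [ze|/big h] := leP `|z| eta; last by lra.
have := cos_lipschitz x (y + z); have := ler_normD y z; lra.
Qed.

Section block_sums.
Context {R : realType} {d : nat} (E : set (d.-tuple R)) (mE : measurable E).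
Context {disp : measure_display} {T : measurableType disp} (P : probability T R).
Variable X : nat -> nat -> T -> d.-tuple R.
Hypothesis mX : forall n i, (1 <= i <= n)%N -> measurable_fun setT (X n i).
Hypothesis XE : forall n i w, (1 <= i <= n)%N -> E (X n i w).
Hypothesis Xstat : rowwise_stationary P X.
Variables (r l : nat -> nat) (b : nat -> R).
Local Notation m n := (n %/ r n)%N.
Hypothesis r_gt0 : forall n, (0 < r n)%N.
Hypothesis lr : \forall n \near \oo, (l n < r n)%N.
Hypothesis beta_b : \forall n \near \oo,
  0 <= b n /\ (beta_mixing P X n (l n) <= (b n)%:E)%E.
Hypothesis mb : (m n)%:R * b n @[n --> \oo] --> (0 : R).
Hypothesis moo : (m n)%:R @[n --> \oo] --> (+oo : set_system R).
Variables (hz hd : nat -> seq (d.-tuple R) -> R) (K D : nat -> T -> R) (s2 : R).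
Hypothesis mhz : forall n, (l n < r n)%N -> seq_measurable E (r n - l n) (hz n).
Hypothesis mhd : forall n, seq_measurable E (r n) (hd n).
Hypothesis hzE : forall n w, hz n (window X n 1 (r n - l n) w) = K n w - D n w.
Hypothesis hdE : forall n w, hd n (window X n 1 (r n) w) = D n w.
Hypothesis gKD : lindeberg_pair P (fun n => m n) K D.
Hypothesis cK : (m n)%:R * Ex P (fun w => K n w ^+ 2) @[n --> \oo] --> s2.

Let SZ n w := \sum_(i < m n) hz n (window X n (1 + i * r n) (r n - l n) w).
Let Ze n w := \sum_(i < uphalf (m n)) hd n (window X n (1 + i * (2 * r n)) (r n) w).
Let Zo n w := \sum_(i < (m n)./2) hd n (window X n (1 + r n + i * (2 * r n)) (r n) w).
Let SD n w := \sum_(i < m n) hd n (window X n (1 + i * r n) (r n) w).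

Let SDE n w : SD n w = Ze n w + Zo n w.
Proof.
rewrite /SD (sum_even_odd (fun i => hd n (window X n (1 + i * r n) (r n) w))).
congr (_ + _); apply: eq_bigr => i _; congr (hd n (window X n _ _ w)); lia.
Qed.

Let fit n i : (i < m n)%N -> (i * r n + r n <= n)%N.
Proof. by move=> im; rewrite -mulSnr (leq_trans _ (leq_trunc_div n (r n)))// leq_mul2r im orbT. Qed.

Let mSZ : \forall n \near \oo, measurable_fun setT (SZ n).
Proof.
apply: filterS lr => n lrn; apply: measurable_sum => i.
have := fit (ltn_ord i) => ?.
by apply: (measurable_window mE) => //; [lia|lia|exact: mhz].
Qed.

Let mSum n (a p M : nat) : (1 <= a)%N -> (forall i, (i < M)%N -> (a + i * p + r n <= n.+1)%N) ->
  measurable_fun setT (fun w => \sum_(i < M) hd n (window X n (a + i * p) (r n) w)).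
Proof.
move=> a1 aM; apply: measurable_sum => i.
by apply: (measurable_window mE) => //; [lia|exact: aM].
Qed.

Let fit_even n i : (i < uphalf (m n))%N -> (1 + i * (2 * r n) + r n <= n.+1)%N.
Proof.
rewrite uphalf_half => im; have := odd_double_half (m n) => mE'.
have : (i.*2 < m n)%N by lia.
by move=> /fit; lia.
Qed.

Let fit_odd n i : (i < (m n)./2)%N -> (1 + r n + i * (2 * r n) + r n <= n.+1)%N.
Proof.
move=> im; have := odd_double_half (m n) => mE'.
have : (i.*2.+1 < m n)%N by lia.
by move=> /fit; lia.
Qed.

Let mZe n : measurable_fun setT (Ze n).
Proof. by apply: mSum => //; exact: fit_even. Qed.

Let mZo n : measurable_fun setT (Zo n).
Proof. by apply: mSum => //; exact: fit_odd. Qed.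

Let seq_measurableZ k (c : R) h : seq_measurable E k h -> seq_measurable E k (fun x => c * h x).
Proof. by move=> mh; apply: measurable_funM. Qed.

Let small_rate c n := (m n)%:R * (4 * b n + `|Ex P (fun w => sin (c * D n w))| +
  2 * Ex P (fun w => sqmin (c * D n w))).

Let small_rate_cvg c : small_rate c n @[n --> \oo] --> (0 : R).
Proof.
have g := lindeberg_pairZ c gKD.
have [_ c1] := pair_small g.
have c2 : `|(m n)%:R * Ex P (fun w => sin (c * D n w))| @[n --> \oo] --> (0 : R).
  by rewrite -(normr0 R); apply: cvg_norm; exact: (pair_sin g).
have c3 : 4 * ((m n)%:R * b n) + `|(m n)%:R * Ex P (fun w => sin (c * D n w))|
    + 2 * ((m n)%:R * Ex P (fun w => `|sqmin (c * D n w)|)) @[n --> \oo] --> (0 : R).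
  by apply: cvg0D (cvg0Z 2 c1); apply: cvg0D c2; exact: cvg0Z.
apply: cvg_trans c3; apply: near_eq_cvg; apply: nearW => n.
rewrite /small_rate normrM ger0_norm// !mulrDr; congr (_ + _ + _); first by ring.
rewrite [RHS]mulrCA; congr (2 * (_ * Ex P _)); apply/funext => w.
by rewrite ger0_norm// sqmin_ge0.
Qed.

(** Full blocks are adjacent; taking every second one leaves gaps of length
    [r n >= l n]. *)
Let small_sum c (a p M : nat -> nat) : 
  (forall n, (1 <= a n)%N) -> (forall n, 2 * r n <= p n)%N ->
  (forall n, M n <= m n)%N ->
  (forall n i, (i < M n)%N -> (a n + i * p n + r n <= n.+1)%N) ->
  Ex P (fun w => satq (c * \sum_(i < M n) hd n (window X n (a n + i * p n) (r n) w)))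
    @[n --> \oo] --> (0 : R).
Proof.
move=> a1 rp Mm fitM.
apply: (@squeeze_cvgr _ _ _ _ (fun=> 0)) (small_rate_cvg c); last exact: cvg_cst.
apply: filterS2 lr beta_b => n lrn [b0 bb].
rewrite Ex_ge0/=; last by move=> w; exact: satq_ge0.
have rl : (r n + l n <= p n)%N by rewrite (leq_trans _ (rp n))// mul2n -addnn leq_add2l ltnW.
have := window_satq mE mX XE Xstat (r_gt0 n) (a1 n) rl (fitM n) (seq_measurableZ c (@mhd n)) b0 bb.
under [in X in X <= _ -> _]eq_fun do rewrite -mulr_sumr.
under [in X in _ <= X -> _]eq_fun do rewrite hdE.
move/le_trans; apply.
rewrite /small_rate; under [X in _ * (_ + 2 * Ex P X)]eq_fun do rewrite hdE.
rewrite ler_wpM2r ?ler_nat//.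
by rewrite !addr_ge0 ?mulr_ge0 ?Ex_ge0// => w; exact: sqmin_ge0.
Qed.

Let Ze_small c : Ex P (fun w => satq (c * Ze n w)) @[n --> \oo] --> (0 : R).
Proof.
apply: (@small_sum c (fun=> 1%N) (fun n => 2 * r n)%N (fun n => uphalf (m n))) => //.
by move=> n; rewrite leq_uphalf_double -addnn leq_addr.
Qed.

Let Zo_small c : Ex P (fun w => satq (c * Zo n w)) @[n --> \oo] --> (0 : R).
Proof.
apply: (@small_sum c (fun n => 1 + r n)%N (fun n => 2 * r n)%N (fun n => (m n)./2)) => //.
by move=> n; rewrite -{2}(odd_double_half (m n)) -addnn addnA leq_addl.
Qed.

Let iq (Y : T -> R) c : measurable_fun setT Y -> integ P (fun w => satq (c * Y w)).
Proof.
move=> mY; apply: bddmeas_integ; apply: (@bddmeas_comp _ _ _ (fun x => satq x) 1).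
- exact: measurable_satq.
- by move=> x; rewrite ger0_norm ?satq_ge0// satq_le1.
- exact: measurable_funM.
Qed.

Let mKD : \forall n \near \oo, measurable_fun setT (fun w => K n w - D n w).
Proof.
have [s _] := pair_bounded_sq gKD; have md := pair_measurable gKD.
by apply: filterS2 s md => n [mK _] mD; exact: measurable_funB.
Qed.

Let SZ_charfun th : Ex P (fun w => cos (SZ n w + th)) @[n --> \oo] --> expR (- (s2 / 2)) * cos th.
Proof.
pose p n := Ex P (fun w => cos (K n w - D n w)).
have p1 : \forall n \near \oo, p n <= 1.
  apply: filterS mKD => n mk; apply: le_trans (ler_norm _) _.
  apply: Ex_bound; first exact: bddmeas_integ (bddmeas_cos mk).
  by move=> w; exact: cos_max.
have cp := power_cvg_expR moo p1 (pair_cos_limit gKD cK).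
have cq : `|(m n)%:R * Ex P (fun w => sin (K n w - D n w))| @[n --> \oo] --> (0 : R).
  by rewrite -(normr0 R); apply: cvg_norm; exact: pair_sin_limit gKD.
have cd : Ex P (fun w => cos (SZ n w + th)) - p n ^+ m n * cos th @[n --> \oo] --> (0 : R).
  apply/norm_cvg0P; apply: (@squeeze_cvgr _ _ _ _ (fun=> 0)) (cvg0D (cvg0Z 8 mb) cq); last exact: cvg_cst.
  apply: filterS2 lr beta_b => n lrn [b0 bb]; rewrite normr_ge0/=.
  have k0 : (0 < r n - l n)%N by rewrite subn_gt0.
  have kl : (r n - l n + l n <= r n)%N by rewrite subnK// ltnW.
  have fitn i : (i < m n)%N -> (1 + i * r n + (r n - l n) <= n.+1)%N by move=> /fit; lia.
  have := window_cos mE mX XE Xstat k0 (leqnn 1) kl fitn (mhz lrn) b0 bb th.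
  under [in X in _ - X ^+ _ * _]eq_fun do rewrite hzE.
  under [in X in _ <= _ * (_ + `|X|) -> _]eq_fun do rewrite hzE.
  by rewrite normrM [X in _ + X * _]ger0_norm// mulrDr mulrCA.
have c : Ex P (fun w => cos (SZ n w + th)) - p n ^+ m n * cos th + p n ^+ m n * cos th
    @[n --> \oo] --> expR (- (s2 / 2)) * cos th.
  rewrite -[X in _ --> X]add0r; apply: cvgD => //; apply: cvgM => //; exact: cvg_cst.
by apply: cvg_trans c; apply: near_eq_cvg; apply: nearW => n; rewrite subrK.
Qed.

(** The remainders only perturb the argument of the cosine, and they are small
    in probability by [Ze_small] and [Zo_small]. *)
Lemma block_sum_charfun th :
  Ex P (fun w => cos (SZ n w + SD n w + th)) @[n --> \oo] --> expR (- (s2 / 2)) * cos th.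
Proof.
have cd : Ex P (fun w => cos (SZ n w + SD n w + th)) - Ex P (fun w => cos (SZ n w + th))
    @[n --> \oo] --> (0 : R).
  apply/cvgr0Pnorm_le => e e0; pose eta := e / 4.
  have eta0 : 0 < eta by rewrite divr_gt0.
  have e16 : 0 < e / 16 by rewrite divr_gt0.
  move/cvgr0Pnorm_le : (Ze_small eta^-1) => /(_ _ e16) h1.
  move/cvgr0Pnorm_le : (Zo_small eta^-1) => /(_ _ e16) h2.
  apply: filterS3 mSZ h1 h2 => n mS h1 h2.
  have iC (Y : T -> R) : measurable_fun setT Y -> integ P (fun w => cos (Y w + th)).
    by move=> mY; apply: bddmeas_integ; apply: bddmeas_cos; exact: measurable_fun_add_cst.
  have mS' : measurable_fun setT (fun w => SZ n w + SD n w).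
    by under eq_fun do rewrite SDE; apply: measurable_funD => //; exact: measurable_funD.
  rewrite -ExB; [|exact: (iC (fun w => SZ n w + SD n w))|exact: iC].
  apply: (@le_trans _ _ (Ex P (fun w => 2 * eta + 4 * satq (eta^-1 * Ze n w) + 4 * satq (eta^-1 * Zo n w)))).
    apply: Ex_norm_le.
    - by apply: integB; [exact: (iC (fun w => SZ n w + SD n w))|exact: iC].
    - apply: integD; last exact/integZ/iq.
      by apply: integD; [exact: integ_cst|exact/integZ/iq].
    - move=> w; rewrite SDE (_ : SZ n w + _ + th = SZ n w + th + (Ze n w + Zo n w)); last by ring.
      exact: cos_perturb.
  rewrite ExD; [|by apply: integD; [exact: integ_cst|exact/integZ/iq]|exact/integZ/iq].
  rewrite ExD; [|exact: integ_cst|exact/integZ/iq].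
  rewrite Ex_cst !ExZ; [|exact: iq|exact: iq].
  have := le_trans (ler_norm _) h1; have := le_trans (ler_norm _) h2.
  by rewrite /eta; lra.
have c : Ex P (fun w => cos (SZ n w + SD n w + th)) - Ex P (fun w => cos (SZ n w + th)) +
    Ex P (fun w => cos (SZ n w + th)) @[n --> \oo] --> expR (- (s2 / 2)) * cos th.
  by rewrite -[X in _ --> X]add0r; apply: cvgD => //; exact: SZ_charfun.
by apply: cvg_trans c; apply: near_eq_cvg; apply: nearW => n; rewrite subrK.
Qed.

Let SZ_satq c : \forall n \near \oo, Ex P (fun w => satq (c * SZ n w)) <=
  (m n)%:R * (4 * b n + `|Ex P (fun w => sin (c * K n w - c * D n w))|
    + 4 * Ex P (fun w => sqmin (c * D n w))) + 4 * c ^+ 2 * ((m n)%:R * Ex P (fun w => K n w ^+ 2)).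
Proof.
have [s _] := pair_bounded_sq gKD; have md := pair_measurable gKD.
apply: filterS3 lr beta_b (filterI s md) => n lrn [b0 bb] [[mK iK] mD].
have k0 : (0 < r n - l n)%N by rewrite subn_gt0.
have kl : (r n - l n + l n <= r n)%N by rewrite subnK// ltnW.
have fitn i : (i < m n)%N -> (1 + i * r n + (r n - l n) <= n.+1)%N by move=> /fit; lia.
have := window_satq mE mX XE Xstat k0 (leqnn 1) kl fitn (seq_measurableZ c (mhz lrn)) b0 bb.
under [in X in X <= _ -> _]eq_fun do rewrite -mulr_sumr.
under [in X in _ <= X -> _]eq_fun do rewrite hzE mulrBr.
move/le_trans; apply.
have iD : integ P (fun w => sqmin (c * D n w)).
  apply: integ_le (integ_cst P 1); first by apply: measurable_sqmin; exact: measurable_funM.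
  by move=> w; rewrite normr1 ger0_norm ?sqmin_ge0 ?sqmin_le1.
have h : Ex P (fun w => sqmin (c * hz n (window X n 1 (r n - l n) w))) <=
    2 * c ^+ 2 * Ex P (fun w => K n w ^+ 2) + 2 * Ex P (fun w => sqmin (c * D n w)).
  under eq_fun do rewrite hzE mulrBr.
  rewrite -!ExZ// -ExD; [|exact: integZ|exact: integZ].
  apply: Ex_le; last first.
  - move=> w; rewrite (le_trans (sqminD _ _))// lerD//.
      by rewrite -mulrA ler_wpM2l// -exprMn sqmin_le.
    by rewrite /sqmin sqrrN.
  - by apply: integD; exact: integZ.
  - apply: integ_le (integ_cst P 1).
      by apply: measurable_sqmin; apply: measurable_funB; exact: measurable_funM.
    by move=> w; rewrite normr1 ger0_norm ?sqmin_ge0 ?sqmin_le1.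
have m0 : 0 <= (m n)%:R :> R by [].
move: h; move: (Ex P _) => A; move: (Ex P _) => B; move: (Ex P _) => C h.
have := ler_wpM2l m0 h; lra.
Qed.

(** For the multiple [c] the bound [SZ_satq] tends to [4 c^2 s2], so small [c],
    that is a large level [3 / c], makes it small. *)
Lemma block_sum_tight e : 0 < e -> exists L : R, \forall n \near \oo,
  Ex P (\1_[set w | L < `|SZ n w + SD n w|]) <= e.
Proof.
move=> e0; pose A := `|s2| + 1; have A0 : 0 < A by rewrite ltr_wpDl.
(* With [c <= 1], this choice gives [4 c^2 A <= e / 8]. *)
pose c := Num.min 1 (e / 32 / A).
have c0 : 0 < c by rewrite lt_min ltr01 !divr_gt0.
have cA : 4 * c ^+ 2 * A <= e / 8.
  have : c * A <= e / 32 by rewrite -ler_pdivlMr// /c ge_min lexx orbT.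
  have : c <= 1 by rewrite /c ge_min lexx.
  move=> c1 cA; have h : 0 <= c * A * (1 - c) by rewrite !mulr_ge0 ?subr_ge0 ?(ltW c0) ?(ltW A0).
  by nra.
exists (3 / c).
have KA : \forall n \near \oo, (m n)%:R * Ex P (fun w => K n w ^+ 2) <= A.
  have : s2 < A by rewrite (le_lt_trans (ler_norm _))// ltrDl.
  by move=> /(cvgr_lt _ cK); apply: filterS => n; exact: ltW.
have gc := lindeberg_pairZ c gKD.
have sm : (m n)%:R * (4 * b n + `|Ex P (fun w => sin (c * K n w - c * D n w))|
    + 4 * Ex P (fun w => sqmin (c * D n w))) @[n --> \oo] --> (0 : R).
  have [_ c1] := pair_small gc.
  have c2 : `|(m n)%:R * Ex P (fun w => sin (c * K n w - c * D n w))| @[n --> \oo] --> (0 : R).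
    by rewrite -(normr0 R); apply: cvg_norm; exact: pair_sin_limit gc.
  apply: cvg_trans (cvg0D (cvg0D (cvg0Z 4 mb) c2) (cvg0Z 4 c1)).
  apply: near_eq_cvg; apply: nearW => n /=.
  rewrite normrM ger0_norm// !mulrDr; congr (_ + _ + _); first by ring.
  rewrite [RHS]mulrCA; congr (4 * (_ * Ex P _)); apply/funext => w.
  by rewrite ger0_norm// sqmin_ge0.
have e8 : 0 < e / 8 by rewrite divr_gt0.
move/cvgr0Pnorm_le : (Ze_small c) => /(_ _ e8) h1.
move/cvgr0Pnorm_le : (Zo_small c) => /(_ _ e8) h2.
move/cvgr0Pnorm_le : sm => /(_ _ e8) h3.
apply: filterS3 (filterI mSZ KA) (filterI h1 h2) (filterI h3 (SZ_satq c)).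
move=> n [mS KAn] [h1n h2n] [h3n h4n].
have mS' : measurable_fun setT (fun w => SZ n w + SD n w).
  by under eq_fun do rewrite SDE; apply: measurable_funD => //; exact: measurable_funD.
have i1 := iq c mS; have i2 := iq c (mZe n); have i3 := iq c (mZo n).
apply: (@le_trans _ _ (Ex P (fun w => 2 * satq (c * SZ n w) + 2 * satq (c * Ze n w) + 2 * satq (c * Zo n w)))).
  apply: Ex_le.
  - by apply: bddmeas_integ; apply: bddmeas_indic; exact: measurable_gt_set.
  - by apply: integD; [apply: integD|]; exact: integZ.
  move=> w; have := satq_ge0 (c * SZ n w); have := satq_ge0 (c * Ze n w); have := satq_ge0 (c * Zo n w).
  rewrite indicE; case: (boolP (w \in _)) => [|_]; last by rewrite /=; lra.
  rewrite inE /= ltr_pdivrMr// SDE => h.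
  have [s1|/satq_ge_half] := leP `|c * SZ n w| 1; last by lra.
  have [s2'|/satq_ge_half] := leP `|c * Ze n w| 1; last by lra.
  have [s3|/satq_ge_half] := leP `|c * Zo n w| 1; last by lra.
  have : `|SZ n w + (Ze n w + Zo n w)| * c <= 3.
    rewrite -[X in _ * X](gtr0_norm c0) -normrM mulrC !mulrDr.
    by rewrite (le_trans (ler_normD _ _))// (le_trans (lerD s1 (ler_normD _ _)))//; lra.
  by lra.
rewrite ExD; [|by apply: integD; exact: integZ|exact: integZ].
rewrite ExD; [|exact: integZ|exact: integZ].
rewrite !ExZ//.
have := le_trans (ler_norm _) h1n; have := le_trans (ler_norm _) h2n.
have := le_trans (ler_norm _) h3n.
have : 4 * c ^+ 2 * ((m n)%:R * Ex P (fun w => K n w ^+ 2)) <= 4 * c ^+ 2 * A.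
  by rewrite ler_wpM2l// mulr_ge0// sqr_ge0.
by lra.
Qed.

End block_sums.

(** * Number of blocks and mixing rate *)
Section block_counts.
Context {R : realType}.
Variables (r l : nat -> nat).
Hypothesis r_gt0 : forall n, (0 < r n)%N.
Hypothesis r_n : (fun n => (r n)%:R : R) =o_\oo (fun n => n%:R : R).
Local Notation m n := (n %/ r n)%N.

Lemma littleo_ratio (u v : nat -> nat) (e : R) : 0 < e ->
  (fun n => (u n)%:R : R) =o_\oo (fun n => (v n)%:R : R) ->
  \forall n \near \oo, (u n)%:R <= e * (v n)%:R.
Proof.
move=> e0 /eqoP /(_ e e0); apply: filterS => n.
by rewrite !ger0_norm.
Qed.

Lemma littleo_lt (u v : nat -> nat) : (forall n, 0 < v n)%N ->
  (fun n => (u n)%:R : R) =o_\oo (fun n => (v n)%:R : R) ->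
  \forall n \near \oo, (u n < v n)%N.
Proof.
move=> v0 /(@littleo_ratio _ _ 2^-1 _)[|N _ h]; first by rewrite invr_gt0.
exists N => // n /h h'; rewrite -(ltr_nat R) (le_lt_trans h')//.
have vn : 0 < (v n)%:R :> R by rewrite ltr0n.
by lra.
Qed.

Lemma r_le_n : \forall n \near \oo, (r n <= n)%N.
Proof.
have := littleo_ratio (u := r) (v := id) ltr01 r_n.
by apply: filterS => n; rewrite mul1r ler_nat.
Qed.

Lemma block_countr_le n : (m n)%:R * (r n)%:R <= n%:R :> R.
Proof. by rewrite -natrM ler_nat leq_trunc_div. Qed.

Lemma block_count_le n : (m n)%:R <= n%:R / (r n)%:R :> R.
Proof. by rewrite ler_pdivlMr ?ltr0n// block_countr_le. Qed.

Lemma block_countr_ge n : n%:R - (r n)%:R <= (m n)%:R * (r n)%:R :> R.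
Proof.
by rewrite lerBlDr -natrM -natrD ler_nat {1}(divn_eq n (r n)) leq_add2l ltnW// ltn_pmod.
Qed.

Lemma block_count_ratio : (m n)%:R * (r n)%:R / n%:R @[n --> \oo] --> (1 : R).
Proof.
apply/cvgrPdist_le => e e0.
have n0 : \forall n \near \oo, (0 < n)%N by exists 1%N.
apply: filterS2 (littleo_ratio (u := r) (v := id) e0 r_n) n0 => n h n0.
have n0' : 0 < n%:R :> R by rewrite ltr0n.
have h1 := block_countr_le n; have h2 := block_countr_ge n.
have q1 : (m n)%:R * (r n)%:R / n%:R <= 1 :> R by rewrite ler_pdivrMr// mul1r.
have q2 : 1 - e <= (m n)%:R * (r n)%:R / n%:R by rewrite ler_pdivlMr// mulrBl mul1r; lra.
by rewrite ger0_norm ?subr_ge0//; lra.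
Qed.

Lemma block_count_oo : (m n)%:R @[n --> \oo] --> (+oo : set_system R).
Proof.
apply/cvgryPge => A; pose e := (`|A| + 1)^-1.
have A1 : 0 < `|A| + 1 by rewrite ltr_wpDl.
have e0 : 0 < e by rewrite invr_gt0.
apply: filterS (littleo_ratio (u := r) (v := id) e0 r_n) => n h.
have rn : 0 < (r n)%:R :> R by rewrite ltr0n.
have h2 : (`|A| + 1) * (r n)%:R <= n%:R by rewrite mulrC -ler_pdivlMr// mulrC.
have h3 := block_countr_ge n.
rewrite (le_trans (ler_norm A))// -(ler_pM2r rn); lra.
Qed.

Lemma rate_of_mixing (be : nat -> \bar R) :
  (be n * (n%:R / (r n)%:R)%:E)%E @[n --> \oo] --> (0%E : \bar R) ->
  exists2 b : nat -> R, \forall n \near \oo, 0 <= b n /\ (be n <= (b n)%:E)%E &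
    (m n)%:R * b n @[n --> \oo] --> (0 : R).
Proof.
move=> /fine_cvgP[finb cb].
have n0 : \forall n \near \oo, (0 < n)%N by exists 1%N.
have fb : \forall n \near \oo, be n \is a fin_num.
  apply: filterS2 finb n0 => n + n0.
  have q0 : 0 < n%:R / (r n)%:R :> R by rewrite divr_gt0// ltr0n.
  by case: (be n) => [//|/=|/=]; rewrite ?gt0_mulye ?gt0_mulNye ?lte_fin.
exists (fun n => `|fine (be n)|).
  by apply: filterS fb => n fn; rewrite normr_ge0 -{1}(fineK fn) lee_fin ler_norm.
have cn : `|fine (be n * (n%:R / (r n)%:R)%:E)| @[n --> \oo] --> (0 : R).
  by rewrite -(normr0 R); exact: cvg_norm.
apply: (@squeeze_cvgr _ _ _ _ (fun=> 0)) cn; last exact: cvg_cst.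
apply: filterS fb => n fn; rewrite mulr_ge0//=.
rewrite -{2}(fineK fn) -EFinM/= normrM mulrC ler_wpM2l//.
by rewrite (le_trans (block_count_le n))// ler_norm.
Qed.

End block_counts.

(** * The normalized functional of one block *)
Section normalized_arrays.
Context {R : realType} {disp : measure_display} {T : measurableType disp}
  (P : probability T R).

Lemma fine_expectation (Y : T -> R) : fine 'E_P[Y] = Ex P Y.
Proof. by rewrite unlock. Qed.

Lemma covariance_Ex (Y Z : T -> R) :
  covariance P Y Z = ('E_P[fun w => ((Y w - fine 'E_P[Y]) * (Z w - fine 'E_P[Z]))%R])%E.
Proof. by rewrite covariance.unlock. Qed.

Lemma elittleo_Ex (Y : nat -> T -> R) (b : nat -> R) (e : R) :
  elittleo (fun n => ('E_P[Y n])%E) b -> 0 < e ->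
  \forall n \near \oo, `|Ex P (Y n)| <= e * `|b n|.
Proof.
move=> h e0; apply: filterS (h e e0) => n.
rewrite -fine_expectation; case: ('E_P[Y n])%E => [x||]//=.
Qed.

Variables (r : nat -> nat) (v : nat -> R).
Hypothesis r_gt0 : forall n, (0 < r n)%N.
Hypothesis r_n : (fun n => (r n)%:R : R) =o_\oo (fun n => n%:R : R).
Hypothesis nv_oo : n%:R * v n @[n --> \oo] --> (+oo : set_system R).
Local Notation m n := (n %/ r n)%N.
Local Notation s n := (Num.sqrt (n%:R * v n)).

Definition centered (Y : nat -> T -> R) n w := Y n w - fine 'E_P[Y n].

Definition normalized (Y : nat -> T -> R) n w := (s n)^-1 * centered Y n w.

Let s_gt0 : \forall n \near \oo, [/\ 0 < s n, s n ^+ 2 = n%:R * v n & 0 < v n].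
Proof.
move/cvgryPgt : nv_oo => /(_ 0); apply: filterS => n h.
rewrite sqrtr_gt0 h sqr_sqrtr ?(ltW h)//; split => //.
by move: h; case: (ltP 0 (v n)) => // v0; rewrite ltNge mulr_ge0_le0.
Qed.

Let indic_if (p : pred T) w : \1_[set w | p w] w = (if p w then 1 else 0) :> R.
Proof. by rewrite indicE; case: ifP => h; [rewrite mem_set|rewrite memNset//= h]. Qed.

Lemma integ_fin (g : T -> R) : measurable_fun setT g -> (forall w, 0 <= g w) ->
  ('E_P[g])%E \is a fin_num -> integ P g.
Proof.
move=> mg g0 fg; apply/integrableP; split; first exact/measurable_EFinP.
under eq_integral do rewrite /= ger0_norm//.
by move: fg; rewrite unlock ge0_fin_numE// integral_ge0// => w _; rewrite lee_fin.
Qed.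

Definition cov_limit (Y Z : nat -> T -> R) (c : R) :=
  ((((r n)%:R * v n)^-1)%:E * covariance P (Y n) (Z n))%E @[n --> \oo] --> c%:E.

Let cov_limit_fine (Y Z : nat -> T -> R) c : cov_limit Y Z c ->
  (\forall n \near \oo, covariance P (Y n) (Z n) \is a fin_num) /\
  ((r n)%:R * v n)^-1 * Ex P (fun w => centered Y n w * centered Z n w) @[n --> \oo] --> c.
Proof.
move=> /fine_cvgP[fc cc].
have a0 : \forall n \near \oo, 0 < ((r n)%:R * v n)^-1.
  by apply: filterS s_gt0 => n [_ _ v0]; rewrite invr_gt0 mulr_gt0 ?ltr0n.
have fcov : \forall n \near \oo, covariance P (Y n) (Z n) \is a fin_num.
  apply: filterS2 fc a0 => n + an.
  by case: (covariance P (Y n) (Z n)) => [//|/=|/=]; rewrite ?gt0_muley ?gt0_muleNy ?lte_fin.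
split => //; apply: cvg_trans cc; apply: near_eq_cvg; apply: filterS fcov => n fn.
by rewrite /= fineM//= covariance_Ex; congr (_ * _); exact: fine_expectation.
Qed.

Let prod_integ (f g : T -> R) : measurable_fun setT f -> measurable_fun setT g ->
  integ P (fun w => f w * f w) -> integ P (fun w => g w * g w) -> integ P (fun w => f w * g w).
Proof.
move=> mf mg if2 ig2; apply: integ_le (integD if2 ig2); first exact: measurable_funM.
move=> w; rewrite [leRHS]ger0_norm; last by rewrite -!expr2 addr_ge0 ?sqr_ge0.
rewrite ler_norml; apply/andP; split.
  by have := sqr_ge0 (f w + g w); have := sqr_ge0 (f w); have := sqr_ge0 (g w); nra.
by have := sqr_ge0 (f w - g w); have := sqr_ge0 (f w); have := sqr_ge0 (g w); nra.
Qed.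

Let mcentered (Y : nat -> T -> R) n : integ P (Y n) -> measurable_fun setT (centered Y n).
Proof. by move=> /integ_meas mY; exact: measurable_funB. Qed.

Let centered_sq (Y : nat -> T -> R) c : (\forall n \near \oo, integ P (Y n)) ->
  cov_limit Y Y c ->
  \forall n \near \oo, measurable_fun setT (centered Y n) /\
    integ P (fun w => centered Y n w * centered Y n w).
Proof.
move=> iY /cov_limit_fine[fc _]; apply: filterS2 iY fc => n iYn.
rewrite covariance_Ex => fc; have mc := mcentered iYn; split => //.
apply: integ_fin fc; first exact: measurable_funM.
by move=> w; rewrite -expr2 sqr_ge0.
Qed.

Lemma normalized_covariance (Y Z : nat -> T -> R) (c cy cz : R) :
  (\forall n \near \oo, integ P (Y n)) -> (\forall n \near \oo, integ P (Z n)) ->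
  cov_limit Y Y cy -> cov_limit Z Z cz -> cov_limit Y Z c ->
  (\forall n \near \oo, integ P (fun w => normalized Y n w * normalized Z n w)) /\
  (m n)%:R * Ex P (fun w => normalized Y n w * normalized Z n w) @[n --> \oo] --> c.
Proof.
move=> iY iZ /(centered_sq iY) sY /(centered_sq iZ) sZ /cov_limit_fine[_ cc].
have E n : (fun w => normalized Y n w * normalized Z n w) =
    (fun w => (s n ^+ 2)^-1 * (centered Y n w * centered Z n w)).
  by apply/funext => w; rewrite /normalized -/(centered Y n w) -/(centered Z n w) -exprVn expr2; ring.
have iP : \forall n \near \oo, integ P (fun w => centered Y n w * centered Z n w).
  by apply: filterS2 sY sZ => n [mY iY'] [mZ iZ']; exact: prod_integ.
split; first by apply: filterS iP => n ip; rewrite E; exact: integZ.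
have cr : (m n)%:R * (r n)%:R / n%:R * (((r n)%:R * v n)^-1 *
    Ex P (fun w => centered Y n w * centered Z n w)) @[n --> \oo] --> c.
  by rewrite -(mul1r c); exact: cvgM (block_count_ratio r_gt0 r_n) cc.
apply: cvg_trans cr; apply: near_eq_cvg.
have n0 : \forall n \near \oo, (0 < n)%N by exists 1%N.
apply: filterS3 iP s_gt0 n0 => n ip [s0 s2 v0] n0 /=.
rewrite E ExZ// s2; field.
by rewrite !gt_eqF ?ltr0n.
Qed.

Lemma normalized_mean (Y : nat -> T -> R) n : integ P (Y n) -> Ex P (normalized Y n) = 0.
Proof.
move=> iY; have i1 := integ_cst P (Ex P (Y n)).
by rewrite /normalized /centered fine_expectation (ExZ _ (integB iY i1)) (ExB iY i1) Ex_cst subrr mulr0.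
Qed.

Let measurable_normalized (Y : nat -> T -> R) n : integ P (Y n) ->
  measurable_fun setT (normalized Y n).
Proof. by move=> iY; apply: measurable_funM => //; exact: mcentered. Qed.

Let rate (e : R) n : 0 <= e -> (m n)%:R * (e * (r n)%:R) <= e * n%:R.
Proof. by move=> e0; rewrite mulrCA ler_wpM2l// block_countr_le. Qed.

Variables (Y D : nat -> T -> R) (cy : R).
Hypothesis iY : \forall n \near \oo, integ P (Y n).
Hypothesis iD : \forall n \near \oo, integ P (D n).
Hypothesis cY : cov_limit Y Y cy.
Hypothesis lindeberg : forall e, 0 < e -> elittleo
  (fun n => ('E_P[fun w => (centered Y n w ^+ 2 * \1_[set w | (e * s n < `|centered Y n w|)%R] w)%R])%E)
  (fun n => (r n)%:R * v n).
Hypothesis D_var : elittleo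
  (fun n => ('E_P[fun w => (centered D n w ^+ 2 * \1_[set w | (`|centered D n w| <= s n)%R] w)%R])%E)
  (fun n => (r n)%:R * v n).
Hypothesis D_mean : elittleo
  (fun n => ('E_P[fun w => (centered D n w * \1_[set w | (s n < `|centered D n w|)%R] w)%R])%E)
  (fun n => (r n)%:R * Num.sqrt (v n / n%:R)).
Hypothesis D_tail : elittleo (fun n => P [set w | s n < `|centered D n w|])
  (fun n => (r n)%:R / n%:R).

Let norm_scale n (x : R) : 0 < s n -> `|(s n)^-1 * x| = `|x| / s n.
Proof. by move=> s0; rewrite normrM gtr0_norm ?invr_gt0// mulrC. Qed.

Let rvE n : 0 < v n -> `|(r n)%:R * v n| = (r n)%:R * v n.
Proof. by move=> v0; rewrite ger0_norm// mulr_ge0// ltW. Qed.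

Let negl_ge0 (h : nat -> T -> R) : (forall n w, 0 <= h n w) ->
  (\forall n \near \oo, integ P (h n)) ->
  (forall d, 0 < d -> \forall n \near \oo, `|(m n)%:R * Ex P (h n)| <= d) ->
  negl P (fun n => m n) h.
Proof.
move=> h0 ih hd; split => //; apply/cvgr0Pnorm_le => d /hd; apply: filterS => n.
by congr (`|_ * Ex P _| <= _); apply/funext => w; rewrite ger0_norm.
Qed.

(** [m / s^2 * (r v) = m r / n <= 1]. *)
Let scaled_bound (n : nat) (x d : R) : 0 < d -> 0 < s n -> s n ^+ 2 = n%:R * v n -> 0 < v n ->
  `|x| <= d * `|(r n)%:R * v n| -> `|(m n)%:R * ((s n ^+ 2)^-1 * x)| <= d.
Proof.
move=> d0 s0 s2 v0; rewrite rvE// => h.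
have q0 : 0 < s n ^+ 2 by exact: exprn_gt0.
rewrite s2 in q0 *; rewrite normrM ger0_norm// normrM gtr0_norm ?invr_gt0//.
rewrite mulrCA mulrC ler_pdivrMr//.
apply: (le_trans (ler_wpM2l (ler0n _ _) h)).
rewrite !mulrA ler_wpM2r ?(ltW v0)// -mulrA.
by apply: rate; exact: ltW.
Qed.

Let negl_lind e : 0 < e -> negl P (fun n => m n) (fun n w => large e (normalized Y n w)).
Proof.
move=> e0.
have [iN _] := normalized_covariance iY iY cY cY cY.
have iL : \forall n \near \oo, integ P (fun w => large e (normalized Y n w)).
  apply: filterS2 iY iN => n iYn; apply: integ_le.
    by apply: measurable_large; exact: measurable_normalized.
  move=> w; rewrite !ger0_norm ?large_ge0 -?expr2 ?sqr_ge0// /large.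
  by case: ifP => // _; exact: sqr_ge0.
apply: (negl_ge0 _ iL) => [n w|d d0]; first exact: large_ge0.
apply: filterS3 (elittleo_Ex (lindeberg e0) d0) s_gt0 (filterI iL (centered_sq iY cY)).
move=> n h [s0 s2 v0] [iLn [mc ic]].
pose g w := centered Y n w ^+ 2 * \1_[set w | e * s n < `|centered Y n w|] w.
have E : (fun w => large e (normalized Y n w)) = (fun w => (s n ^+ 2)^-1 * g w).
  apply/funext => w; rewrite /g indic_if /large norm_scale// ltr_pdivlMr//.
  by case: ifP; rewrite ?mulr1 ?mulr0// exprMn exprVn.
have ig : integ P g.
  have -> : g = (fun w => s n ^+ 2 * large e (normalized Y n w)).
    by apply/funext => w; have /= -> := congr1 (@^~ w) E; rewrite mulVKf// sqrf_eq0 gt_eqF.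
  exact: integZ.
by rewrite E ExZ//; exact: scaled_bound h.
Qed.

Let mD n : integ P (D n) -> measurable_fun setT (normalized D n).
Proof. exact: measurable_normalized. Qed.

(** [min (x^2, 1)] is [x^2] on [|x| <= 1] and 1 elsewhere: the truncated variance
    and the tail of the first condition. *)
Let negl_sqmin : negl P (fun n => m n) (fun n w => sqmin (normalized D n w)).
Proof.
apply: negl_ge0 => [n w||d d0]; first exact: sqmin_ge0.
  apply: filterS iD => n iDn; apply: integ_le (integ_cst P 1).
    by apply: measurable_sqmin; exact: mD.
  by move=> w; rewrite normr1 ger0_norm ?sqmin_ge0 ?sqmin_le1.
have d2 : 0 < d / 2 by rewrite divr_gt0.
have n0 : \forall n \near \oo, (0 < n)%N by exists 1%N.
apply: filterS3 (elittleo_Ex D_var d2) (filterI s_gt0 n0) (filterI (D_tail d2) iD).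
move=> n h1 [[s0 s2 v0] n1] [h2 iDn].
have mc := mcentered iDn.
have mA := measurable_gt_set (s n) mc.
pose g w := centered D n w ^+ 2 * \1_[set w | `|centered D n w| <= s n] w.
have E : (fun w => sqmin (normalized D n w)) =
    (fun w => (s n ^+ 2)^-1 * g w + \1_[set w | s n < `|centered D n w|] w).
  apply/funext => w; rewrite /g !indic_if.
  have -> : normalized D n w = (s n)^-1 * centered D n w by [].
  set x := centered D n w; have x2 : ((s n)^-1 * x) ^+ 2 = (s n ^+ 2)^-1 * `|x| ^+ 2.
    by rewrite exprMn exprVn real_normK ?num_real.
  rewrite /sqmin x2 [x ^+ 2](_ : _ = `|x| ^+ 2); last by rewrite real_normK ?num_real.
  have [xs|xs] := leP `|x| (s n).
    rewrite mulr1 addr0; apply/min_idPl.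
    by rewrite mulrC ler_pdivrMr ?exprn_gt0// mul1r ler_sqr ?nnegrE ?(ltW s0).
  rewrite !mulr0 add0r; apply/min_idPr.
  by rewrite mulrC ler_pdivlMr ?exprn_gt0// mul1r ler_sqr ?nnegrE ?(ltW s0)// ltW.
have mA' : measurable [set w | `|centered D n w| <= s n].
  rewrite (_ : mkset _ = ~` [set w | s n < `|centered D n w|]); first exact: measurableC.
  by apply/seteqP; split => w /=; rewrite leNgt => /negP.
have ig : integ P g.
  apply: integ_le (integ_cst P (s n ^+ 2)).
    apply: measurable_funM; first exact: measurable_funX.
    exact: (bddmeas_indic mA').1.
  move=> w; rewrite /g indic_if; case: ifPn => xs; last by rewrite mulr0 normr0.
  by rewrite mulr1 !ger0_norm ?sqr_ge0// -(@real_normK _ (centered D n w)) ?num_real// ler_sqr ?nnegrE ?(ltW s0).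
have bA : bddmeas (\1_[set w | s n < `|centered D n w|] : T -> R) by exact: bddmeas_indic.
rewrite E (ExD (integZ _ ig) (bddmeas_integ P bA)) ExZ// Ex_indic// mulrDr.
rewrite (le_trans (ler_normD _ _))// [leRHS](splitr d) lerD//; first exact: scaled_bound h1.
have rn0 : 0 <= (r n)%:R / n%:R :> R by rewrite divr_ge0.
move: h2; rewrite (ger0_norm rn0) -[P _]fineK ?fin_num_measure// lee_fin => h2.
rewrite normrM [X in X * _]ger0_norm// (le_trans (ler_wpM2l (ler0n _ _) h2))//.
have nn : 0 < n%:R :> R by rewrite ltr0n.
rewrite [leLHS](_ : _ = (m n)%:R * (d / 2 * (r n)%:R) / n%:R); last by field; rewrite gt_eqF.
by rewrite ler_pdivrMr//; apply: rate; exact: ltW.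
Qed.

(** As [D] is centered, its mean over small values is minus its mean over
    large ones, which is controlled; replacing the identity by [sin] on the
    small values, and adding the large ones, costs at most [sqmin]. *)
Let sin_limit : (m n)%:R * Ex P (fun w => sin (normalized D n w)) @[n --> \oo] --> (0 : R).
Proof.
pose big n w := normalized D n w * \1_[set w | s n < `|centered D n w|] w.
have bigE n w : big n w = (s n)^-1 * (centered D n w * \1_[set w | s n < `|centered D n w|] w).
  by rewrite /big mulrA.
have ic : \forall n \near \oo, integ P (centered D n).
  by apply: filterS iD => n i; apply: integB => //; exact: integ_cst.
have ict : \forall n \near \oo,
    integ P (fun w => centered D n w * \1_[set w | s n < `|centered D n w|] w).
  apply: filterS2 iD ic => n i j; apply: integ_le j.
    apply: measurable_funM; first exact: mcentered.
    by apply: (bddmeas_indic _).1; apply: measurable_gt_set; exact: mcentered.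
  move=> w; rewrite normrM indic_if; case: ifP => _; first by rewrite normr1 mulr1.
  by rewrite normr0 mulr0.
have iN : \forall n \near \oo, integ P (normalized D n).
  by apply: filterS ic => n; exact: integZ.
have ib : \forall n \near \oo, integ P (big n).
  by apply: filterS ict => n /(integZ (s n)^-1); under eq_fun do rewrite -bigE.
have isn : \forall n \near \oo, integ P (fun w => sin (normalized D n w)).
  by apply: filterS iD => n i; apply: bddmeas_integ; apply: bddmeas_sin; exact: mD.
apply: (mE_cvg (g := fun n w => normalized D n w - big n w)) => //.
- by apply: filterS2 iN ib => n; exact: integB.
- apply: negl_le negl_sqmin.
    apply: filterS3 isn iN ib => n i1 i2 i3.
    exact: integ_meas (integB i1 (integB i2 i3)).
  apply: filterS s_gt0 => n [s0 _ _] w; rewrite /big indic_if -/(normalized D n w).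
  have -> : (s n < `|centered D n w|) = (1 < `|normalized D n w|).
    by rewrite /normalized norm_scale// ltr_pdivlMr// mul1r.
  set x := normalized D n w; case: ifPn => [x1|].
    rewrite mulr1 subrr subr0 /sqmin (min_idPr _) ?sin_max//.
    by rewrite -(@real_normK _ x) ?num_real// exprn_ege1// ltW.
  rewrite -leNgt => x1; rewrite mulr0 subr0.
  have x2 : x ^+ 2 <= 1 by rewrite -(@real_normK _ x) ?num_real// exprn_ile1.
  rewrite /sqmin (min_idPl x2) (le_trans (sin_id_bound x))//.
  rewrite -[leRHS](@real_normK _ x) ?num_real//.
  by move: (`|x|) x1 (normr_ge0 x) => y ? ?; have := sqr_ge0 y; nra.
- apply/cvgr0Pnorm_le => d d0.
  have n0 : \forall n \near \oo, (0 < n)%N by exists 1%N.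
  apply: filterS3 (elittleo_Ex D_mean d0) (filterI s_gt0 n0) (filterI iD (filterI (filterI iN ib) ict)).
  move=> n h [[s0 s2 v0] n1] [i1 [[i2 i3] i4]].
  rewrite ExB// normalized_mean// sub0r.
  have -> : Ex P (big n) = (s n)^-1 * Ex P (fun w => centered D n w * \1_[set w | s n < `|centered D n w|] w).
    by rewrite -ExZ//; congr (Ex P); apply/funext => w; rewrite bigE.
  have nn : 0 < n%:R :> R by rewrite ltr0n.
  have sv : Num.sqrt (v n / n%:R) = s n / n%:R.
    rewrite (_ : v n / n%:R = (s n / n%:R) ^+ 2); last first.
      by rewrite exprMn s2 exprVn; field; rewrite gt_eqF.
    by rewrite sqrtr_sqr ger0_norm// divr_ge0// ltW.
  rewrite mulrN normrN normrM [X in X * _]ger0_norm// normrM gtr0_norm ?invr_gt0//.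
  rewrite sv in h; have p0 : 0 <= (r n)%:R * (s n / n%:R) by rewrite !mulr_ge0 ?invr_ge0 ?(ltW s0).
  rewrite (ger0_norm p0) in h.
  rewrite mulrCA mulrC ler_pdivrMr// (le_trans (ler_wpM2l (ler0n _ _) h))//.
  rewrite [leLHS](_ : _ = ((m n)%:R * (d * (r n)%:R)) / n%:R * s n); last by field; rewrite gt_eqF.
  rewrite ler_wpM2r ?(ltW s0)// ler_pdivrMr//; apply: rate; exact: ltW.
Qed.

Lemma normalized_lindeberg_pair : lindeberg_pair P (fun n => m n) (normalized Y) (normalized D).
Proof.
have [iN cN] := normalized_covariance iY iY cY cY cY.
split.
- split.
    apply: filterS2 iY iN => n iYn iNn; split; first exact: measurable_normalized.
    by under eq_fun do rewrite expr2.
  exists (cy + 1); have := ltrDl cy 1; rewrite ltr01 => h.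
  move/(cvgr_lt _ cN) : h; apply: filterS => n h.
  by under eq_fun do rewrite expr2; exact: ltW.
- by move=> e e0; exact: negl_lind.
- by apply: filterS iY => n; exact: normalized_mean.
- by apply: filterS iD => n; exact: mD.
- exact: negl_sqmin.
- exact: sin_limit.
Qed.

End normalized_arrays.

(** * Characteristic functions and tightness of the empirical process *)
Lemma cvg_sum (R : realType) (U : set_system nat) (FU : Filter U) (I : Type) (s : seq I)
  (u : I -> nat -> R) (a : I -> R) : (forall i, u i n @[n --> U] --> a i) ->
  \sum_(i <- s) u i n @[n --> U] --> \sum_(i <- s) a i.
Proof.
move=> ua; elim: s => [|i s ih].
  by under eq_fun do rewrite big_nil; rewrite big_nil; exact: cvg_cst.
by under eq_fun do rewrite big_cons; rewrite big_cons; exact: cvgD.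
Qed.

Section cluster_sums.
Context {R : realType} {d : nat} (E : set (d.-tuple R)) (mE : measurable E).
Context {disp : measure_display} {T : measurableType disp} (P : probability T R).
Variable X : nat -> nat -> T -> d.-tuple R.
Hypothesis mX : forall n i, (1 <= i <= n)%N -> measurable_fun setT (X n i).
Hypothesis XE : forall n i w, (1 <= i <= n)%N -> E (X n i w).
Hypothesis Xstat : rowwise_stationary P X.
Variables (r l : nat -> nat).
Hypothesis r_gt0 : forall n, (0 < r n)%N.
Hypothesis l_r : (fun n => (l n)%:R : R) =o_\oo (fun n => (r n)%:R : R).
Hypothesis r_n : (fun n => (r n)%:R : R) =o_\oo (fun n => n%:R : R).
Hypothesis nv_oo : n%:R * vprob P X n @[n --> \oo] --> (+oo : set_system R).
Hypothesis mixing : (beta_mixing P X n (l n) * (n%:R / (r n)%:R)%:E)%E @[n --> \oo]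
  --> (0%E : \bar R).
Local Notation m n := (n %/ r n)%N.
Local Notation v := (vprob P X).
Local Notation s n := (Num.sqrt (n%:R * v n)).
Variable F : set (seq (d.-tuple R) -> R).
Hypothesis F_meas : forall f k, F f -> seq_measurable E k f.
Let Y (f : seq (d.-tuple R) -> R) n w := f (block X r n 1 w).
Let D (f : seq (d.-tuple R) -> R) n := Delta X r l n f.
Hypothesis F_int : forall f n, F f -> (l n < r n <= n)%N -> integ P (Y f n) /\ integ P (D f n).
Hypothesis F_Dvar : forall f, F f -> elittleo
  (fun n => ('E_P[fun w => (centered P (D f) n w ^+ 2 *
     \1_[set w | (`|centered P (D f) n w| <= s n)%R] w)%R])%E)
  (fun n => (r n)%:R * v n).
Hypothesis F_Dmean : forall f, F f -> elittleo
  (fun n => ('E_P[fun w => (centered P (D f) n w *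
     \1_[set w | (s n < `|centered P (D f) n w|)%R] w)%R])%E)
  (fun n => (r n)%:R * Num.sqrt (v n / n%:R)).
Hypothesis F_Dtail : forall f, F f -> elittleo
  (fun n => P [set w | s n < `|centered P (D f) n w|]) (fun n => (r n)%:R / n%:R).
Hypothesis F_lindeberg : forall (e : R) f, 0 < e -> F f -> elittleo
  (fun n => ('E_P[fun w => (centered P (Y f) n w ^+ 2 *
     \1_[set w | (e * s n < `|centered P (Y f) n w|)%R] w)%R])%E)
  (fun n => (r n)%:R * v n).
Variable c : (seq (d.-tuple R) -> R) -> (seq (d.-tuple R) -> R) -> R.
Hypothesis F_cov : forall f g, F f -> F g -> cov_limit P r v (Y f) (Y g) (c f g).

Let lr : \forall n \near \oo, (l n < r n)%N.
Proof. exact: littleo_lt l_r. Qed.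

Let rn : \forall n \near \oo, (r n <= n)%N.
Proof. exact: r_le_n r_n. Qed.

Let iY f : F f -> \forall n \near \oo, integ P (Y f n).
Proof. by move=> Ff; apply: filterS2 lr rn => n h1 h2; apply: (F_int Ff _).1; rewrite h1. Qed.

Let iD f : F f -> \forall n \near \oo, integ P (D f n).
Proof. by move=> Ff; apply: filterS2 lr rn => n h1 h2; apply: (F_int Ff _).2; rewrite h1. Qed.

Let normalized_pair f : F f -> lindeberg_pair P (fun n => m n) (normalized P v (Y f)) (normalized P v (D f)).
Proof.
move=> Ff; apply: (normalized_lindeberg_pair r_gt0 r_n nv_oo (iY Ff) (iD Ff) (F_cov Ff Ff)).
- by move=> e e0; exact: F_lindeberg.
- exact: F_Dvar.
- exact: F_Dmean.
- exact: F_Dtail.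
Qed.

Let fit n i : (i < m n)%N -> (1 + i * r n + r n <= n.+1)%N.
Proof.
move=> im; rewrite -addnA add1n ltnS -mulSnr.
by rewrite (leq_trans _ (leq_trunc_div n (r n)))// leq_mul2r im orbT.
Qed.

Lemma Zproc_windows n f w : F f -> Zproc P X r n f w =
  \sum_(i < m n) (s n)^-1 * (f (window X n (1 + i * r n) (r n) w) - fine 'E_P[Y f n]).
Proof.
move=> Ff; rewrite /Zproc -mulr_sumr; congr (_ * _).
rewrite big_add1 big_mkord; apply: eq_bigr => i _.
have bE w' : block X r n i.+1 w' = window X n (1 + i * r n) (r n) w'.
  by rewrite /block /window subn1/= addn1.
rewrite bE; congr (_ - _); rewrite !fine_expectation.
under eq_fun do rewrite bE.
by apply: (Ex_window mE mX XE Xstat (chi := id)) => //; [exact: fit|exact: F_meas].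
Qed.

Lemma measurable_Zproc n f : F f -> measurable_fun setT (Zproc P X r n f).
Proof.
move=> Ff; rewrite (funext (fun w => Zproc_windows n w Ff)).
apply: measurable_sum => i; apply: measurable_funM => //; apply: measurable_funB => //.
by apply: (measurable_window mE) => //; [exact: fit|exact: F_meas].
Qed.

Variables (k : nat) (t : 'I_k -> seq (d.-tuple R) -> R) (a : 'I_k -> R).
Hypothesis tF : forall j, F (t j).

Let K n w := \sum_(j < k) a j * normalized P v (Y (t j)) n w.
Let De n w := \sum_(j < k) a j * normalized P v (D (t j)) n w.

Let gKD : lindeberg_pair P (fun n => m n) K De.
Proof. by apply: lindeberg_pair_lin_comb => j; exact: normalized_pair. Qed.

Definition limit_variance := \sum_(i < k) \sum_(j < k) a i * a j * c (t i) (t j).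

Let cK : (m n)%:R * Ex P (fun w => K n w ^+ 2) @[n --> \oo] --> limit_variance.
Proof.
pose p i j n := Ex P (fun w => normalized P v (Y (t i)) n w * normalized P v (Y (t j)) n w).
have cp i j : (m n)%:R * p i j n @[n --> \oo] --> c (t i) (t j).
  exact: (normalized_covariance r_gt0 r_n nv_oo (iY (tF i)) (iY (tF j)) (F_cov (tF i) (tF i)) (F_cov (tF j) (tF j)) (F_cov (tF i) (tF j))).2.
have ip i j : \forall n \near \oo, integ P (fun w => normalized P v (Y (t i)) n w * normalized P v (Y (t j)) n w).
  exact: (normalized_covariance r_gt0 r_n nv_oo (iY (tF i)) (iY (tF j)) (F_cov (tF i) (tF i)) (F_cov (tF j) (tF j)) (F_cov (tF i) (tF j))).1.
have c1 : \sum_(i < k) \sum_(j < k) a i * a j * ((m n)%:R * p i j n) @[n --> \oo] --> limit_variance.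
  apply: cvg_sum => i; apply: cvg_sum => j.
  by apply: cvgM; [exact: cvg_cst|exact: cp].
apply: cvg_trans c1; apply: near_eq_cvg.
have ip' : \forall n \near \oo, forall i j, integ P (fun w => normalized P v (Y (t i)) n w * normalized P v (Y (t j)) n w).
  by apply: filter_forall => i; apply: filter_forall => j.
apply: filterS ip' => n ipn /=.
have -> : (fun w => K n w ^+ 2) = (fun w => \sum_(i < k) \sum_(j < k)
    (a i * a j) * (normalized P v (Y (t i)) n w * normalized P v (Y (t j)) n w)).
  apply/funext => w; rewrite /K expr2 big_distrl/=; apply: eq_bigr => i _.
  by rewrite big_distrr/=; apply: eq_bigr => j _; ring.
rewrite Ex_sum; last by move=> i; apply: integ_sum => j; exact: integZ.
rewrite mulr_sumr; apply: eq_bigr => i _.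
rewrite Ex_sum; last by move=> j; exact: integZ.
rewrite mulr_sumr; apply: eq_bigr => j _.
by rewrite ExZ// mulrCA.
Qed.

(** The summand as a function of the truncated block.  The constant is chosen so
    that its value is [xi - de]. *)
Let hz n x := \sum_(j < k) a j * ((s n)^-1 * (t j x - (fine 'E_P[Y (t j) n] - fine 'E_P[D (t j) n]))).

Let hd n x := \sum_(j < k) a j * ((s n)^-1 * (t j x - t j (take (r n - l n) x) - fine 'E_P[D (t j) n])).

Let mhz n : (l n < r n)%N -> seq_measurable E (r n - l n) (hz n).
Proof.
move=> _; apply: measurable_sum => j; apply: measurable_funM => //.
by apply: measurable_funM => //; apply: measurable_funB => //; exact: F_meas.
Qed.

Let mhd n : seq_measurable E (r n) (hd n).
Proof.
apply: measurable_sum => j; apply: measurable_funM => //; apply: measurable_funM => //.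
apply: measurable_funB => //; apply: measurable_funB; first exact: F_meas.
by apply: (seq_measurable_take mE) => [|q]; [exact: leq_subr|exact: F_meas].
Qed.

Let hdE n w : hd n (window X n 1 (r n) w) = De n w.
Proof. by []. Qed.

Let hzE n w : hz n (window X n 1 (r n - l n) w) = K n w - De n w.
Proof.
rewrite /K /De -sumrB; apply: eq_bigr => j _.
rewrite /normalized /centered /Y /D /Delta -/(window X n 1 (r n) w) take_window ?leq_subr//.
by ring.
Qed.

Let sumE n w : \sum_(j < k) a j * Zproc P X r n (t j) w =
  \sum_(i < m n) hz n (window X n (1 + i * r n) (r n - l n) w) +
  \sum_(i < m n) hd n (window X n (1 + i * r n) (r n) w).
Proof.
rewrite -big_split/=.
under eq_bigr do rewrite Zproc_windows// mulr_sumr.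
rewrite exchange_big/=; apply: eq_bigr => i _.
rewrite -big_split/=; apply: eq_bigr => j _.
by rewrite take_window ?leq_subr//; ring.
Qed.

Lemma Zproc_charfun th :
  Ex P (fun w => cos (\sum_(j < k) a j * Zproc P X r n (t j) w + th)) @[n --> \oo]
    --> expR (- (limit_variance / 2)) * cos th.
Proof.
have [b bb mb] := rate_of_mixing r_gt0 mixing.
under eq_fun do under eq_fun do rewrite sumE.
exact: (block_sum_charfun mE mX XE Xstat r_gt0 lr bb mb (block_count_oo r_gt0 r_n) mhz mhd hzE hdE gKD cK).
Qed.

Lemma Zproc_tight e : 0 < e -> exists L : R, \forall n \near \oo,
  Ex P (\1_[set w | L < `|\sum_(j < k) a j * Zproc P X r n (t j) w|]) <= e.
Proof.
have [b bb mb] := rate_of_mixing r_gt0 mixing.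
move=> e0; have [L h] := block_sum_tight mE mX XE Xstat r_gt0 lr bb mb
  mhz mhd hzE hdE gKD cK e0.
exists L; apply: filterS h => n hn.
rewrite (_ : [set w | L < `|\sum_(j < k) a j * Zproc P X r n (t j) w|] =
  [set w | L < `|\sum_(i < m n) hz n (window X n (1 + i * r n) (r n - l n) w) +
    \sum_(i < m n) hd n (window X n (1 + i * r n) (r n) w)|])//.
by apply/funext => w /=; rewrite sumE.
Qed.

End cluster_sums.

(** * The Gaussian limit process *)
Section gaussian_criterion.
Context {R : realType} {disp : measure_display} {T : measurableType disp}
  (Q : probability T R).
Variables (W : T -> R) (V : R).
Hypothesis mW : measurable_fun setT W.
Hypothesis charW : forall u th, Ex Q (fun w => cos (u * W w + th)) =
  expR (- (u ^+ 2 * V / 2)) * cos th.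

Lemma charfun_variance_ge0 : 0 <= V.
Proof.
have h : expR (- (1 ^+ 2 * V / 2)) * cos 0 <= 1.
  rewrite -charW (le_trans (ler_norm _))//.
  apply: Ex_bound => [|w]; last exact: cos_max.
  apply: bddmeas_integ; apply: bddmeas_cos; apply: measurable_fun_add_cst.
  exact: measurable_funM.
move: h; rewrite cos0 mulr1 expr1n mul1r -expR0 ler_expR oppr_le0.
by rewrite pmulr_lge0// invr_gt0.
Qed.

Lemma moments_transfer (mu : probability (measurableTypeR R) R) :
  (forall B, measurable B -> Q (W @^-1` B) = mu B) ->
  integ mu (fun x => x ^+ 2) -> integ mu (fun x => x) ->
  [/\ integ Q (fun w => W w ^+ 2), Ex Q (fun w => W w ^+ 2) = Ex mu (fun x => x ^+ 2)
    & Ex Q W = Ex mu (fun x => x)].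
Proof.
move=> law i2 i1.
have mW' : measurable_fun setT (W : T -> measurableTypeR R) := mW.
have eqm (f : measurableTypeR R -> \bar R) :
    (\int[pushforward Q (W : T -> measurableTypeR R)]_y f y = \int[mu]_y f y)%E.
  by apply: eq_measure_integral => A mA _; exact: law.
have tr (f : R -> R) : measurable_fun setT f -> integ mu f ->
    integ Q (fun w => f (W w)) /\ Ex Q (fun w => f (W w)) = Ex mu f.
  move=> mf imf.
  have mfE : measurable_fun [set: measurableTypeR R] (EFin \o f) by exact/measurable_EFinP.
  have iQ : integ Q (fun w => f (W w)).
    apply/integrableP; split; first by apply/measurable_EFinP; exact: measurableT_comp.
    move/integrableP : imf => [_]; congr (_ < _)%E; rewrite -eqm.
    rewrite (ge0_integral_pushforward mW' Q measurableT) ?preimage_setT//.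
    exact: measurableT_comp.
  split => //; rewrite /Ex /Rintegral -eqm; congr fine.
  rewrite (integral_pushforward mW' (mu := Q) mfE) ?preimage_setT//.
have [j2 e2] := tr (fun x => x ^+ 2) (exprn_measurable 2) i2.
by have [_ e1] := tr _ (@measurable_id _ _ setT) i1; split.
Qed.

(** The law is identified by its characteristic function.  A vanishing variance
    has to be separated, as it gives a Dirac mass. *)
Lemma gaussian_of_charfun : gaussian_rv Q W /\
  [/\ integ Q (fun w => W w ^+ 2), Ex Q (fun w => W w ^+ 2) = V & Ex Q W = 0].
Proof.
have V0 := charfun_variance_ge0; pose s := Num.sqrt V.
have s2 : s ^+ 2 = V by rewrite sqr_sqrtr.
have [s0|sn0] := eqVneq s 0.
  have m2 : measurable_fun setT (fun x : R => x ^+ 2) by exact: exprn_measurable.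
  have m1 : measurable_fun setT (fun x : R => x) by exact: measurable_id.
  have V00 : V = 0 by rewrite -s2 s0 expr0n.
  have dE (f : R -> R) : measurable_fun setT f -> Ex (\d_(0 : measurableTypeR R)) f = f 0.
    move=> mf; rewrite /Ex /Rintegral integral_dirac ?diracT ?mul1e//.
    exact/measurable_EFinP.
  have di (f : R -> R) : measurable_fun setT f -> integ (\d_(0 : measurableTypeR R)) f.
    move=> mf; apply/integrableP; split; first exact/measurable_EFinP.
    rewrite integral_dirac ?diracT ?mul1e ?ltry//.
    by apply: measurableT_comp => //; exact/measurable_EFinP.
  have law (B : set (measurableTypeR R)) : measurable B -> Q (W @^-1` B) = \d_(0 : measurableTypeR R) B.
    apply: law_unique => // u th.
    rewrite charW V00 mulr0 mul0r oppr0 expR0 mul1r dE ?mulr0 ?add0r//.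
    apply: (bddmeas_cos (T := measurableTypeR R) _).1.
    by apply: measurable_fun_add_cst; exact: measurable_funM.
  have [] := moments_transfer law (di _ m2) (di _ m1).
  rewrite !dE ?expr0n//.
  move=> i2 e2 e1; rewrite V00; split => //; split => //.
  by exists 0, 0; split => // B mB; rewrite eqxx law.
have s_gt0 : 0 < s by rewrite lt0r sn0 sqrtr_ge0.
have law (B : set (measurableTypeR R)) : measurable B -> Q (W @^-1` B) = normal_prob 0 s B.
  by apply: law_unique => // u th; rewrite charW normal_charfun// s2.
have [] := moments_transfer law (integ_normal_sq s_gt0) (integ_normal_id s_gt0).
rewrite Ex_normal_sq// Ex_normal_id// s2 => i2 e2 e1; split => //; split => //.
by exists 0, s; split; [exact: ltW|move=> B mB; rewrite (negbTE sn0) law].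
Qed.

End gaussian_criterion.

Section gaussian_limit.
Context {R : realType} {disp : measure_display} {T : measurableType disp}
  (P : probability T R) (I : Type) (F : set I) (Zn : nat -> I -> T -> R).
Variable c : I -> I -> R.
Hypothesis mZn : forall n i, F i -> measurable_fun setT (Zn n i).
Hypothesis c_sym : forall i j, F i -> F j -> c i j = c j i.
Let var (k : nat) (t : 'I_k -> I) (a : 'I_k -> R) :=
  \sum_(i < k) \sum_(j < k) a i * a j * c (t i) (t j).
Hypothesis charfun_cvg : forall (k : nat) (t : 'I_k -> I) (a : 'I_k -> R) th,
  (forall j, F (t j)) ->
  Ex P (fun w => cos (\sum_(j < k) a j * Zn n (t j) w + th)) @[n --> \oo] -->
    expR (- (var t a / 2)) * cos th.
Hypothesis tight : forall i, F i -> forall e, 0 < e -> exists L : R,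
  \forall n \near \oo, Ex P (\1_[set w | L < `|Zn n i w|]) <= e.

Context (U : set_system nat) (FU : UltraFilter U) (Uoo : \oo `<=` U).
Local Notation LT := (g_sigma_algebraType (@measurable _ (loeb FU Uoo T))).
Local Notation Q := (@loeb_prob R U FU Uoo disp T P).

Let Z (i : I) : LT -> R := stdpart (fun n => Zn n i).

Let mZ i : F i -> measurable_fun setT (Z i).
Proof. by move=> Fi; apply: measurable_stdpart => n; exact: mZn. Qed.

Let near_U (p : nat -> Prop) : (\forall n \near \oo, p n) -> \forall n \near U, p n.
Proof. exact: Uoo. Qed.

Let cvg_U (u : nat -> R) (x : R) : u n @[n --> \oo] --> x -> u n @[n --> U] --> x.
Proof. by move=> ux B /ux; exact: Uoo. Qed.

Let ae_filter : Filter (nbhs (almost_everywhere Q)).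
Proof. exact: ae_filter_ringOfSetsType. Qed.

Let Z_cvg k (t : 'I_k -> I) : (forall j, F (t j)) ->
  {ae Q, forall w, forall j, Zn n (t j) (w n) @[n --> U] --> Z (t j) w}.
Proof.
move=> Ft; apply: filter_forall => j.
have h : {ae Q, forall w, stdpart_dom (fun n => Zn n (t j)) (w : LT)}.
  apply: stdpart_dom_ae => [n|e e0]; first exact: mZn.
  by have [L hL] := tight (Ft j) e0; exists L; exact: near_U.
by apply: filterS h => w; exact: stdpart_cvg.
Qed.

(** Bounded internal functions integrate to the limit of their expectations;
    here the pointwise limit is known almost everywhere only. *)
Let Ex_limit (h : nat -> T -> R) (g : LT -> R) (M : R) :
  (forall n, measurable_fun setT (h n)) -> (forall n w, `|h n w| <= M) ->
  measurable_fun setT g -> {ae Q, forall w, h n (w n) @[n --> U] --> g w} ->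
  Ex Q g = ulim U (fun n => Ex P (h n)).
Proof.
move=> mh hM mg hg; rewrite -(Ex_stdpart FU Uoo P mh hM).
rewrite /Ex /Rintegral; congr fine; apply: ae_eq_integral => //.
- exact/measurable_EFinP.
- by apply/measurable_EFinP; exact: measurable_stdpart.
- apply: (@filterS _ _ ae_filter _ _ _ hg) => w hw _; congr EFin.
  have c1 := stdpart_cvg (stdpart_bdd w hM).
  by rewrite -(ulimE hw) (ulimE c1).
Qed.

Let charfun_Z k (t : 'I_k -> I) (a : 'I_k -> R) th : (forall j, F (t j)) ->
  Ex Q (fun w => cos (\sum_(j < k) a j * Z (t j) w + th)) = expR (- (var t a / 2)) * cos th.
Proof.
move=> Ft.
have mS n : measurable_fun setT (fun w => \sum_(j < k) a j * Zn n (t j) w).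
  by apply: measurable_sum => j; apply: measurable_funM => //; exact: mZn.
have mSZ : measurable_fun setT (fun w => \sum_(j < k) a j * Z (t j) w).
  by apply: measurable_sum => j; apply: measurable_funM => //; exact: mZ.
rewrite (Ex_limit (h := fun n w => cos (\sum_(j < k) a j * Zn n (t j) w + th)) (M := 1)).
- by apply: ulimE; apply: cvg_U; exact: charfun_cvg.
- by move=> n; apply: (bddmeas_cos _).1; exact: measurable_fun_add_cst.
- by move=> n w; exact: cos_max.
- by apply: (bddmeas_cos _).1; exact: measurable_fun_add_cst.
- apply: (@filterS _ _ ae_filter _ _ _ (Z_cvg Ft)) => w hw.
  apply: (@cvg_comp _ _ _ (fun n => \sum_(j < k) a j * Zn n (t j) (w n) + th) cos _
    (nbhs (\sum_(j < k) a j * Z (t j) w + th))); last exact: continuous_cos.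
  apply: cvgD; last exact: cvg_cst.
  by apply: cvg_sum => j; apply: cvgM => //; exact: cvg_cst.
Qed.

Let comb_gaussian k (t : 'I_k -> I) (a : 'I_k -> R) : (forall j, F (t j)) ->
  gaussian_rv Q (fun w => \sum_(j < k) a j * Z (t j) w) /\
  [/\ integ Q (fun w => (\sum_(j < k) a j * Z (t j) w) ^+ 2),
      Ex Q (fun w => (\sum_(j < k) a j * Z (t j) w) ^+ 2) = var t a &
      Ex Q (fun w => \sum_(j < k) a j * Z (t j) w) = 0].
Proof.
move=> Ft; apply: gaussian_of_charfun.
  by apply: measurable_sum => j; apply: measurable_funM => //; exact: mZ.
move=> u th; have := charfun_Z (fun j => u * a j) th Ft.
under eq_fun do under eq_bigr do rewrite -mulrA.
under eq_fun do rewrite -mulr_sumr.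
move=> ->; congr (expR (- (_ / 2)) * _).
rewrite /var mulr_sumr; apply: eq_bigr => i _; rewrite mulr_sumr.
by apply: eq_bigr => j _; ring.
Qed.

Let comb1 i : F i -> [/\ integ Q (fun w => Z i w ^+ 2), Ex Q (fun w => Z i w ^+ 2) = c i i
  & Ex Q (Z i) = 0].
Proof.
move=> Fi; have [_] := comb_gaussian (k := 1) (t := fun=> i) (fun=> 1) (fun=> Fi).
have E : (fun w => \sum_(j < 1) 1 * Z i w) = Z i by apply/funext => w; rewrite big_ord1 mul1r.
have E2 : (fun w => (\sum_(j < 1) 1 * Z i w) ^+ 2) = (fun w => Z i w ^+ 2).
  by apply/funext => w; rewrite big_ord1 mul1r.
by rewrite E E2 /var !big_ord1 !mul1r.
Qed.

Let comb2 i j (a b : R) : F i -> F j ->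
  Ex Q (fun w => (a * Z i w + b * Z j w) ^+ 2) =
    a * a * c i i + a * b * c i j + (b * a * c j i + b * b * c j j) /\
  integ Q (fun w => (a * Z i w + b * Z j w) ^+ 2).
Proof.
move=> Fi Fj.
pose t (x : 'I_2) := if x == ord0 then i else j.
pose q (x : 'I_2) := if x == ord0 then a else b.
have Ft x : F (t x) by rewrite /t; case: ifP.
have [_ [i2 e2 _]] := comb_gaussian q Ft.
have E : (fun w => (\sum_(x < 2) q x * Z (t x) w) ^+ 2) =
    (fun w => (a * Z i w + b * Z j w) ^+ 2).
  by apply/funext => w; rewrite !big_ord_recl big_ord0 addr0.
rewrite E in i2 e2; split => //; rewrite e2 /var.
by rewrite !big_ord_recl !big_ord0 !addr0.
Qed.

(** Polarization of the variances of the sum and the difference. *)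
Let cov_Z i j : F i -> F j -> covariance Q (Z i) (Z j) = (c i j)%:E.
Proof.
move=> Fi Fj; have [i1 e1 m1] := comb1 Fi; have [j1 f1 n1] := comb1 Fj.
have [e2 i2] := comb2 1 1 Fi Fj; have [e3 i3] := comb2 1 (-1) Fi Fj.
have E : (fun w => Z i w * Z j w) = (fun w => 4^-1 * (1 * Z i w + 1 * Z j w) ^+ 2 -
    4^-1 * (1 * Z i w + (-1) * Z j w) ^+ 2).
  by apply/funext => w; field.
have iP : integ Q (fun w => Z i w * Z j w).
  by rewrite E; apply: integB; exact: integZ.
rewrite covariance.unlock unlock.
transitivity (\int[Q]_w ((Z i w * Z j w)%:E))%E.
  apply: eq_integral => w _; congr EFin.
  have z k : fine (\int[Q]_x (Z k x)%:E)%E = Ex Q (Z k) by [].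
  by rewrite /= /GRing.mul /= !z m1 n1 !subr0.
rewrite -EFin_Ex//; congr EFin; rewrite E ExB; [|exact: integZ..].
by rewrite !ExZ// e2 e3 (c_sym Fj Fi); field.
Qed.

Let Z_fidi : fidi_cvg F P Zn Q Z.
Proof.
move=> k t Ft g cg [M gM].
pose row n w : 'rV[R]_k := \row_(j < k) Zn n (t j) w.
pose rowZ w : 'rV[R]_k := \row_(j < k) Z (t j) w.
have mrow n : measurable_row (row n).
  by move=> j; under eq_fun do rewrite mxE; exact: mZn.
have mrowZ : measurable_row rowZ.
  by move=> j; under eq_fun do rewrite mxE; exact: mZ.
have cv : cvgn (fun n => Ex P (fun w => g (row n w))).
  apply: (levy_cvg (M := M)) => //.
  - move=> a th.
    have Er : (fun n => Ex P (fun w => cos (rowdot a (row n w) + th))) =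
        (fun n => Ex P (fun w => cos (\sum_(j < k) a ord0 j * Zn n (t j) w + th))).
      apply/funext => n; congr (Ex P _); apply/funext => w; congr (cos (_ + _)).
      by apply: eq_bigr => j _; rewrite mxE.
    rewrite Er; apply/cvg_ex; exists (expR (- (var t (fun j => a ord0 j) / 2)) * cos th).
    exact: charfun_cvg.
  - move=> j e e0; have [L hL] := tight (Ft j) e0; exists L.
    apply: filterS hL => n; rewrite (_ : [set w | L < `|row n w ord0 j|] =
      [set w | L < `|Zn n (t j) w|])//.
    by apply/funext => w /=; rewrite mxE.
have eL : Ex Q (fun w => g (rowZ w)) = lim (Ex P (fun w => g (row n w)) @[n --> \oo]).
  rewrite (Ex_limit (h := fun n w => g (row n w)) (M := M)).
  - by apply: ulimE; apply: cvg_U; exact: cv.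
  - by move=> n; apply: (bddmeas_continuous_row (mrow n) cg gM).1.
  - by move=> n w; exact: gM.
  - exact: (bddmeas_continuous_row mrowZ cg gM).1.
  - apply: (@filterS _ _ ae_filter _ _ _ (Z_cvg Ft)) => w hw.
    apply: (@cvg_comp _ _ _ (fun n => row n (w n)) g _ (nbhs (rowZ w))); last exact: cg.
    move=> B [p hp pB].
    have h : \forall n \near U, forall i j, p i j (row n (w n) i j).
      apply: filter_forall => i; apply: filter_forall => j.
      have hpj : nbhs (Z (t j) w) (p i j) by have := hp i j; rewrite /rowZ mxE.
      have h : \forall n \near U, p i j (Zn n (t j) (w n)) by exact: hw hpj.
      by apply: filterS h => n; rewrite /row mxE.
    by apply: filterS h => n; exact: pB.
have ExE n : ('E_P[fun w => g (row n w)])%E = (Ex P (fun w => g (row n w)))%:E.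
  by rewrite EFin_Ex ?unlock//; exact/bddmeas_integ/bddmeas_continuous_row.
have ExQ : ('E_Q[fun w => g (rowZ w)])%E = (Ex Q (fun w => g (rowZ w)))%:E.
  by rewrite EFin_Ex ?unlock//; exact/bddmeas_integ/bddmeas_continuous_row.
rewrite ExQ; under eq_fun do rewrite ExE.
apply: cvg_EFin; first by apply: nearW => n.
by rewrite eL; exact: cv.
Qed.

(** The expectations of a bounded continuous [g] converge by [levy_cvg], and
    their limit is the limit along [U], which [Ex_limit] computes. *)
Lemma gaussian_limit : centered_gaussian_process Q F c Z /\ fidi_cvg F P Zn Q Z.
Proof.
split; last exact: Z_fidi.
split => [k t a Ft|i Fi|i j Fi Fj]; last exact: cov_Z.
  exact: (comb_gaussian a Ft).1.
have [i2 _ m0] := comb1 Fi.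
have iZ : integ Q (Z i).
  apply: integ_le (mZ Fi) _ (integD (integ_cst Q 1) i2) => w.
  rewrite [leRHS]ger0_norm ?addr_ge0 ?sqr_ge0// -(@real_normK _ (Z i w)) ?num_real//.
  by have := sqr_ge0 (`|Z i w| - 1); have := normr_ge0 (Z i w); nra.
by rewrite unlock -EFin_Ex// m0.
Qed.

End gaussian_limit.

(** * Convergence of the finite-dimensional distributions *)
Theorem theorem2p3 (R : realType) (d : nat) (hd : (0 < d)%N)
  (E : set (d.-tuple R)) (mE : measurable E) (E0 : E (vzero R d))
  (disp : measure_display) (T : measurableType disp) (P : probability T R)
  (X : nat -> nat -> T -> d.-tuple R)
  (mX : forall n i, (1 <= i <= n)%N -> measurable_fun setT (X n i))
  (XE : forall n i w, (1 <= i <= n)%N -> E (X n i w))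
  (Xstat : rowwise_stationary P X)
  (r l : nat -> nat)
  (r_gt0 : forall n, (0 < r n)%N) (l_gt0 : forall n, (0 < l n)%N)
  (l_oo : l n @[n --> \oo] --> \oo)
  (l_r : (fun n => (l n)%:R : R) =o_\oo (fun n => (r n)%:R : R))
  (r_n : (fun n => (r n)%:R : R) =o_\oo (fun n => n%:R : R))
  (rv0 : (r n)%:R * vprob P X n @[n --> \oo] --> (0 : R))
  (nv_oo : n%:R * vprob P X n @[n --> \oo] --> (+oo : set_system R))
  (mixing : (beta_mixing P X n (l n) * (n%:R / (r n)%:R)%:E)%E @[n --> \oo]
              --> (0%E : \bar R))
  (F : set (seq (d.-tuple R) -> R))
  (F_cluster : forall f, F f -> cluster_functional E f)
  (F_int : forall f n, F f -> (l n < r n <= n)%N ->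
     P.-integrable setT (fun w => (f (block X r n 1 w))%:E) /\
     P.-integrable setT (fun w => (Delta X r l n f w)%:E))
  (cond1 : forall f, F f ->
     let Db n w := Delta X r l n f w - fine 'E_P[Delta X r l n f] in
     let s n := Num.sqrt (n%:R * vprob P X n) in
     [/\ elittleo
           (fun n => 'E_P[fun w => ((Db n w) ^+ 2 *
                                    \1_[set w | `|Db n w| <= s n] w)%R]%E)
           (fun n => (r n)%:R * vprob P X n),
         elittleo
           (fun n => 'E_P[fun w => (Db n w * \1_[set w | s n < `|Db n w|] w)%R]%E)
           (fun n => (r n)%:R * Num.sqrt (vprob P X n / n%:R))
       & elittleo
           (fun n => P [set w | s n < `|Db n w|])
           (fun n => (r n)%:R / n%:R)])
  (cond2 : forall (e : R) f, 0 < e -> F f ->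
     let fb n w := f (block X r n 1 w)
                   - fine 'E_P[fun w => f (block X r n 1 w)] in
     elittleo
       (fun n => 'E_P[fun w => ((fb n w) ^+ 2 *
          \1_[set w | e * Num.sqrt (n%:R * vprob P X n) < `|fb n w|] w)%R]%E)
       (fun n => (r n)%:R * vprob P X n))
  (c : (seq (d.-tuple R) -> R) -> (seq (d.-tuple R) -> R) -> R)
  (cond3 : forall f g, F f -> F g ->
     ((((r n)%:R * vprob P X n)^-1)%:E *
      covariance P (fun w => f (block X r n 1 w))
                   (fun w => g (block X r n 1 w)))%E @[n --> \oo]
       --> (c f g)%:E) :
  exists (disp' : measure_display) (T' : measurableType disp')
         (Q : probability T' R) (Z : (seq (d.-tuple R) -> R) -> T' -> R),
    centered_gaussian_process Q F c Z /\
    fidi_cvg F P (Zproc P X r) Q Z.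
Proof.
have F_meas f k : F f -> seq_measurable E k f by move=> /F_cluster[+ _ _]; exact.
have F_cov f g : F f -> F g -> cov_limit P r (vprob P X)
    (fun n w => f (block X r n 1 w)) (fun n w => g (block X r n 1 w)) (c f g).
  exact: cond3.
have c_sym f g : F f -> F g -> c f g = c g f.
  move=> Ff Fg; have h1 := F_cov f g Ff Fg; have := F_cov g f Fg Ff.
  rewrite /cov_limit; under eq_fun do rewrite covarianceC.
  by move=> /(cvg_unique (@ereal_hausdorff R) h1)[].
have F_int' f n : F f -> (l n < r n <= n)%N ->
    integ P (fun w => f (block X r n 1 w)) /\ integ P (Delta X r l n f).
  exact: F_int.
have F_Dvar f (Ff : F f) := let: And3 h _ _ := cond1 f Ff in h.
have F_Dmean f (Ff : F f) := let: And3 _ h _ := cond1 f Ff in h.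
have F_Dtail f (Ff : F f) := let: And3 _ _ h := cond1 f Ff in h.
have mZ n f : F f -> measurable_fun setT (Zproc P X r n f).
  by apply: (measurable_Zproc mE mX XE Xstat r_gt0 F_meas).
have cZ k t a th (tF : forall j : 'I_k, F (t j)) :=
  Zproc_charfun mE mX XE Xstat r_gt0 l_r r_n nv_oo mixing F_meas F_int'
    F_Dvar F_Dmean F_Dtail cond2 F_cov (t := t) (a := a) tF (th := th).
have tZ f : F f -> forall e, 0 < e -> exists L : R,
    \forall n \near \oo, Ex P (\1_[set w | L < `|Zproc P X r n f w|]) <= e.
  move=> Ff e e0.
  have [L hL] := Zproc_tight mE mX XE Xstat r_gt0 l_r r_n nv_oo mixing F_meas
    F_int' F_Dvar F_Dmean F_Dtail cond2 F_cov (t := fun _ : 'I_1 => f)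
    (fun=> 1) (fun=> Ff) e0.
  exists L; apply: filterS hL => n; rewrite (_ : [set w | _ ] =
    [set w | L < `|Zproc P X r n f w|])//.
  by apply/funext => w /=; rewrite big_ord1 mul1r.
have [U [FU Uoo]] := ultraFilterLemma (eventually_filter : ProperFilter \oo).
do 4 eexists; exact: (gaussian_limit mZ c_sym cZ tZ FU Uoo).
Qed.
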